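(* Let $N=2$ or $N\ge 5$, let $1\le\alpha,\beta\le N$ with $\alpha\neq\beta$, and let $c_0\in\mathbb{R}$ be fixed. Write $\partial=\partial(n):=\lceil c_0n^{1/4}\rceil-c_0n^{1/4}$. Then as $n\to\infty$, \begin{multline*} d_{\alpha,\beta;N;c_0n^{1/4}}(n) = e^{\pi\sqrt{n/3}}\, n^{-3/4}\\ \times \left(\frac{1}{8\sqrt[4]{3}} \operatorname{erfc}\left(\frac{c_0\sqrt{\pi N}}{2\sqrt[4]{3}}\right) + \frac{e^{-c_0^2\pi N/(4\sqrt{3})}}{16\sqrt{3N}} \left(\beta-\alpha+N-2N\partial\right) n^{-1/4} + O\left(n^{-1/2}\right)\right). \end{multline*}
   Context: $\mathcal D(n)$ denotes the set of partitions of $n$ into distinct parts $\lambda=(\lambda_1,\dots,\lambda_l)$. For $1\le\alpha,\beta\le N$, $\alpha\neq\beta$, $\operatorname{pd}_{\alpha,\beta;N}(\lambda):=\#\{i:\lambda_i\equiv\alpha \pmod N\}-\#\{i:\lambda_i\equiv\beta\pmod N\}$, and for $c\in\mathbb{R}$, $d_{\alpha,\beta;N;c}(n):=\#\{\lambda\in\mathcal D(n):\operatorname{pd}_{\alpha,\beta;N}(\lambda)\ge c\}$. $\operatorname{erfc}$ is the complementary error function. *)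

(* Defs.v *)
From HB Require Import structures.
From mathcomp Require Import all_boot all_order all_algebra.
From mathcomp Require Import finmap.
From mathcomp Require Import all_classical all_reals all_analysis.

Set Implicit Arguments.
Unset Strict Implicit.
Unset Printing Implicit Defensive.

Import Order.TTheory GRing.Theory Num.Theory.
Import numFieldNormedType.Exports.

Local Open Scope classical_set_scope.
Local Open Scope ring_scope.

Definition distinct_partitions (n : nat) : set (seq nat) :=
  [set lam | [/\ sorted gtn lam, all (leq 1) lam & sumn lam = n]].

(* [fset_set] is junk on infinite sets; this shows that it is used properly
   in [d_pd] below. *)
Lemma finite_distinct_partitions (n : nat) : finite_set (distinct_partitions n).
Proof.
pose s := rev (iota 0 n.+1).
apply: (@sub_finite_set _ _ ((fun m : (size s).-tuple bool => mask m s) @` setT));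
  last exact: finite_image.
move=> lam [slam _ sumlam].
have memlam : {subset lam <= s}.
  move=> x xlam; rewrite mem_rev mem_iota /= add0n ltnS -sumlam.
  by rewrite (perm_sumn (perm_to_rem xlam)) /= leq_addr.
have lamE : lam = [seq x <- s | x \in lam].
  have gtn_tr : transitive gtn by move=> y x z /= yx zy; exact: ltn_trans yx.
  have gtn_irr : irreflexive gtn by move=> x /=; rewrite ltnn.
  apply: (irr_sorted_eq gtn_tr gtn_irr) => //.
  - by apply: (sorted_filter gtn_tr); rewrite rev_sorted; exact: iota_ltn_sorted.
  - move=> x; rewrite mem_filter.
    by case: (boolP (x \in lam)) => //= /memlam ->.
exists (map_tuple (fun x => x \in lam) (in_tuple s)) => //=.
by rewrite -filter_mask -lamE.
Qed.

Definition pd (alpha beta N : nat) (lam : seq nat) : int :=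
  (count (fun i => i == alpha %[mod N]) lam)%:Z
  - (count (fun i => i == beta %[mod N]) lam)%:Z.

Definition d_pd (R : realType) (alpha beta N : nat) (c : R) (n : nat) : nat :=
  #|` fset_set [set lam | distinct_partitions n lam
                          /\ c <= (pd alpha beta N lam)%:~R]|%fset.

Definition erfc (R : realType) (x : R) : R :=
  2 / Num.sqrt pi * \int[lebesgue_measure]_(t in `[x, +oo[) gauss_fun t.

(* Main.v *)
Require Import Defs.
From HB Require Import structures.
From mathcomp Require Import all_boot all_order all_algebra.
From mathcomp Require Import finmap complex.
From mathcomp Require Import all_classical all_reals all_analysis.
From mathcomp Require Import measurable_realfun.
From mathcomp Require Import ring lra zify.

Set Implicit Arguments.
Unset Strict Implicit.
Unset Printing Implicit Defensive.

Import Order.TTheory GRing.Theory Num.Theory.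
Import numFieldNormedType.Exports.

Local Open Scope classical_set_scope.
Local Open Scope ring_scope.

(** Give the part [k] the weight e^{-k tau^2 + eps_k tau}, where [eps_k] is 1, -1
or 0 according as [k] is congruent to alpha, to beta or to neither, so that the
parts become independent Bernoulli variables.  If tau^4 = pi^2/(12 n), the number
of partitions of [n] into distinct parts with [pd = m] is the partition function
times e^{n tau^2 - m tau} times a point probability, that is, a Fourier integral
over [-pi, pi]^2.  The integrand is exponentially small away from the origin (this
can fail for N = 3 and N = 4) and close to a Gaussian near it; the corrections that
are odd in the first variable cancel under phi -> - phi.  Tilting also in the
direction of [pd] makes the error of this local limit theorem decay like
e^{-tau m}, so that summing it over all [m >= c] costs only a factor 1/tau.
Euler-Maclaurin then turns the remaining Gaussian sum over m >= ceil c into the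
complementary error function and its first correction. *)

(** * Derivatives and Taylor bounds *)

(** The theorem asks for relative accuracy tau^2, and its second term has relative size tau. So the
    mean of [pd] is needed with its bounded term [mu0], and the logarithm of the partition function
    up to O(tau^2); for third cumulants orders of magnitude suffice. The classes of alpha and beta
    carry opposite tilts, so cumulants of odd degree in [eps] lose their leading term, and the error
    count depends on the powers of tau gained in this way.

    The tilt moves the mean of [pd] to about 1 / (N tau), a bounded number of standard deviations.
    Undoing it completes a square and recentres the Gaussian at [mu0].

    The constant pi^2 / 12 is the integral of ln (1 + e^{-x}) over [0, +oo). The failure for N = 3
    and N = 4 comes from congruences: if N = 3 and the two classes are 1 and 2, then [pd] is n or -n
    modulo 3; if N = 4 and they are 1 and 3, then [pd] is n modulo 2. The characteristic function
    then has modulus 1 at points far from the origin. *)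

Section Calculus.
Variable R : realType.
Implicit Types (f g u w du dw : R -> R) (x a b : R).

(* Wrapping [is_derive], which is a class, keeps type class resolution from
   closing derivative goals with its own, unnormalized derivatives. *)
Definition der_at f x (d : R) : Prop := is_derive x 1 f d.

Lemma dC (c x : R) : der_at (fun _ => c) x 0.
Proof. exact: is_derive_cst. Qed.
Lemma dI x : der_at (fun y => y) x 1.
Proof. exact: is_derive_id. Qed.
Lemma dD f g x (df dg : R) : der_at f x df -> der_at g x dg ->
  der_at (fun y => f y + g y) x (df + dg).
Proof. exact: is_deriveD. Qed.
Lemma dN f x (df : R) : der_at f x df -> der_at (fun y => - f y) x (- df).
Proof. exact: is_deriveN. Qed.
Lemma dM f g x (df dg : R) : der_at f x df -> der_at g x dg ->
  der_at (fun y => f y * g y) x (f x * dg + g x * df).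
Proof. exact: is_deriveM. Qed.
Lemma der_eq f x (d e : R) : der_at f x d -> d = e -> der_at f x e.
Proof. by move=> h <-. Qed.
Lemma dX f n x (df : R) : der_at f x df ->
  der_at (fun y => f y ^+ n) x (n%:R * f x ^+ n.-1 * df).
Proof.
move=> h; elim: n => [|n IH].
  by apply: (der_eq (dC 1 x)); rewrite !mul0r.
have -> : (fun y => f y ^+ n.+1) = (fun y => f y * f y ^+ n) by apply/funext => y; rewrite exprS.
apply: (der_eq (dM h IH)).
case: n {IH} => [|n] /=; first by rewrite expr0; ring.
have -> : n.+2%:R = 1 + n.+1%:R :> R by rewrite addrC natr1.
by rewrite /= exprS; ring.
Qed.
Lemma dV f x (df : R) : f x != 0 -> der_at f x df ->
  der_at (fun y => (f y)^-1) x (- f x ^- 2 * df).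
Proof. exact: is_deriveV. Qed.
Lemma dcomp f g x (df dg : R) : der_at f (g x) df -> der_at g x dg ->
  der_at (fun y => f (g y)) x (df * dg).
Proof. exact: is_derive1_comp. Qed.
Lemma dsum (I : Type) (r : seq I) (F : I -> R -> R) (D : I -> R) x :
  (forall i, der_at (F i) x (D i)) ->
  der_at (fun y => \sum_(i <- r) F i y) x (\sum_(i <- r) D i).
Proof.
move=> h; elim: r => [|i r IH].
  by rewrite big_nil; under eq_fun do rewrite big_nil; exact: dC.
by rewrite big_cons; under eq_fun do rewrite big_cons; exact: dD.
Qed.
Lemma dexp x : der_at expR x (expR x).
Proof. exact: is_derive_expR. Qed.
Lemma dcos x : der_at cos x (- sin x).
Proof. exact: is_derive_cos. Qed.
Lemma dsin x : der_at sin x (cos x).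
Proof. exact: is_derive_sin. Qed.
Lemma dln x : 0 < x -> der_at (@ln R) x x^-1.
Proof. exact: is_derive1_ln. Qed.

Lemma derive_cont f x (df : R) : der_at f x df -> {for x, continuous f}.
Proof. by move=> [h _]; apply/differentiable_continuous/derivable1_diffP. Qed.

Lemma derive_within f df a b :
  (forall x, a <= x <= b -> der_at f x (df x)) -> {within `[a, b], continuous f}.
Proof.
move=> h; apply: derivable_within_continuous => x; rewrite in_itv /= => xab.
by have [] := h x xab.
Qed.

(** The mean value theorem for [w - u]. With [abs_increment] it stands in for integration: the
    Taylor bounds below compare a remainder with its majorant through their derivatives, one order
    at a time. *)
Lemma le_increment u w du dw a b : a <= b ->
  (forall x, a <= x <= b -> der_at u x (du x)) ->
  (forall x, a <= x <= b -> der_at w x (dw x)) ->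
  (forall x, a <= x <= b -> du x <= dw x) -> u b - u a <= w b - w a.
Proof.
move=> ab hu hw le.
have hwu x : a <= x <= b -> der_at (fun y => w y - u y) x (dw x - du x).
  by move=> xab; apply: dD; [exact: hw | apply: dN; exact: hu].
have [||c cab] := MVT_segment (f := fun y => w y - u y) (df := fun y => dw y - du y) ab.
- by move=> x; rewrite in_itv /= => /andP[ax xb]; apply: hwu; rewrite !ltW.
- exact: derive_within hwu.
have : 0 <= (dw c - du c) * (b - a).
  by apply: mulr_ge0; rewrite subr_ge0 //; apply: le; move: cab; rewrite in_itv.
move=> h1 h2; move: h1; rewrite -h2; lra.
Qed.

Lemma abs_increment u w du dw a b : a <= b ->
  (forall x, a <= x <= b -> der_at u x (du x)) ->
  (forall x, a <= x <= b -> der_at w x (dw x)) ->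
  (forall x, a <= x <= b -> `|du x| <= dw x) -> `|u b - u a| <= w b - w a.
Proof.
move=> ab hu hw le; rewrite ler_norml; apply/andP; split; last first.
  by apply: (le_increment ab hu hw) => x /le; rewrite ler_norml => /andP[].
have : (- u b) - (- u a) <= w b - w a; last lra.
apply: (le_increment (u := fun y => - u y) (du := fun y => - du y) ab _ hw).
  by move=> x /hu ?; exact: dN.
by move=> x /le; rewrite ler_norml => /andP[]; lra.
Qed.
End Calculus.

Ltac der_step :=
  match goal with
  | H : der_at ?f ?x _ |- der_at ?f ?x _ => exact H
  | |- der_at (fun _ => ?c) _ _ => exact: dC
  | |- der_at (fun y => y) _ _ => exact: dI
  | |- der_at (fun y => @?f y + @?g y) _ _ => apply: (@dD _ f g)
  | |- der_at (fun y => - @?f y) _ _ => apply: (@dN _ f)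
  | |- der_at (fun y => @?f y * @?g y) _ _ => apply: (@dM _ f g)
  | |- der_at (fun y => @?f y ^+ ?n) _ _ => apply: (@dX _ f n)
  | |- der_at (fun y => (@?f y)^-1) _ _ => apply: (@dV _ f)
  | |- der_at (fun y => expR (@?g y)) _ _ => apply: (@dcomp _ expR g); [exact: dexp|]
  | |- der_at (fun y => cos (@?g y)) _ _ => apply: (@dcomp _ cos g); [exact: dcos|]
  | |- der_at (fun y => sin (@?g y)) _ _ => apply: (@dcomp _ sin g); [exact: dsin|]
  | |- der_at (fun y => ln (@?g y)) _ _ => apply: (@dcomp _ (@ln _) g); [apply: dln|]
  | |- der_at expR _ _ => exact: dexp
  | |- der_at cos _ _ => exact: dcos
  | |- der_at sin _ _ => exact: dsin
  end.
(** Reads a derivative off the syntax of the function. The comparison with the stated derivative is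
    left as an equation, after side conditions such as positivity under [ln]. *)
Ltac der := eapply der_eq; [repeat der_step|cbn beta; rewrite /=].

Section Taylor.
Variable R : realType.
Implicit Types (x y : R).

Lemma exprn_le_expR n x : 0 <= x -> x ^+ n <= n`!%:R * expR x.
Proof.
elim: n x => [|n IH] x x0; first by rewrite expr0 mul1r -expR0 ler_expR.
have := @le_increment R (fun y => y ^+ n.+1) (fun y => n.+1`!%:R * expR y)
  (fun y => n.+1%:R * y ^+ n) (fun y => n.+1`!%:R * expR y) 0 x x0.
rewrite expr0n /= subr0 expR0 => h.
have : x ^+ n.+1 <= n.+1`!%:R * expR x - n.+1`!%:R * 1.
  apply: h => y /andP[y0 _].
  - by der; rewrite mulr1.
  - by der; ring.
  - by rewrite factS natrM -mulrA ler_pM2l ?ltr0n // IH.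
have : (0 : R) <= n.+1`!%:R by rewrite ler0n.
lra.
Qed.

Lemma sin_abs_ge0 x : 0 <= x -> `|sin x| <= x.
Proof.
move=> x0; have := @abs_increment R sin id cos (fun=> 1) 0 x x0.
rewrite sin0 !subr0; apply => y _; [exact: dsin | exact: dI | exact: cos_max].
Qed.

Lemma sin_abs x : `|sin x| <= `|x|.
Proof.
by have [x0|x0] := ger0P x; [exact: sin_abs_ge0 | rewrite -normrN -sinN; apply: sin_abs_ge0; lra].
Qed.

Lemma cos_even_le (P : R -> R) (Q : R -> R) : (forall x, P (- x) = P x) -> (forall x, Q (- x) = Q x) ->
  (forall x, 0 <= x -> P x <= Q x) -> forall x, P x <= Q x.
Proof.
move=> hP hQ h x; have [x0|x0] := leP 0 x; first exact: h.
by rewrite -hP -hQ; apply: h; lra.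
Qed.

Lemma cos_taylor2 x : `|1 - cos x| <= x ^+ 2 / 2.
Proof.
move: x; apply: cos_even_le => [x|x|x x0]; rewrite ?cosN ?sqrrN //.
have := @abs_increment R (fun y => 1 - cos y) (fun y => y ^+ 2 / 2) sin id 0 x x0.
rewrite cos0 subrr subr0 expr0n /= mul0r subr0; apply => y /andP[y0 _].
- by der; ring.
- by der; rewrite /=; field.
- exact: sin_abs_ge0.
Qed.

Lemma sin_taylor3_ge0 x : 0 <= x -> `|x - sin x| <= x ^+ 3 / 6.
Proof.
move=> x0; have := @abs_increment R (fun y => y - sin y) (fun y => y ^+ 3 / 6) (fun y => 1 - cos y) (fun y => y ^+ 2 / 2) 0 x x0.
rewrite sin0 subr0 expr0n /= mul0r !subr0; apply => y /andP[y0 _].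
- by der; ring.
- by der; rewrite /=; field.
- exact: cos_taylor2.
Qed.

Lemma cos_taylor4 x : `|cos x - 1 + x ^+ 2 / 2| <= x ^+ 4 / 24.
Proof.
move: x; apply: cos_even_le => [x|x|x x0]; rewrite ?cosN ?sqrrN //; first by congr (_ / _); ring.
have := @abs_increment R (fun y => cos y - 1 + y ^+ 2 / 2) (fun y => y ^+ 4 / 24) (fun y => y - sin y) (fun y => y ^+ 3 / 6) 0 x x0.
rewrite cos0 subrr !expr0n /= !mul0r !addr0 !subr0; apply => y /andP[y0 _].
- by der; rewrite /=; field.
- by der; rewrite /=; field.
- exact: sin_taylor3_ge0.
Qed.

(** Near 0 this is weaker than [cos_taylor4], but it has the order that integrates to the x^4 / 24
    of [sin_taylor4]. *)
Lemma cos_taylor3 x : 0 <= x -> `|cos x - 1 + x ^+ 2 / 2| <= x ^+ 3 / 6.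
Proof.
move=> x0.
have := @abs_increment R (fun y => cos y - 1 + y ^+ 2 / 2) (fun y => y ^+ 3 / 6) (fun y => y - sin y) (fun y => y ^+ 2 / 2) 0 x x0.
rewrite cos0 subrr !expr0n /= !mul0r !addr0 !subr0; apply => y /andP[y0 _].
- by der; rewrite /=; field.
- by der; rewrite /=; field.
have := @abs_increment R (fun y => y - sin y) (fun y => y ^+ 2 / 2) (fun y => 1 - cos y) id 0 y y0.
rewrite sin0 subr0 expr0n /= mul0r !subr0; apply => z /andP[z0 _].
- by der; ring.
- by der; rewrite /=; field.
have := @abs_increment R (fun y => 1 - cos y) id sin (fun=> 1) 0 z z0.
rewrite cos0 subrr !subr0; apply => s /andP[s0 _].
- by der; ring.
- exact: dI.
- exact: sin_max.
Qed.

Lemma sin_taylor4 x : `|sin x - x + x ^+ 3 / 6| <= x ^+ 4 / 24.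
Proof.
have h y : 0 <= y -> `|sin y - y + y ^+ 3 / 6| <= y ^+ 4 / 24.
  move=> y0.
  have := @abs_increment R (fun y => sin y - y + y ^+ 3 / 6) (fun y => y ^+ 4 / 24) (fun y => cos y - 1 + y ^+ 2 / 2) (fun y => y ^+ 3 / 6) 0 y y0.
  rewrite sin0 subrr !expr0n /= !mul0r !addr0 !subr0; apply => z /andP[z0 _].
  - by der; rewrite /=; field.
  - by der; rewrite /=; field.
  - exact: cos_taylor3.
have [x0|x0] := leP 0 x; first exact: h.
rewrite -normrN; have := h (- x); rewrite sinN.
have -> : - sin x - - x + (- x) ^+ 3 / 6 = - (sin x - x + x ^+ 3 / 6) by ring.
have -> : (- x) ^+ 4 = x ^+ 4 by ring.
by apply; lra.
Qed.

(** From [cos_taylor4], because x^4 / 24 <= x^2 / 4 for |x| <= 1. The Gaussian decay of the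
    Bernoulli factors near the origin rests on it. *)
Lemma cos_gap x : `|x| <= 1 -> x ^+ 2 / 4 <= 1 - cos x.
Proof.
move=> x1; have := cos_taylor4 x; rewrite ler_norml => /andP[_ h].
have x2 : x ^+ 2 <= 1 by rewrite -real_normK ?num_real // expr_le1.
have : x ^+ 4 <= x ^+ 2.
  have -> : x ^+ 4 = x ^+ 2 * x ^+ 2 by ring.
  by rewrite -[leRHS]mulr1 ler_wpM2l // sqr_ge0.
have := sqr_ge0 x; lra.
Qed.

(** The factor e^{max(0, x)} bounds the exponential between 0 and x, whatever the sign of x. *)
Lemma expR_taylor2 x : `|expR x - 1 - x| <= x ^+ 2 / 2 * expR (Num.max 0 x).
Proof.
have [x0|x0] := leP 0 x.
- have := @abs_increment R (fun y => expR y - 1 - y) (fun y => y ^+ 2 / 2 * expR x) (fun y => expR y - 1) (fun y => y * expR x) 0 x x0.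
  rewrite expR0 !subrr expr0n /= !mul0r !subr0; apply => y /andP[y0 yx].
  - by der; ring.
  - by der; rewrite /=; field.
  have := @abs_increment R (fun y => expR y - 1) (fun y => y * expR x) expR (fun y => expR x) 0 y y0.
  rewrite expR0 subrr mul0r !subr0; apply => z /andP[z0 zy].
  - by der; ring.
  - by der; ring.
  by rewrite ger0_norm ?expR_ge0 // ler_expR (le_trans zy).
- rewrite expR0 mulr1.
  have := @abs_increment R (fun y => expR (- y) - 1 + y) (fun y => y ^+ 2 / 2) (fun y => 1 - expR (- y)) (fun y => y) 0 (- x).
  rewrite oppr0 expR0 subrr expr0n /= !mul0r !addr0 !subr0 opprK sqrrN; apply => [|y /andP[y0 yx]|y /andP[y0 yx]|y /andP[y0 yx]].
  - lra.
  - by der; ring.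
  - by der; rewrite /=; field.
  have := expR_ge1Dx (- y); have : expR (- y) <= 1 by rewrite -expR0 ler_expR; lra.
  by move=> h1 h2; rewrite ger0_norm; lra.
Qed.

Lemma expR_taylor1 x : `|expR x - 1| <= `|x| * expR (Num.max 0 x).
Proof.
have [x0|x0] := leP 0 x.
- have := @abs_increment R (fun y => expR y - 1) (fun y => y * expR x) expR (fun y => expR x) 0 x x0.
  rewrite expR0 subrr mul0r !subr0 (ger0_norm x0); apply => z /andP[z0 zy].
  - by der; ring.
  - by der; ring.
  by rewrite ger0_norm ?expR_ge0 // ler_expR.
- rewrite expR0 mulr1 (ltr0_norm x0) ler0_norm; last by rewrite subr_le0 -expR0 ler_expR ltW.
  have := expR_ge1Dx x; lra.
Qed.

End Taylor.

(** * Complex exponentials *)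

Section Complex.
Variable R : realType.
Local Open Scope complex_scope.
Local Notation Re := complex.Re.
Local Notation Im := complex.Im.
Local Notation normc := Normc.normc.
Implicit Types (z w : R[i]) (x y a b : R).

(** The modulus as an element of [R]; the norm of [R[i]] has its values in [R[i]]. *)
Definition cabs z : R := Num.sqrt (Re z ^+ 2 + Im z ^+ 2).

Lemma cabsE z : cabs z = normc z.
Proof. by case: z. Qed.

Lemma cabs_ge0 z : 0 <= cabs z. Proof. exact: sqrtr_ge0. Qed.

Lemma cabsM z w : cabs (z * w) = cabs z * cabs w.
Proof. by rewrite !cabsE Normc.normcM. Qed.

Lemma cabsD z w : cabs (z + w) <= cabs z + cabs w.
Proof. by rewrite !cabsE le_normcD. Qed.

Lemma cabsN z : cabs (- z) = cabs z.
Proof. by rewrite !cabsE normcN. Qed.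

Lemma cabsB z w : cabs (z - w) <= cabs z + cabs w.
Proof. by rewrite -(cabsN w); exact: cabsD. Qed.

Lemma cabs_real x : cabs x%:C = `|x|.
Proof. by rewrite /cabs /= expr0n addr0 sqrtr_sqr. Qed.

Lemma Re_cabs z : `|Re z| <= cabs z.
Proof. by rewrite -sqrtr_sqr ler_wsqrtr // lerDl sqr_ge0. Qed.

Lemma cabs_le_ReIm z : cabs z <= `|Re z| + `|Im z|.
Proof.
case: z => a b; rewrite -(ger0_norm (addr_ge0 (normr_ge0 a) (normr_ge0 b))) /= -sqrtr_sqr.
apply: ler_wsqrtr; rewrite /= sqrrD !real_normK ?num_real //.
have := mulr_ge0 (normr_ge0 a) (normr_ge0 b); lra.
Qed.

Lemma cabs_sqr z : cabs z ^+ 2 = Re z ^+ 2 + Im z ^+ 2.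
Proof. by rewrite sqr_sqrtr // addr_ge0 ?sqr_ge0. Qed.

Lemma cabs_prod (I : Type) (r : seq I) (P : pred I) (F : I -> R[i]) :
  cabs (\prod_(i <- r | P i) F i) = \prod_(i <- r | P i) cabs (F i).
Proof.
by apply: (big_morph cabs cabsM); rewrite /cabs /= expr1n expr0n addr0 sqrtr1.
Qed.

Definition cexp z : R[i] := (expR (Re z) * cos (Im z)) +i* (expR (Re z) * sin (Im z)).

Lemma cexpD z w : cexp (z + w) = cexp z * cexp w.
Proof.
case: z => a b; case: w => c d; rewrite /cexp /= expRD cosD sinD.
by apply/eqP; rewrite eq_complex /=; apply/andP; split; apply/eqP; ring.
Qed.

Lemma cexp0 : cexp 0 = 1.
Proof. by rewrite /cexp /= expR0 cos0 sin0 mulr1 mulr0. Qed.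

Lemma cabs_cexp z : cabs (cexp z) = expR (Re z).
Proof.
rewrite /cabs /cexp /= !exprMn -mulrDr cos2Dsin2 mulr1 sqrtr_sqr ger0_norm ?expR_ge0 //.
Qed.

Lemma cexp_sum (I : Type) (r : seq I) (P : pred I) (F : I -> R[i]) :
  cexp (\sum_(i <- r | P i) F i) = \prod_(i <- r | P i) cexp (F i).
Proof. exact: (big_morph cexp cexpD cexp0). Qed.

Lemma Re_sum (I : Type) (r : seq I) (P : pred I) (F : I -> R[i]) :
  Re (\sum_(i <- r | P i) F i) = \sum_(i <- r | P i) Re (F i).
Proof. by apply: (big_morph (@Re R)) => // [[? ?] [? ?]]. Qed.

Lemma Im_sum (I : Type) (r : seq I) (P : pred I) (F : I -> R[i]) :
  Im (\sum_(i <- r | P i) F i) = \sum_(i <- r | P i) Im (F i).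
Proof. by apply: (big_morph (@Im R)) => // [[? ?] [? ?]]. Qed.

Definition expi x : R[i] := cexp (0 +i* x).

Lemma expiE x : expi x = cos x +i* sin x.
Proof. by rewrite /expi /cexp /= expR0 !mul1r. Qed.

Lemma expiD x y : expi (x + y) = expi x * expi y.
Proof. by rewrite /expi -cexpD; congr cexp; apply/eqP; rewrite eq_complex /= addr0 !eqxx. Qed.

Lemma cabs_expi x : cabs (expi x) = 1.
Proof. by rewrite cabs_cexp expR0. Qed.

Lemma expi_gap x : cabs (expi x - 1) ^+ 2 = 2 * (1 - cos x).
Proof. by rewrite cabs_sqr expiE /=; have := cos2Dsin2 x; rewrite oppr0 addr0; nra. Qed.

Lemma expi_taylor4 x :
  cabs (expi x - ((1 - x ^+ 2 / 2) +i* (x - x ^+ 3 / 6))) <= x ^+ 4 / 12.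
Proof.
apply: (le_trans (cabs_le_ReIm _)); rewrite expiE /=.
have := cos_taylor4 x; have := sin_taylor4 x.
have -> : cos x - (1 - x ^+ 2 / 2) = cos x - 1 + x ^+ 2 / 2 by ring.
have -> : sin x - (x - x ^+ 3 / 6) = sin x - x + x ^+ 3 / 6 by ring.
lra.
Qed.

Lemma cexp_taylor2 z : cabs (cexp z - 1 - z) <= 3 * cabs z ^+ 2 * expR (Num.max 0 (Re z)).
Proof.
case: z => a b; rewrite cabs_sqr /=; set E := expR _.
have E1 : 1 <= E by rewrite -expR0 ler_expR le_max lexx.
have Ea : expR a <= E by rewrite ler_expR le_max lexx orbT.
have ha := expR_taylor2 a; have ha1 := expR_taylor1 a.
have hc := cos_taylor2 b; have hs := sin_abs b.
have hs2 : `|sin b - b| <= b ^+ 2 / 2.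
  have h y : 0 <= y -> `|y - sin y| <= y ^+ 2 / 2.
    move=> y0; have := @abs_increment R (fun y => y - sin y) (fun y => y ^+ 2 / 2) (fun y => 1 - cos y) (fun y => y) 0 y y0.
    rewrite sin0 subr0 expr0n /= mul0r !subr0; apply => z /andP[z0 _].
    - by der; ring.
    - by der; field.
    have := @abs_increment R (fun y => 1 - cos y) (fun y => y) sin (fun=> 1) 0 z z0.
    rewrite cos0 subrr !subr0; apply => s /andP[s0 _].
    - by der; ring.
    - exact: dI.
    - exact: sin_max.
  have [b0|b0] := leP 0 b; first by rewrite distrC; exact: h.
  have := h (- b); rewrite sinN sqrrN opprK addrC; apply; lra.
(* The remainder is made of second-order remainders of [expR], [cos] and [sin], and of the product b
   (e^a - 1). *)
have -> : cexp (a +i* b) - 1 - (a +i* b) =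
   (expR a - 1 - a - expR a * (1 - cos b)) +i* (expR a * (sin b - b) + b * (expR a - 1)).
  by apply/eqP; rewrite eq_complex /=; apply/andP; split; apply/eqP; ring.
apply: (le_trans (cabs_le_ReIm _)) => /=.
have ea0 : 0 <= expR a := expR_ge0 a.
have a1 : `|expR a * (1 - cos b)| <= E * (b ^+ 2 / 2).
  by rewrite normrM (ger0_norm ea0); apply: ler_pM.
have a2 : `|expR a * (sin b - b)| <= E * (b ^+ 2 / 2).
  by rewrite normrM (ger0_norm ea0); apply: ler_pM.
have a3 : `|b * (expR a - 1)| <= E * ((a ^+ 2 + b ^+ 2) / 2).
  rewrite normrM; apply: (@le_trans _ _ (`|b| * (`|a| * E))); first exact: ler_wpM2l.
  rewrite mulrA mulrC ler_wpM2l ?expR_ge0 //.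
  rewrite -(real_normK (num_real a)) -(real_normK (num_real b)).
  have := sqr_ge0 (`|a| - `|b|); nra.
have := ler_normB (expR a - 1 - a) (expR a * (1 - cos b)).
have := ler_normD (expR a * (sin b - b)) (b * (expR a - 1)).
have X0 : 0 <= a ^+ 2 * E by rewrite mulr_ge0 ?sqr_ge0 // expR_ge0.
have Y0 : 0 <= b ^+ 2 * E by rewrite mulr_ge0 ?sqr_ge0 // expR_ge0.
move: ha a1 a2 a3; rewrite -/E; lra.
Qed.

(** Telescoping: the factors are exchanged one at a time while all others are bounded by e^{-W}. The
    total e^{- sum W} includes the exchanged index, hence the compensating [expR (W k)]. *)
Lemma cabs_prod_diff n (A B : nat -> R[i]) (W : nat -> R) :
  (forall k, (k < n)%N -> cabs (A k) <= expR (- W k)) ->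
  (forall k, (k < n)%N -> cabs (B k) <= expR (- W k)) ->
  cabs (\prod_(k < n) A k - \prod_(k < n) B k) <=
  \sum_(k < n) cabs (A k - B k) * expR (W k) * expR (- \sum_(k < n) W k).
Proof.
elim: n => [|n IH] hA hB.
  by rewrite !big_ord0 subrr /cabs /= expr0n addr0 sqrtr0.
rewrite !big_ord_recr /=.
have -> : \prod_(k < n) A k * A n - \prod_(k < n) B k * B n =
  (\prod_(k < n) A k - \prod_(k < n) B k) * A n + \prod_(k < n) B k * (A n - B n) by ring.
apply: (le_trans (cabsD _ _)); rewrite !cabsM cabs_prod; apply: lerD.
  apply: (le_trans (ler_pM (cabs_ge0 _) (cabs_ge0 _) (IH _ _) (hA n _))) => //.
  - by move=> k kn; apply: hA; rewrite ltnW.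
  - by move=> k kn; apply: hB; rewrite ltnW.
  by rewrite mulr_suml; apply: ler_sum => i _; rewrite -!mulrA -!expRD opprD.
rewrite -mulrA mulrC ler_wpM2l ?cabs_ge0 //.
rewrite -expRD opprD addrCA subrr addr0 -sumrN expR_sum.
by apply: ler_prod => i _; rewrite cabs_ge0 hB // ltnS ltnW.
Qed.
End Complex.

(** * The Fermi function and its antiderivatives *)

Section Fermi.
Variable R : realType.
Implicit Types (x y t e : R).

(* Mean, variance and third cumulant of a Bernoulli variable with odds e^{-x};
   [lexp] is the logarithm of its normalizing constant.  Each is minus the
   derivative of its predecessor in the list [lexp], [ferm], [fvar], [fskew]. *)
Definition ferm x : R := (1 + expR x)^-1.
Definition fvar x : R := ferm x * (1 - ferm x).
Definition fskew x : R := fvar x * (1 - 2 * ferm x).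
Definition lexp x : R := ln (1 + expR (- x)).

Lemma onepexp_gt0 x : 0 < 1 + expR x. Proof. by have := expR_gt0 x; lra. Qed.
Hint Resolve onepexp_gt0 : core.
Lemma onepexp_neq0 x : 1 + expR x != 0. Proof. by rewrite gt_eqF. Qed.
Hint Resolve onepexp_neq0 : core.

Lemma ferm_gt0 x : 0 < ferm x. Proof. by rewrite invr_gt0. Qed.
Lemma ferm_lt1 x : ferm x < 1.
Proof. by rewrite invf_lt1 //; have := expR_gt0 x; lra. Qed.
Lemma fermN x : ferm (- x) = 1 - ferm x.
Proof.
rewrite /ferm expRN; have := expR_gt0 x; have := onepexp_neq0 x => h1 h2.
field; rewrite h1 gt_eqF //; rewrite ?andbT //; try lra.
Qed.
Lemma ferm_le_exp x : ferm x <= expR (- x).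
Proof. by rewrite /ferm expRN lef_pV2 ?posrE ?expR_gt0 //; have := expR_gt0 x; lra. Qed.
Lemma fvar_gt0 x : 0 < fvar x.
Proof. by rewrite mulr_gt0 ?ferm_gt0 // subr_gt0 ferm_lt1. Qed.
Lemma fvar_le_exp x : fvar x <= expR (- x).
Proof.
apply: le_trans (ferm_le_exp x); rewrite /fvar; have := ferm_gt0 x; have := ferm_lt1 x; nra.
Qed.
Lemma fvar_le1 x : fvar x <= 1 / 4.
Proof. rewrite /fvar; have := sqr_ge0 (ferm x - 1 / 2); nra. Qed.
Lemma fvarN x : fvar (- x) = fvar x.
Proof. by rewrite /fvar fermN; ring. Qed.
Lemma fskew_abs x : `|fskew x| <= fvar x.
Proof.
rewrite /fskew normrM (ger0_norm (ltW (fvar_gt0 x))) -[leRHS]mulr1.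
apply: ler_wpM2l; first exact/ltW/fvar_gt0.
by rewrite ler_norml; have := ferm_gt0 x; have := ferm_lt1 x; lra.
Qed.

Lemma dferm x : der_at ferm x (- fvar x).
Proof.
rewrite /ferm; der; first by [].
rewrite /fvar /ferm; field; exact: onepexp_neq0.
Qed.
Lemma dfvar x : der_at fvar x (- fskew x).
Proof.
have h := dferm x; rewrite /fvar; der.
by rewrite /fskew /fvar; ring.
Qed.
Lemma dlexp x : der_at lexp x (- ferm x).
Proof.
rewrite /lexp; der; first exact: onepexp_gt0.
rewrite /ferm expRN; have := expR_gt0 x => h.
field; have := onepexp_gt0 x => h1; rewrite !gt_eqF //; lra.
Qed.
Lemma lexpN x : lexp (- x) = lexp x + x.
Proof.
rewrite /lexp opprK -[in X in _ = _ + X](expRK x) -lnM ?posrE ?onepexp_gt0 ?expR_gt0 //.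
by rewrite mulrDl mul1r -expRD addNr expR0 addrC.
Qed.
Lemma lexp_ge0 x : 0 <= lexp x.
Proof. by rewrite ln_ge0 // lerDl expR_ge0. Qed.
Lemma lexp_le_exp x : lexp x <= expR (- x).
Proof. by apply: le_ln1Dx; have := expR_gt0 (- x); lra. Qed.
Lemma exp_lexp x : expR (lexp x) = 1 + expR (- x).
Proof. by rewrite lnK // posrE onepexp_gt0. Qed.
Lemma ferm0 : ferm 0 = 1 / 2. Proof. by rewrite /ferm expR0; field. Qed.
Lemma lexp0 : lexp 0 = ln 2. Proof. by rewrite /lexp oppr0 expR0. Qed.
End Fermi.

(** * Partial sums of Euler's series for pi^2 / 8, pi^2 / 6 and pi^2 / 12 *)

Section Basel.
Variable R : realType.
Implicit Types (x : R).

Lemma sin_ge_xcos x : 0 <= x <= pi / 2 -> x * cos x <= sin x.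
Proof.
move=> /andP[x0 x2].
have := @le_increment R (fun=> 0) (fun y => sin y - y * cos y) (fun=> 0) (fun y => y * sin y) 0 x x0.
rewrite sin0 mul0r !subr0 => h.
have : 0 <= sin x - x * cos x; last lra.
apply: h => y /andP[y0 yx]; [exact: dC | by der; ring | ].
by rewrite mulr_ge0 // sin_ge0_pi // y0 /=; have := @pi_gt0 R; lra.
Qed.

(** The squared reciprocals of sin x <= x <= tan x, since 1 / sin^2 - 1 = cot^2. *)
Lemma inv_sin2_bounds x : 0 < x < pi / 2 ->
  (sin x ^+ 2)^-1 - 1 <= (x ^+ 2)^-1 <= (sin x ^+ 2)^-1.
Proof.
move=> /andP[x0 x2]; have p0 := @pi_gt0 R.
have s0 : 0 < sin x by apply: sin_gt0_pi; rewrite x0 /=; lra.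
have c0 : 0 < cos x by apply: cos_gt0_pihalf; apply/andP; split; lra.
have sx : sin x <= x by have := sin_abs_ge0 (ltW x0); rewrite ger0_norm // ltW.
have xc : x * cos x <= sin x by apply: sin_ge_xcos; rewrite !ltW.
have cs := cos2Dsin2 x.
apply/andP; split; last first.
  by rewrite lef_pV2 ?posrE ?exprn_gt0 // lerXn2r // nnegrE; apply: ltW.
have -> : (sin x ^+ 2)^-1 - 1 = (cos x / sin x) ^+ 2.
  have -> : (cos x / sin x) ^+ 2 = (1 - sin x ^+ 2) / sin x ^+ 2.
    by rewrite -cs addrK; field; rewrite gt_eqF.
  by field; rewrite gt_eqF.
have sx0 : cos x / sin x <= x^-1 by rewrite ler_pdivrMr // ler_pdivlMl.
rewrite -exprVn; apply: lerXn2r => //; rewrite nnegrE ?invr_ge0; last exact: ltW.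
by rewrite divr_ge0 // ltW.
Qed.

(* Angles for the elementary proof of Euler's pi^2/8: since
   1/sin^2 x + 1/cos^2 x = 4/sin^2 (2 x), the sum of [1 / sin (sinpt n k) ^ 2] over
   [k < 2 ^ n] is multiplied by 4 when [n] grows by 1. *)
Definition sinpt (n k : nat) : R := (2 * k%:R + 1) * pi / 2 ^+ n.+2.

Lemma sinpt_bound n k : (k < 2 ^ n)%N -> 0 < sinpt n k < pi / 2.
Proof.
move=> kn; have p0 := @pi_gt0 R; rewrite /sinpt; apply/andP; split.
  by rewrite divr_gt0 ?exprn_gt0 // mulr_gt0 //; have := ler0n R k; lra.
have : k%:R + 1 <= 2 ^+ n :> R by rewrite natr1 -natrX ler_nat.
have q0 : 0 < 2 ^+ n :> R by rewrite exprn_gt0.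
by rewrite ltr_pdivrMr ?exprn_gt0 // !exprS => h; nra.
Qed.

(** Pairs k with 2m - 1 - k. For m = 2^n the corresponding angles [sinpt n.+1] add up to pi / 2, so
    that [inv_sin2_half] applies to each pair. *)
Lemma sum_fold (m : nat) (F : nat -> R) :
  \sum_(k < m + m) F k = \sum_(k < m) (F k + F (m + (m - k.+1))%N).
Proof.
rewrite big_split_ord /= big_split /=; congr (_ + _).
by rewrite (reindex_inj rev_ord_inj).
Qed.

Lemma inv_sin2_half (y : R) : sin y != 0 -> cos y != 0 ->
  (sin y ^+ 2)^-1 + (sin (pi / 2 - y) ^+ 2)^-1 = 4 * (sin (2 * y) ^+ 2)^-1.
Proof.
move=> s0 c0.
have -> : sin (pi / 2 - y) = cos y.
  by rewrite -[RHS]cosN -sinDpihalf; congr sin; ring.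
have -> : 2 * y = y *+ 2 by ring.
rewrite sin_mulr2n; have := cos2Dsin2 y => h.
have -> : (sin y ^+ 2)^-1 + (cos y ^+ 2)^-1 = (cos y ^+ 2 + sin y ^+ 2) / (sin y ^+ 2 * cos y ^+ 2).
  by field; rewrite s0 c0.
by rewrite h; field; rewrite s0 c0.
Qed.

Lemma sum_inv_sin2 n : \sum_(k < 2 ^ n) (sin (sinpt n k) ^+ 2)^-1 = 2 * 4 ^+ n.
Proof.
have p0 := @pi_gt0 R.
elim: n => [|n IH].
  rewrite expn0 big_ord_recl big_ord0 addr0 expr0 mulr1 /sinpt /=.
  have -> : (2 * 0%:R + 1) * pi / 2 ^+ 2 = pi / 4 :> R by field.
  have h : sin (pi / 4 : R) = cos (pi / 4).
    by rewrite -[RHS]cosN -sinDpihalf; congr sin; field.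
  have := cos2Dsin2 (pi / 4 : R); rewrite h => h2.
  by have -> : cos (pi / 4 : R) ^+ 2 = 1 / 2 by [lra]; field.
rewrite exprS mulrCA -IH mulr_sumr expnS mul2n -addnn.
rewrite (sum_fold _ (fun k => (sin (sinpt n.+1 k) ^+ 2)^-1)).
apply: eq_bigr => k _; have kn := ltn_ord k.
have /andP[b1 b2] := sinpt_bound kn.
have -> : sinpt n.+1 k = sinpt n k / 2.
  by rewrite /sinpt [2 ^+ n.+3]exprS; field; rewrite expf_neq0.
have -> : sinpt n.+1 (2 ^ n + (2 ^ n - k.+1)) = pi / 2 - sinpt n k / 2.
  rewrite /sinpt natrD natrB // -natr1 natrX [2 ^+ n.+3]exprS [2 ^+ n.+2]exprS [2 ^+ n.+1]exprS; field; rewrite expf_neq0 //.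
rewrite inv_sin2_half; first by congr (_ * (sin _ ^+ 2)^-1); field.
  by rewrite gt_eqF // sin_gt0_pihalf //; apply/andP; split; lra.
by rewrite gt_eqF // cos_gt0_pihalf //; apply/andP; split; lra.
Qed.

Definition odd_sum n : R := \sum_(k < 2 ^ n) ((2 * k%:R + 1) ^+ 2)^-1.

Lemma pi_le4 : pi <= 4 :> R.
Proof. by have /andP[_] := @pihalf_02 R; lra. Qed.

(** Each of the 2^n terms 1 / [sinpt]^2 is within 1 of 1 / sin^2, so a rescaled [odd_sum n] is
    within 2^n of the total 2 * 4^n. Scaling back leaves the factor pi^2 / 16 <= 1. *)
Lemma odd_sum_bound n : `|odd_sum n - pi ^+ 2 / 8| <= 1 / 2 ^+ n.
Proof.
have p0 := @pi_gt0 R; have p4 := pi_le4.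
have q0 : 0 < 2 ^+ n :> R by rewrite exprn_gt0.
have e4 : 4 ^+ n = 2 ^+ n * 2 ^+ n :> R by rewrite -exprMn; congr (_ ^+ _); ring.
have hS : \sum_(k < 2 ^ n) (sinpt n k ^+ 2)^-1 = 16 * 4 ^+ n / pi ^+ 2 * odd_sum n.
  rewrite /odd_sum mulr_sumr; apply: eq_bigr => k _; rewrite /sinpt e4 [2 ^+ n.+2]exprS [2 ^+ n.+1]exprS.
  have k0 : 2 * k%:R + 1 != 0 :> R by rewrite gt_eqF //; have := ler0n R k; lra.
  move: k0 p0 q0; move: (2 * _ + 1) (pi) (2 ^+ n) => a p q a0 p0 q0.
  by field; rewrite a0 !gt_eqF.
have up : 16 * 4 ^+ n / pi ^+ 2 * odd_sum n <= 2 * 4 ^+ n.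
  rewrite -hS -sum_inv_sin2; apply: ler_sum => k _.
  by have /andP[] := inv_sin2_bounds (sinpt_bound (ltn_ord k)).
have lo : 2 * 4 ^+ n - 2 ^+ n <= 16 * 4 ^+ n / pi ^+ 2 * odd_sum n.
  rewrite -hS -sum_inv_sin2.
  have -> : 2 ^+ n = \sum_(k < 2 ^ n) 1 :> R by rewrite sumr_const card_ord -natrX.
  rewrite -sumrB; apply: ler_sum => k _.
  by have /andP[] := inv_sin2_bounds (sinpt_bound (ltn_ord k)).
clear hS; move: up lo q0; rewrite e4 {e4}; move: (odd_sum n) (2 ^+ n) pi p0 p4 => o Q p p0 p4 up lo q0.
have -> : o = 16 * (Q * Q) / p ^+ 2 * o * (p ^+ 2 / (16 * (Q * Q))).
  by field; rewrite !gt_eqF.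
set X := _ * o in up lo *.
have r0 : 0 < p ^+ 2 / (16 * (Q * Q)) by rewrite divr_gt0 ?exprn_gt0 ?mulr_gt0.
have u1 : X * (p ^+ 2 / (16 * (Q * Q))) <= p ^+ 2 / 8.
  have -> : p ^+ 2 / 8 = 2 * (Q * Q) * (p ^+ 2 / (16 * (Q * Q))) by field; rewrite !gt_eqF.
  by rewrite ler_wpM2r // ltW.
have l1 : p ^+ 2 / 8 - p ^+ 2 / 16 / Q <= X * (p ^+ 2 / (16 * (Q * Q))).
  have -> : p ^+ 2 / 8 - p ^+ 2 / 16 / Q = (2 * (Q * Q) - Q) * (p ^+ 2 / (16 * (Q * Q))).
    by field; rewrite !gt_eqF.
  by rewrite ler_wpM2r // ltW.
have c1 : p ^+ 2 / 16 / Q <= 1 / Q by apply: ler_wpM2r; [rewrite invr_ge0; exact: ltW | nra].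
have c2 : 0 < 1 / Q by rewrite divr_gt0.
by rewrite ler_norml; apply/andP; split; lra.
Qed.

Definition zeta_sum n : R := \sum_(k < n) (k.+1%:R ^+ 2)^-1.
Definition eta_sum n : R := \sum_(k < n) (-1) ^+ k * (k.+1%:R ^+ 2)^-1.

Lemma sum_even_odd (F : nat -> R) m :
  \sum_(k < m.*2) F k = \sum_(k < m) F k.*2 + \sum_(k < m) F k.*2.+1.
Proof.
elim: m => [|m IH]; first by rewrite !big_ord0 addr0.
by rewrite doubleS !big_ord_recr /= IH; ring.
Qed.

Lemma zeta_eta_double n :
  zeta_sum (2 ^ n.+1) = odd_sum n + zeta_sum (2 ^ n) / 4 /\
  eta_sum (2 ^ n.+1) = odd_sum n - zeta_sum (2 ^ n) / 4.
Proof.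
rewrite expnS mul2n /zeta_sum /eta_sum (sum_even_odd (fun k => (k.+1%:R ^+ 2)^-1)).
rewrite (sum_even_odd (fun k => (-1) ^+ k * (k.+1%:R ^+ 2)^-1)) /odd_sum mulr_suml -sumrN; split.
  congr (_ + _); apply: eq_bigr => k _.
    by congr (_ ^+ _)^-1; rewrite -natr1 -muln2 natrM; ring.
  have -> : k.*2.+2%:R = 2 * k.+1%:R :> R by rewrite -doubleS -muln2 natrM mulrC.
  by rewrite exprMn invfM mulrC; congr (_ / _); ring.
congr (_ + _); apply: eq_bigr => k _.
  have -> : (-1) ^+ k.*2 = 1 :> R by rewrite -mul2n exprM sqrrN expr1n expr1n.
  by rewrite mul1r; congr (_ ^+ _)^-1; rewrite -natr1 -muln2 natrM; ring.
have -> : (-1) ^+ k.*2.+1 = -1 :> R by rewrite exprS -mul2n exprM sqrrN expr1n expr1n mulr1.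
have -> : k.*2.+2%:R = 2 * k.+1%:R :> R by rewrite -doubleS -muln2 natrM mulrC.
by rewrite exprMn invfM mulN1r mulrC; congr (- (_ / _)); ring.
Qed.

(** By [zeta_eta_double] the limit z satisfies z = pi^2 / 8 + z / 4. An error e / 2^n is inherited
    by the next n if e / 4 + 1 <= e / 2, and e = 4 is the least such constant. *)
Lemma zeta_sum_bound n : `|zeta_sum (2 ^ n) - pi ^+ 2 / 6| <= 4 / 2 ^+ n.
Proof.
have p0 := @pi_gt0 R; have p4 := pi_le4.
elim: n => [|n IH].
  rewrite expn0 expr0 /zeta_sum big_ord_recl big_ord0 addr0 expr1n invr1.
  by rewrite ler_norml; apply/andP; split; nra.
have [-> _] := zeta_eta_double n; have := odd_sum_bound n; move: IH.
rewrite [2 ^+ n.+1]exprS invfM; set Q := (2 ^+ n)^-1.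
by rewrite !ler_norml => /andP[? ?] /andP[? ?]; apply/andP; split; lra.
Qed.

Lemma eta_sum_bound n : `|eta_sum (2 ^ n.+1) - pi ^+ 2 / 12| <= 2 / 2 ^+ n.
Proof.
have [_ ->] := zeta_eta_double n; have := odd_sum_bound n; have := zeta_sum_bound n.
set Q := (2 ^+ n)^-1.
by rewrite !ler_norml => /andP[? ?] /andP[? ?]; apply/andP; split; lra.
Qed.
End Basel.

(** * The primitive of [lexp], a dilogarithm, and its increment pi^2 / 12 *)

Section Dilogarithm.
Variable R : realType.
Implicit Types (x X : R).

(* Any base point below all the arguments used later would do. *)
Definition dilog x : R := \int[lebesgue_measure]_(t in `[(-2)%R, x]) lexp t.

Lemma ddilog x : -2 < x -> der_at dilog x (lexp x).
Proof.
move=> x2; have c : continuous (@lexp R) by move=> y; apply: derive_cont (dlexp y).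
have xu : x < x + 1 by lra.
have [|d e] := @continuous_FTC1_closed R (@lexp R) (-2) x (x + 1) xu _ x2 (c x).
  apply: continuous_compact_integrable; first exact: segment_compact.
  exact: continuous_subspaceT.
split; first exact: d.
by rewrite -derive1E; exact: e.
Qed.

(** With u = e^{-x} this is the alternating series of ln (1 + u), the integral of a geometric sum
    from 0 to u. Its remainder is explicit in x, so that it can be integrated once more. *)
Lemma lexp_series m x : 0 <= x ->
  `|lexp x - \sum_(k < m) (-1) ^+ k * (expR (- x * k.+1%:R) / k.+1%:R)| <= expR (- x * m.+1%:R) / m.+1%:R.
Proof.
move=> x0; set u := expR (- x).
have u0 : 0 <= u by exact: expR_ge0.
have := @abs_increment R (fun y => ln (1 + y) - \sum_(k < m) (-1) ^+ k * (y ^+ k.+1 / k.+1%:R))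
  (fun y => y ^+ m.+1 / m.+1%:R) (fun y => (1 + y)^-1 - \sum_(k < m) (- y) ^+ k) (fun y => y ^+ m) 0 u u0.
rewrite addr0 ln1 expr0n /= mul0r subr0 [X in _ - (0 - X)]big1; last first.
  by move=> i _; rewrite expr0n /= mul0r mulr0.
rewrite !subr0.
have -> : ln (1 + u) = lexp x by [].
have -> : \sum_(k < m) (-1) ^+ k * (u ^+ k.+1 / k.+1%:R) = \sum_(k < m) (-1) ^+ k * (expR (- x * k.+1%:R) / k.+1%:R).
  by apply: eq_bigr => k _; rewrite expRM_natr.
rewrite -[u ^+ m.+1]expRM_natr; apply => y /andP[y0 yu].
- have d1 : der_at (fun y => \sum_(k < m) (-1) ^+ k * (y ^+ k.+1 / k.+1%:R)) y (\sum_(k < m) (- y) ^+ k).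
    apply: dsum => k; der; rewrite [(- y) ^+ k]exprNn; have := pnatr_eq0 R k.+1.
    by move: (k.+1%:R : R) => a /= a0; field; rewrite a0.
  by der; [lra | rewrite add0r mulr1].
- der; have := pnatr_eq0 R m.+1.
  by move: (m.+1%:R : R) => a /= a0; field; rewrite a0.
- have y1 : 0 < 1 + y by lra.
  have -> : (1 + y)^-1 - \sum_(k < m) (- y) ^+ k = (- y) ^+ m / (1 + y).
    have h : (1 + y) * \sum_(k < m) (- y) ^+ k = 1 - (- y) ^+ m.
      by have := subrX1 (- y) m; nra.
    have -> : \sum_(k < m) (- y) ^+ k = (1 - (- y) ^+ m) / (1 + y).
      by rewrite -h mulrAC mulfV ?mul1r // gt_eqF.
    by field; rewrite gt_eqF.
  rewrite normrM normrX normrN (ger0_norm y0) ger0_norm ?invr_ge0; last exact: ltW.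
  by rewrite ler_pdivrMr // ler_peMr ?exprn_ge0 //; lra.
Qed.

(** Integrating [lexp_series] over [0, X] produces the sums [G m]. At 0 they are [eta_sum], which
    tends to pi^2 / 12; at X they are at most 2 e^{-X}, because the sum of 1 / k^2 stays below 2. *)
Lemma dilog_limit X : 0 <= X -> `|dilog X - dilog 0 - pi ^+ 2 / 12| <= 2 * expR (- X).
Proof.
move=> X0.
pose G m x := \sum_(k < m) (-1) ^+ k * (expR (- x * k.+1%:R) / k.+1%:R ^+ 2).
have h1 m : `|dilog X - dilog 0 + (G m X - G m 0)| <= 1 / m.+1%:R ^+ 2.
  have := @abs_increment R (fun y => dilog y + G m y) (fun y => - (expR (- y * m.+1%:R) / m.+1%:R ^+ 2))
    (fun y => lexp y - \sum_(k < m) (-1) ^+ k * (expR (- y * k.+1%:R) / k.+1%:R)) (fun y => expR (- y * m.+1%:R) / m.+1%:R) 0 X X0.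
  have -> : dilog X + G m X - (dilog 0 + G m 0) = dilog X - dilog 0 + (G m X - G m 0) by ring.
  move=> h; apply: (le_trans (h _ _ _)).
  - move=> y /andP[y0 _]; apply: dD; first by apply: ddilog; lra.
    rewrite -sumrN; apply: dsum => k; der; have := pnatr_eq0 R k.+1.
    by move: (k.+1%:R : R) => a /= a0; field; rewrite a0.
  - move=> y _; der; have := pnatr_eq0 R m.+1.
    by move: (m.+1%:R : R) => a /= a0; field; rewrite a0.
  - by move=> y /andP[y0 _]; exact: lexp_series.
  rewrite oppr0 mul0r expR0; have := expR_ge0 (- X * m.+1%:R) => e0.
  have : 0 <= expR (- X * m.+1%:R) / m.+1%:R ^+ 2 by rewrite divr_ge0 ?exprn_ge0.
  by move: (_ / _) (1 / _) => a b; lra.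
have G0 m : G m 0 = eta_sum R m.
  by apply: eq_bigr => k _; rewrite oppr0 mul0r expR0 mul1r.
have GX m : `|G m X| <= 2 * expR (- X).
  apply: (le_trans (ler_norm_sum _ _ _)).
  apply: (@le_trans _ _ (expR (- X) * \sum_(k < m) (k.+1%:R ^+ 2)^-1)).
    rewrite mulr_sumr; apply: ler_sum => k _.
    rewrite normrM normrX normrN1 expr1n mul1r ger0_norm ?divr_ge0 ?expR_ge0 ?exprn_ge0 //.
    rewrite ler_wpM2r ?invr_ge0 ?exprn_ge0 // ler_expR.
    by rewrite mulNr lerN2 ler_peMr // ler1n.
  rewrite mulrC ler_wpM2r ?expR_ge0 //.
  case: m => [|m]; first by rewrite big_ord0.
  (* The sharper bound 2 - 1 / m is the one that induction preserves. *)
  suff : \sum_(k < m.+1) (k.+1%:R ^+ 2)^-1 <= 2 - m.+1%:R^-1 :> R.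
    have : 0 < m.+1%:R^-1 :> R by rewrite invr_gt0.
    by move: (m.+1%:R^-1) => a; lra.
  elim: m => [|m IH]; first by rewrite big_ord_recl big_ord0 addr0 expr1n invr1; lra.
  rewrite big_ord_recr /=; apply: (le_trans (lerD IH (lexx _))).
  have a0 : 0 < m.+1%:R :> R by [].
  have -> : m.+2%:R = m.+1%:R + 1 :> R by rewrite natr1.
  move: (m.+1%:R : R) a0 => a a0.
  have -> : 2 - (a + 1)^-1 = 2 - a^-1 + (a * (a + 1))^-1.
    by field; rewrite !gt_eqF //; lra.
  by rewrite lerD2l lef_pV2 ?posrE ?mulr_gt0 ?exprn_gt0 //; nra.
(* [eta_sum_bound] is available at powers of 2. The constant 3 is 1 for the truncation of the series
   and 2 for that bound. *)
have h3 n : `|dilog X - dilog 0 - pi ^+ 2 / 12| <= 2 * expR (- X) + 3 / 2 ^+ n.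
  have := h1 (2 ^ n.+1)%N; have := GX (2 ^ n.+1)%N; have := eta_sum_bound R n; rewrite G0.
  have : 1 / (2 ^ n.+1).+1%:R ^+ 2 <= 1 / 2 ^+ n :> R.
    rewrite ler_pM2l // lef_pV2 ?posrE ?exprn_gt0 //.
    apply: (@le_trans _ _ ((2 ^ n.+1)%N.+1%:R)); last by rewrite expr2 ler_peMr // ler1n.
    by rewrite -natrX ler_nat expnS; lia.
  move: (1 / (2 ^ n.+1).+1%:R ^+ 2) (eta_sum R _) (G _ X) => z es g.
  set Q := (2 ^+ n)^-1; rewrite !ler_norml => a /andP[? ?] /andP[? ?] /andP[? ?]; apply/andP; split; lra.
apply/ler_addgt0Pr => e e0.
have [n hn] : exists n : nat, 3 / 2 ^+ n <= e.
  exists (Num.truncn (3 / e)).+1; rewrite ler_pdivrMr ?exprn_gt0 // mulrC -ler_pdivrMr //.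
  set m := Num.truncn _; have : 3 / e < m.+1%:R by exact: truncnS_gt.
  have : m.+1%:R <= 2 ^+ m.+1 :> R by rewrite -natrX ler_nat ltnW // ltn_expl.
  lra.
apply: (le_trans (h3 n)); lra.
Qed.
End Dilogarithm.

(** * Sums over residue classes *)

Section EulerMaclaurin.
Variable R : realType.
Implicit Types (h H dh ddh : R -> R) (a b x y s C K : R).

Lemma der_shift h x r d : der_at h (x + r) d -> der_at (fun z => h (x + z)) r d.
Proof.
move=> hd; apply: (der_eq (d := d * (0 + 1))); last by ring.
have hg : der_at (fun z => x + z) r (0 + 1) by apply: dD; [exact: dC | exact: dI].
exact: (@dcomp _ h (fun z => x + z) r d (0 + 1) hd hg).
Qed.

Lemma lipschitz h dh a b K : (forall x, a <= x <= b -> der_at h x (dh x)) ->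
  (forall x, a <= x <= b -> `|dh x| <= K) ->
  forall x y, a <= x <= b -> a <= y <= b -> `|h x - h y| <= K * (b - a).
Proof.
move=> hd hK; have wl x y : a <= x -> x <= y -> y <= b -> `|h y - h x| <= K * (b - a).
  move=> ax xy yb; have K0 : 0 <= K by apply: le_trans (hK x _) => //; rewrite ax (le_trans xy).
  apply: (@le_trans _ _ (K * y - K * x)); last by nra.
  apply: (abs_increment (w := fun z => K * z) (du := dh) (dw := fun=> K)) => // z /andP[z1 z2].
  - by apply: hd; rewrite (le_trans ax) // (le_trans z2).
  - by der; ring.
  - by apply: hK; rewrite (le_trans ax) // (le_trans z2).
move=> x y /andP[ax xb] /andP[ay yb]; have [xy|yx] := leP x y.
  by rewrite distrC; exact: wl.
by apply: wl => //; exact: ltW.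
Qed.

Lemma taylor2 h dh ddh x r M : 0 <= r ->
  (forall y, x <= y -> der_at h y (dh y)) -> (forall y, x <= y -> der_at dh y (ddh y)) ->
  (forall y, x <= y -> `|ddh y| <= M) ->
  `|h (x + r) - h x - r * dh x| <= r ^+ 2 / 2 * M.
Proof.
move=> r0 h1 h2 hM.
have := @abs_increment R (fun z => h (x + z) - h x - z * dh x) (fun z => z ^+ 2 / 2 * M)
  (fun z => dh (x + z) - dh x) (fun z => z * M) 0 r r0.
rewrite addr0 subrr expr0n /= !mul0r !subr0; apply => z /andP[z0 zr].
- have := der_shift (h1 (x + z) _); rewrite lerDl => /(_ z0) hz.
  by der; ring.
- by der; field.
have := @abs_increment R (fun w => dh (x + w) - dh x) (fun w => w * M)
  (fun w => ddh (x + w)) (fun=> M) 0 z z0.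
rewrite addr0 subrr mul0r !subr0; apply => w /andP[w0 wz].
- have := der_shift (h2 (x + w) _); rewrite lerDl => /(_ w0) hw.
  by der; ring.
- by der; ring.
- by apply: hM; rewrite lerDl.
Qed.

Lemma taylor3 H h dh ddh x r M : 0 <= r ->
  (forall y, x <= y -> der_at H y (h y)) ->
  (forall y, x <= y -> der_at h y (dh y)) -> (forall y, x <= y -> der_at dh y (ddh y)) ->
  (forall y, x <= y -> `|ddh y| <= M) ->
  `|H (x + r) - H x - r * h x - r ^+ 2 / 2 * dh x| <= r ^+ 3 / 6 * M.
Proof.
move=> r0 h0 h1 h2 hM.
have := @abs_increment R (fun z => H (x + z) - H x - z * h x - z ^+ 2 / 2 * dh x) (fun z => z ^+ 3 / 6 * M)
  (fun z => h (x + z) - h x - z * dh x) (fun z => z ^+ 2 / 2 * M) 0 r r0.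
rewrite addr0 subrr !expr0n /= !mul0r !subr0; apply => z /andP[z0 zr].
- have := der_shift (h0 (x + z) _); rewrite lerDl => /(_ z0) hz.
  by der; field.
- by der; field.
exact: (taylor2 z0 h1 h2 hM).
Qed.

(** The ratio e^{-s/2} is at most 1 - s / 4. Thus Riemann sums of e^{-x/2} are bounded uniformly in
    the step s and the length J, which is what turns errors per cell into a total error. *)
Lemma geometric_decay s J : 0 < s <= 1 -> s * \sum_(j < J) expR (- (s * j%:R) / 2) <= 4.
Proof.
move=> /andP[s0 s1]; set r := expR (- s / 2).
have r1 : r <= 1 - s / 4.
  have := expR_taylor2 (- s / 2); rewrite (max_l _); last lra.
  rewrite expR0 ler_norml => /andP[_]; rewrite -/r; nra.
have r0 : 0 < r by exact: expR_gt0.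
have -> : \sum_(j < J) expR (- (s * j%:R) / 2) = \sum_(j < J) r ^+ j.
  by apply: eq_bigr => j _; rewrite -expRM_natr; congr expR; ring.
have h : (1 - r) * \sum_(j < J) r ^+ j = 1 - r ^+ J by have := subrX1 r J; nra.
have S0 : 0 <= \sum_(j < J) r ^+ j by apply: sumr_ge0 => j _; rewrite exprn_ge0 // ltW.
have : 0 <= r ^+ J by rewrite exprn_ge0 // ltW.
nra.
Qed.

Lemma telescope_nat (F : nat -> R) J : \sum_(j < J) (F j.+1 - F j) = F J - F 0.
Proof. by elim: J => [|J IH]; [rewrite big_ord0 subrr | rewrite big_ord_recr /= IH; ring]. Qed.

(** On a cell of length s the function h varies by at most s times its derivative bound, wherever in
    the cell the sampling point lies; [geometric_decay] adds up the errors C s^2 e^{-x/2}. *)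
Lemma euler_maclaurin1 H h dh C s a J : 0 < s <= 1 -> 0 <= a <= 1 ->
  (forall x, 0 <= x -> der_at H x (h x)) -> (forall x, 0 <= x -> der_at h x (dh x)) ->
  (forall x, 0 <= x -> `|dh x| <= C * expR (- x / 2)) ->
  `|s * \sum_(j < J) h (s * (j%:R + a)) - (H (s * J%:R) - H 0)| <= 4 * C * s.
Proof.
move=> s01 /andP[a0 a1] h0 h1 hC; have /andP[s0 s1] := s01.
have C0 : 0 <= C by have := hC 0 (lexx _); rewrite oppr0 mul0r expR0 mulr1; apply: le_trans.
have -> : H (s * J%:R) - H 0 = \sum_(j < J) (H (s * j.+1%:R) - H (s * j%:R)).
  by rewrite (telescope_nat (fun j => H (s * j%:R))) mulr0.
rewrite mulr_sumr -sumrB; apply: (le_trans (ler_norm_sum _ _ _)).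
apply: (@le_trans _ _ (\sum_(j < J) C * s * (s * expR (- (s * j%:R) / 2)))); last first.
  by rewrite -mulr_sumr -mulr_sumr; have := geometric_decay J s01; have := mulr_ge0 C0 (ltW s0); nra.
apply: ler_sum => j _; rewrite distrC.
have j0 : 0 <= s * j%:R by rewrite mulr_ge0 // ltW.
set x := s * j%:R in j0 *; set y := s * (j%:R + a).
have -> : s * j.+1%:R = x + s by rewrite -natr1 /x; ring.
have xy : x <= y <= x + s by rewrite /x /y; apply/andP; split; nra.
have xs : x <= x + s by rewrite lerDl ltW.
have := @abs_increment R (fun z => H z - z * h y) (fun z => C * s * expR (- x / 2) * z)
  (fun z => h z - h y) (fun=> C * s * expR (- x / 2)) x (x + s) xs.
have -> : H (x + s) - (x + s) * h y - (H x - x * h y) = H (x + s) - H x - s * h y by ring.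
have -> : C * s * expR (- x / 2) * (x + s) - C * s * expR (- x / 2) * x = C * s * (s * expR (- x / 2)) by ring.
apply => z /andP[z1 z2].
- have hz := h0 z (le_trans j0 z1); by der; ring.
- by der; ring.
have -> : C * s * expR (- x / 2) = C * expR (- x / 2) * (x + s - x) by ring.
apply: (lipschitz (dh := dh)) => //; last by rewrite z1.
  by move=> w /andP[w1 _]; apply: h1; exact: le_trans w1.
move=> w /andP[w1 _]; apply: (le_trans (hC w _)); first exact: le_trans w1.
by rewrite ler_wpM2l // ler_expR; lra.
Qed.

(** The factor a - 1/2 is the first Bernoulli polynomial at the offset a of the sampling points. The
    dependence of the final formula on alpha and beta enters through it. *)
Lemma euler_maclaurin2 H h dh ddh C s a J : 0 < s <= 1 -> 0 <= a <= 1 ->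
  (forall x, 0 <= x -> der_at H x (h x)) -> (forall x, 0 <= x -> der_at h x (dh x)) ->
  (forall x, 0 <= x -> der_at dh x (ddh x)) ->
  (forall x, 0 <= x -> `|ddh x| <= C * expR (- x / 2)) ->
  `|s * \sum_(j < J) h (s * (j%:R + a)) - (H (s * J%:R) - H 0)
    - s * (1 / 2 - a) * (h 0 - h (s * J%:R))| <= 4 * C * s ^+ 2.
Proof.
move=> s01 /andP[a0 a1] h0 h1 h2 hC; have /andP[s0 s1] := s01.
have C0 : 0 <= C by have := hC 0 (lexx _); rewrite oppr0 mul0r expR0 mulr1; apply: le_trans.
have -> : H (s * J%:R) - H 0 = \sum_(j < J) (H (s * j.+1%:R) - H (s * j%:R)).
  by rewrite (telescope_nat (fun j => H (s * j%:R))) mulr0.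
have -> : h 0 - h (s * J%:R) = - \sum_(j < J) (h (s * j.+1%:R) - h (s * j%:R)).
  by rewrite (telescope_nat (fun j => h (s * j%:R))) mulr0 opprB.
rewrite mulr_sumr mulrN opprK mulr_sumr -sumrB -big_split /=.
apply: (le_trans (ler_norm_sum _ _ _)).
apply: (@le_trans _ _ (\sum_(j < J) C * s ^+ 2 * (s * expR (- (s * j%:R) / 2)))); last first.
  by rewrite -mulr_sumr -mulr_sumr; have := geometric_decay J s01; have := mulr_ge0 C0 (sqr_ge0 s); nra.
apply: ler_sum => j _; rewrite -normrN.
have j0 : 0 <= s * j%:R by rewrite mulr_ge0 // ltW.
have -> : s * (j%:R + a) = s * j%:R + a * s by ring.
have -> : s * j.+1%:R = s * j%:R + s by rewrite -natr1; ring.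
set x := s * j%:R in j0 *; set M := C * expR (- x / 2).
have hM y : x <= y -> `|ddh y| <= M.
  move=> xy; apply: (le_trans (hC y _)); first exact: le_trans xy.
  by rewrite /M ler_wpM2l // ler_expR; lra.
have g0 y : x <= y -> der_at H y (h y) by move=> xy; apply: h0; exact: le_trans xy.
have g1 y : x <= y -> der_at h y (dh y) by move=> xy; apply: h1; exact: le_trans xy.
have g2 y : x <= y -> der_at dh y (ddh y) by move=> xy; apply: h2; exact: le_trans xy.
have T1 := taylor3 (ltW s0) g0 g1 g2 hM.
have T2 := taylor2 (mulr_ge0 a0 (ltW s0)) g1 g2 hM.
have T3 := taylor2 (ltW s0) g1 g2 hM.
have M0 : 0 <= M by rewrite mulr_ge0 ?expR_ge0.
have -> : C * s ^+ 2 * (s * expR (- x / 2)) = s ^+ 3 * M by rewrite /M; ring.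
set A := H (x + s) - H x - s * h x - s ^+ 2 / 2 * dh x in T1.
set B := h (x + a * s) - h x - a * s * dh x in T2.
set D := h (x + s) - h x - s * dh x in T3.
(* Expanded at the left end x of the cell, all terms up to second order cancel, and three Taylor
   remainders are left. *)
have -> : - (s * h (x + a * s) - (H (x + s) - H x) + s * (1 / 2 - a) * (h (x + s) - h x)) =
  A - s * B - s * (1 / 2 - a) * D by rewrite /A /B /D; field.
have nB : `|s * B| <= s ^+ 3 / 2 * M.
  rewrite normrM (ger0_norm (ltW s0)).
  apply: (le_trans (ler_wpM2l (ltW s0) T2)).
  have aa : a ^+ 2 <= 1 by rewrite expr_le1.
  have : 0 <= s ^+ 3 * M by rewrite mulr_ge0 // exprn_ge0 // ltW.
  have -> : s * ((a * s) ^+ 2 / 2 * M) = a ^+ 2 * (s ^+ 3 * M) / 2 by ring.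
  nra.
have nD : `|s * (1 / 2 - a) * D| <= s ^+ 3 / 4 * M.
  have ha : `|1 / 2 - a| <= 1 / 2 by rewrite ler_norml; apply/andP; split; lra.
  rewrite !normrM (ger0_norm (ltW s0)).
  apply: (le_trans (ler_pM _ _ (ler_wpM2l (ltW s0) ha) T3)) => //; first by rewrite mulr_ge0 // ltW.
  by have -> : s * (1 / 2) * (s ^+ 2 / 2 * M) = s ^+ 3 / 4 * M by field.
have := ler_normB (A - s * B) (s * (1 / 2 - a) * D); have := ler_normB A (s * B).
have : 0 <= s ^+ 3 * M by rewrite mulr_ge0 // exprn_ge0 // ltW.
lra.
Qed.
End EulerMaclaurin.

(** * Riemann sums over the parts in one residue class *)

Section ClassSums.
Variable R : realType.
(* One residue class: its parts have rescaled sizes [s (j + a)], [s] is N tau^2 and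
   [e] is the common value of [eps]. *)
Variables (tau s a e : R) (J : nat).
Hypotheses (tau01 : 0 < tau <= 1) (s01 : 0 < s <= 1) (a01 : 0 <= a <= 1) (e1 : `|e| <= 1).
Hypothesis hJ : expR (- (s * J%:R) / 2) <= s ^+ 2.
Implicit Types (x : R) (h : R -> R).

Local Notation X := (s * J%:R).
Local Notation sh := (fun x => x - e * tau).
Definition class_sum h : R := s * \sum_(j < J) h (s * (j%:R + a)).

Lemma shift_bound x : x - 1 <= sh x <= x + 1.
Proof.
move: tau01 e1 => /andP[t0 t1]; rewrite ler_norml => /andP[? ?].
by apply/andP; split; nra.
Qed.

Lemma exp1_le3 : expR 1 <= 3 :> R.
Proof.
have := expR_taylor2 (1 / 2 : R); rewrite (max_r _); last lra.
have -> : expR 1 = expR (1 / 2) ^+ 2 :> R by rewrite expr2 -expRD; congr expR; lra.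
have := expR_gt0 (1 / 2 : R); set z := expR _ => z0.
by rewrite ler_norml => /andP[_ h]; have : z <= 12 / 7; [lra|nra].
Qed.

(** The shift of the argument costs at most e <= 3, and half of the exponential decay absorbs x^n
    through (x / 2)^n <= n! e^{x/2}. *)
Lemma shift_exp n x : 0 <= x -> x ^+ n * expR (- sh x) <= n`!%:R * 2 ^+ n * 3 * expR (- x / 2).
Proof.
move=> x0; have /andP[h _] := shift_bound x.
have := @exprn_le_expR R n (x / 2) (divr_ge0 x0 _); rewrite ler0n => /(_ isT) hx.
have xE : x ^+ n = 2 ^+ n * (x / 2) ^+ n.
  by rewrite -exprMn; congr (_ ^+ _); field.
have h1 : expR (- sh x) <= 3 * expR (- x).
  apply: (@le_trans _ _ (expR (1 - x))); first by rewrite ler_expR; lra.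
  by rewrite expRD ler_wpM2r ?expR_ge0 ?exp1_le3.
have p2 : 0 <= 2 ^+ n :> R by rewrite exprn_ge0.
apply: (@le_trans _ _ (2 ^+ n * (n`!%:R * expR (x / 2)) * (3 * expR (- x)))).
  rewrite xE; apply: ler_pM => //; rewrite ?expR_ge0 //; last exact: ler_wpM2l.
  by rewrite mulr_ge0 // exprn_ge0 // divr_ge0.
have -> : expR (- x / 2) = expR (x / 2) * expR (- x) by rewrite -expRD; congr expR; field.
by rewrite le_eqVlt; apply/orP; left; apply/eqP; ring.
Qed.

(** [Hoo] is the value of the primitive H at infinity; stopping at X costs a multiple of e^{-X/2} <=
    s^2. The constant 500 is 4 * 100 from Euler-Maclaurin plus 100 from this end. *)
Lemma class_sum_bound H h dh C Hoo : C <= 100 ->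
  (forall x, 0 <= x -> der_at H x (h x)) -> (forall x, 0 <= x -> der_at h x (dh x)) ->
  (forall x, 0 <= x -> `|dh x| <= C * expR (- x / 2)) ->
  (0 <= X -> `|H X - Hoo| <= 100 * expR (- X / 2)) ->
  `|class_sum h - (Hoo - H 0)| <= 500 * s.
Proof.
move=> C1 h0 h1 hC hH; have := euler_maclaurin1 J s01 a01 h0 h1 hC.
have /andP[s0 s1] := s01.
have X0 : 0 <= X by rewrite mulr_ge0 // ltW.
have := hH X0.
rewrite /class_sum; have hJ' := hJ; set S := s * _; set E := expR _ in hJ' *.
have : s ^+ 2 <= s by nra.
have : C * s <= 100 * s by rewrite ler_pM2r.
rewrite !ler_norml => q1 q2 /andP[? ?] /andP[? ?]; apply/andP; split; lra.
Qed.

Lemma class_sum_bound2 H h dh ddh C Hoo : C <= 100 ->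
  (forall x, 0 <= x -> der_at H x (h x)) -> (forall x, 0 <= x -> der_at h x (dh x)) ->
  (forall x, 0 <= x -> der_at dh x (ddh x)) ->
  (forall x, 0 <= x -> `|ddh x| <= C * expR (- x / 2)) ->
  (0 <= X -> `|H X - Hoo| <= 100 * expR (- X / 2)) ->
  (0 <= X -> `|h X| <= 100 * expR (- X / 2)) ->
  `|class_sum h - (Hoo - H 0) - s * (1 / 2 - a) * h 0| <= 600 * s ^+ 2.
Proof.
move=> C1 h0 h1 h2 hC hH hh; have := euler_maclaurin2 J s01 a01 h0 h1 h2 hC.
have /andP[s0 s1] := s01; have X0 : 0 <= X by rewrite mulr_ge0 // ltW.
have := hH X0; have := hh X0; rewrite /class_sum; have hJ' := hJ; set S := s * \sum_(j < J) _; set E := expR _ in hJ' *.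
have : C * s ^+ 2 <= 100 * s ^+ 2 by rewrite ler_wpM2r // sqr_ge0.
have E0 : 0 <= E by exact: expR_ge0.
have /andP[a0 a1] := a01.
move=> q1 hX q2 q3.
have hw : `|s * (1 / 2 - a) * h X| <= 100 * E / 2.
  have q : `|s * (1 / 2 - a)| <= 1 / 2 by rewrite ler_norml; apply/andP; split; nra.
  by rewrite normrM; have := normr_ge0 (h X); have := normr_ge0 (s * (1 / 2 - a)); nra.
move: hw q2 q3 hJ' q1; clear; rewrite !ler_norml => /andP[? ?] /andP[? ?] /andP[? ?] ? ?; apply/andP; split; lra.
Qed.

Local Ltac derF := eapply der_eq; [repeat first [der_step |
  match goal with
  | |- der_at (fun y => ferm (@?g y)) _ _ => apply: (@dcomp _ (@ferm R) g); [exact: dferm|]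
  | |- der_at (fun y => fvar (@?g y)) _ _ => apply: (@dcomp _ (@fvar R) g); [exact: dfvar|]
  | |- der_at (fun y => lexp (@?g y)) _ _ => apply: (@dcomp _ (@lexp R) g); [exact: dlexp|]
  | |- der_at (fun y => dilog (@?g y)) _ _ => apply: (@dcomp _ (@dilog R) g); [apply: ddilog|]
  end] | cbn beta; rewrite /=].

(* The total increment of [dilog] on [0, +oo). *)
Definition cdilog : R := pi ^+ 2 / 12.

Lemma sh_gtN2 x : 0 <= x -> -2 < sh x.
Proof. by have /andP[] := shift_bound x; lra. Qed.

Lemma fvar_sh n x : 0 <= x -> `|x ^+ n * fvar (sh x)| <= n`!%:R * 2 ^+ n * 3 * expR (- x / 2).
Proof.
move=> x0; rewrite ger0_norm; last by rewrite mulr_ge0 ?exprn_ge0 // ltW // fvar_gt0.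
apply: le_trans (shift_exp n x0); by rewrite ler_wpM2l ?exprn_ge0 // fvar_le_exp.
Qed.
Lemma fskew_sh n x : 0 <= x -> `|x ^+ n * fskew (sh x)| <= n`!%:R * 2 ^+ n * 3 * expR (- x / 2).
Proof.
move=> x0; apply: le_trans (fvar_sh n x0); rewrite [leLHS]normrM [leRHS]normrM ler_wpM2l //.
by rewrite (ger0_norm (ltW (fvar_gt0 _))) fskew_abs.
Qed.
Lemma ferm_sh n x : 0 <= x -> `|x ^+ n * ferm (sh x)| <= n`!%:R * 2 ^+ n * 3 * expR (- x / 2).
Proof.
move=> x0; rewrite ger0_norm; last by rewrite mulr_ge0 ?exprn_ge0 // ltW // ferm_gt0.
apply: le_trans (shift_exp n x0); by rewrite ler_wpM2l ?exprn_ge0 // ferm_le_exp.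
Qed.
Lemma lexp_sh n x : 0 <= x -> `|x ^+ n * lexp (sh x)| <= n`!%:R * 2 ^+ n * 3 * expR (- x / 2).
Proof.
move=> x0; rewrite ger0_norm; last by rewrite mulr_ge0 ?exprn_ge0 // lexp_ge0.
apply: le_trans (shift_exp n x0); by rewrite ler_wpM2l ?exprn_ge0 // lexp_le_exp.
Qed.
(** The shifted argument may be as low as -1, where [dilog_limit] does not apply. There e^{- sh x}
    >= 1 dominates both [cdilog] <= 3 and the increment of [dilog] up to 0. *)
Lemma dilog_sh x : 0 <= x -> `|dilog (sh x) - dilog 0 - cdilog| <= 18 * expR (- x / 2).
Proof.
move=> x0; have := shift_exp 0 x0; rewrite expr0 mul1r fact0 !mul1r => hE.
have /andP[b1 b2] := shift_bound x; have E0 := expR_gt0 (- sh x).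
have [y0|y0] := leP 0 (sh x); first by apply: (le_trans (dilog_limit y0)); lra.
have e1' : 1 <= expR (- sh x) by rewrite -expR0 ler_expR; lra.
have h : `|dilog (sh x) - dilog 0| <= 3 * expR (- sh x).
  rewrite distrC; have := @abs_increment R (@dilog R) (fun z => (3 * expR (- sh x)) * z) (@lexp R) (fun=> 3 * expR (- sh x)) (sh x) 0 (ltW y0).
  move=> h; apply: (le_trans (h _ _ _)).
  - by move=> z /andP[z1 z2]; apply: ddilog; lra.
  - by move=> z _; der; ring.
  - move=> z /andP[z1 z2]; rewrite ger0_norm ?lexp_ge0 //.
    apply: (le_trans (lexp_le_exp _)); apply: (@le_trans _ _ (expR (- sh x))); last lra.
    by rewrite ler_expR; lra.
  by have : 0 < 3 * expR (- sh x); [lra | nra].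
have c1 : 0 <= cdilog <= 3.
  by have := pi_le4 R; have := @pi_gt0 R; rewrite /cdilog => p0 p4; apply/andP; split; nra.
move: c1 h => /andP[c0 c3]; rewrite !ler_norml => /andP[? ?]; apply/andP; split; lra.
Qed.

Local Ltac pow_bounds x0 :=
  try (match goal with |- context [fvar] => idtac end;
       have := fvar_sh 0 x0; have := fvar_sh 1 x0; have := fvar_sh 2 x0);
  try (match goal with |- context [fskew] => idtac end;
       have := fskew_sh 0 x0; have := fskew_sh 1 x0; have := fskew_sh 2 x0);
  try (match goal with |- context [ferm] => idtac end;
       have := ferm_sh 0 x0; have := ferm_sh 1 x0; have := ferm_sh 2 x0);
  try (match goal with |- context [lexp] => idtac end;
       have := lexp_sh 0 x0; have := lexp_sh 1 x0);
  try (match goal with |- context [dilog] => idtac end; have := dilog_sh x0);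
  rewrite ?expr0 ?expr1 ?mul1r /factorial /= ?muln1 ?mul1r;
  rewrite !ler_norml;
  repeat (case/andP => ? ?); apply/andP; split; try lra.

(** Here and below the primitives come from repeated integration by parts along the chain [dilog],
    [lexp], [ferm], [fvar], [fskew]. They are evaluated at the shifted origin - e tau. *)
Lemma class_x_ferm :
  `|class_sum (fun x => x * ferm (sh x)) - (dilog 0 + cdilog - dilog (- (e * tau)))| <= 500 * s.
Proof.
have := @class_sum_bound (fun x => - (x * lexp (sh x)) + dilog (sh x)) (fun x => x * ferm (sh x))
  (fun x => ferm (sh x) - x * fvar (sh x)) 20 (dilog 0 + cdilog).
rewrite mul0r oppr0 add0r sub0r; apply; first by lra.
- by move=> x x0; derF; [exact: sh_gtN2 | ring].
- by move=> x x0; derF; ring.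
- by move=> x x0; pow_bounds x0.
- by move=> x0; pow_bounds x0.
Qed.

Lemma class_x2_fvar :
  `|class_sum (fun x => x ^+ 2 * fvar (sh x)) - 2 * (dilog 0 + cdilog - dilog (- (e * tau)))| <= 500 * s.
Proof.
have := @class_sum_bound (fun x => - (x ^+ 2 * ferm (sh x)) - 2 * (x * lexp (sh x)) + 2 * dilog (sh x)) (fun x => x ^+ 2 * fvar (sh x))
  (fun x => 2 * (x * fvar (sh x)) - x ^+ 2 * fskew (sh x)) 100 (2 * (dilog 0 + cdilog)).
rewrite expr0n /= !mul0r oppr0 mulr0 subr0 add0r sub0r -mulrBr; apply; first by lra.
- by move=> x x0; derF; [exact: sh_gtN2 | ring].
- by move=> x x0; derF; ring.
- by move=> x x0; pow_bounds x0.
- by move=> x0; pow_bounds x0.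
Qed.
Lemma class_x_fvar :
  `|class_sum (fun x => x * fvar (sh x)) - lexp (- (e * tau))| <= 500 * s.
Proof.
have := @class_sum_bound (fun x => - (x * ferm (sh x)) - lexp (sh x)) (fun x => x * fvar (sh x))
  (fun x => fvar (sh x) - x * fskew (sh x)) 20 0.
rewrite mul0r oppr0 !add0r opprK; apply; first by lra.
- by move=> x x0; derF; ring.
- by move=> x x0; derF; ring.
- by move=> x x0; pow_bounds x0.
- by move=> x0; pow_bounds x0.
Qed.

Lemma class_fvar :
  `|class_sum (fun x => fvar (sh x)) - ferm (- (e * tau))| <= 500 * s.
Proof.
have := @class_sum_bound (fun x => - ferm (sh x)) (fun x => fvar (sh x))
  (fun x => - fskew (sh x)) 20 0.
rewrite !add0r opprK; apply; first by lra.
- by move=> x x0; derF; ring.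
- by move=> x x0; derF; ring.
- by move=> x x0; pow_bounds x0.
- by move=> x0; pow_bounds x0.
Qed.

Lemma dfskew x : der_at (@fskew R) x (2 * fvar x ^+ 2 - fskew x * (1 - 2 * ferm x)).
Proof.
have h := @dferm R x; have h2 := @dfvar R x; rewrite {1}/fskew; der.
by rewrite /fskew; ring.
Qed.

Lemma class_fskew :
  `|class_sum (fun x => fskew (sh x)) - fvar (- (e * tau))| <= 500 * s.
Proof.
have := @class_sum_bound (fun x => - fvar (sh x)) (fun x => fskew (sh x))
  (fun x => 2 * fvar (sh x) ^+ 2 - fskew (sh x) * (1 - 2 * ferm (sh x))) 20 0.
rewrite !add0r opprK; apply; first by lra.
- by move=> x x0; derF; ring.
- move=> x x0; eapply der_eq; first by apply: (@dcomp _ (@fskew R) sh); [exact: dfskew | der].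
  by rewrite /=; ring.
- move=> x x0; have := fvar_sh 0 x0; have v0 := fvar_gt0 (sh x); have v1 := fvar_le1 (sh x).
  have := fskew_abs (sh x); have := ferm_gt0 (sh x); have := ferm_lt1 (sh x).
  rewrite expr0 !mul1r (ger0_norm (ltW v0)) /factorial /= => f1 f0 k h.
  have : `|fskew (sh x) * (1 - 2 * ferm (sh x))| <= fvar (sh x).
    rewrite normrM -[leRHS]mulr1; apply: ler_pM => //.
    by rewrite ler_norml; apply/andP; split; lra.
  move: h; set V := fvar _ in v0 v1 *; set E := expR _ => h.
  by rewrite !ler_norml => /andP[? ?]; apply/andP; split; nra.
- by move=> x0; pow_bounds x0.
Qed.

Lemma class_x2_fskew :
  `|class_sum (fun x => x ^+ 2 * fskew (sh x)) - 2 * lexp (- (e * tau))| <= 500 * s.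
Proof.
have := @class_sum_bound (fun x => - (x ^+ 2 * fvar (sh x)) - 2 * (x * ferm (sh x)) - 2 * lexp (sh x)) (fun x => x ^+ 2 * fskew (sh x))
  (fun x => 2 * (x * fskew (sh x)) + x ^+ 2 * (2 * fvar (sh x) ^+ 2 - fskew (sh x) * (1 - 2 * ferm (sh x)))) 100 0.
rewrite expr0n /= !mul0r oppr0 mulr0 oppr0 !add0r opprK; apply; first by lra.
- by move=> x x0; derF; ring.
- move=> x x0; have hk : der_at (fun z => fskew (sh z)) x (2 * fvar (sh x) ^+ 2 - fskew (sh x) * (1 - 2 * ferm (sh x))).
    eapply der_eq; first by apply: (@dcomp _ (@fskew R) sh); [exact: dfskew | der].
    by rewrite /=; ring.
  by eapply der_eq; [apply: dM; [der_step; exact: dI | exact: hk] | cbn beta; rewrite /=; ring].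
- move=> x x0; have := fvar_sh 2 x0; have v0 := fvar_gt0 (sh x); have v1 := fvar_le1 (sh x).
  have := fskew_abs (sh x); have := ferm_gt0 (sh x); have := ferm_lt1 (sh x); have := fskew_sh 1 x0.
  rewrite expr1 (@ger0_norm _ (x ^+ 2 * fvar _)); last by rewrite mulr_ge0 ?exprn_ge0 // ltW.
  rewrite /factorial /= => ks f1 f0 k h.
  have : `|fskew (sh x) * (1 - 2 * ferm (sh x))| <= fvar (sh x).
    rewrite normrM -[leRHS]mulr1; apply: ler_pM => //.
    by rewrite ler_norml; apply/andP; split; lra.
  move: h ks; set V := fvar _ in v0 v1 *; set E := expR _ => h ks h1.
  have : `|x ^+ 2 * (2 * V ^+ 2 - fskew (sh x) * (1 - 2 * ferm (sh x)))| <= 2 * (x ^+ 2 * V).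
    rewrite normrM (ger0_norm (sqr_ge0 x)) [leRHS]mulrCA ler_wpM2l ?sqr_ge0 //.
    by move: h1; rewrite !ler_norml => /andP[? ?]; apply/andP; split; nra.
  move: ks; rewrite !ler_norml => /andP[? ?] /andP[? ?]; apply/andP; split; lra.
- by move=> x0; pow_bounds x0.
Qed.

(** This sum and the next one need the boundary term: divided by s they give the mean of [pd] and
    the logarithm of the partition function, whose bounded terms are visible in the theorem. *)
Lemma class_ferm :
  `|class_sum (fun x => ferm (sh x)) - lexp (- (e * tau)) - s * (1 / 2 - a) * ferm (- (e * tau))| <= 600 * s ^+ 2.
Proof.
have := @class_sum_bound2 (fun x => - lexp (sh x)) (fun x => ferm (sh x))
  (fun x => - fvar (sh x)) (fun x => fskew (sh x)) 20 0.
rewrite !add0r opprK; apply; first by lra.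
- by move=> x x0; derF; ring.
- by move=> x x0; derF; ring.
- by move=> x x0; derF; ring.
- by move=> x x0; pow_bounds x0.
- by move=> x0; pow_bounds x0.
- by move=> x0; pow_bounds x0.
Qed.

Lemma class_lexp :
  `|class_sum (fun x => lexp (sh x)) - (dilog 0 + cdilog - dilog (- (e * tau))) - s * (1 / 2 - a) * lexp (- (e * tau))| <= 600 * s ^+ 2.
Proof.
have := @class_sum_bound2 (fun x => dilog (sh x)) (fun x => lexp (sh x))
  (fun x => - ferm (sh x)) (fun x => fvar (sh x)) 20 (dilog 0 + cdilog).
rewrite !add0r; apply; first by lra.
- by move=> x x0; derF; [exact: sh_gtN2 | ring].
- by move=> x x0; derF; ring.
- by move=> x x0; derF; ring.
- by move=> x x0; pow_bounds x0.
- by move=> x0; pow_bounds x0.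
- by move=> x0; pow_bounds x0.
Qed.
End ClassSums.

Section Symmetry.
Variable R : realType.
Implicit Types x : R.
(** The derivative of the left side is [lexp x - lexp (- x)], which is exactly - x by [lexpN]. Hence
    the opposite tilts of the two classes leave only a quadratic term. *)
Lemma dilog_sym x : 0 <= x <= 1 -> dilog x + dilog (- x) = 2 * dilog 0 - x ^+ 2 / 2.
Proof.
move=> /andP[x0 x1].
have := @abs_increment R (fun z => dilog z + dilog (- z) + z ^+ 2 / 2) (fun=> 0) (fun=> 0) (fun=> 0) 0 x x0.
rewrite !oppr0 expr0n /= !mul0r !addr0 => h.
have {h} : `|dilog x + dilog (- x) + x ^+ 2 / 2 - (dilog 0 + dilog 0)| <= 0.
  apply: h => z /andP[z0 zx]; [ | exact: dC | by rewrite normr0].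
  eapply der_eq.
    apply: dD; [apply: dD; [apply: ddilog; lra | apply: (@dcomp _ (@dilog R) (fun z => - z)); [apply: ddilog; lra | der_step; exact: dI]] | der; reflexivity].
  by rewrite lexpN /=; field.
by rewrite normr_le0 => /eqP; lra.
Qed.
Lemma lexp_sym x : lexp (- x) - lexp x = x.
Proof. by rewrite lexpN; ring. Qed.
Lemma ferm_sym x : ferm x + ferm (- x) = 1.
Proof. by rewrite fermN; ring. Qed.
Lemma ferm_near0 x : 0 <= x -> `|ferm x - 1 / 2| <= x.
Proof.
move=> x0; rewrite -ferm0.
have := @abs_increment R (@ferm R) (fun y => y) (fun y => - fvar y) (fun=> 1) 0 x x0.
rewrite subr0; apply => y _; [exact: dferm | exact: dI | ].
by rewrite normrN ger0_norm ?(ltW (fvar_gt0 y)) //; have := fvar_le1 y; lra.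
Qed.
Lemma lexp_near0 x : `|x| <= 1 -> `|lexp (- x) - ln 2 - x / 2| <= x ^+ 2.
Proof.
have h (y : R) : 0 <= y -> `|lexp (- y) - ln 2 - y / 2| <= y ^+ 2 / 2.
  move=> y0; rewrite -lexp0.
  have := @abs_increment R (fun z => lexp (- z) - z / 2) (fun z => z ^+ 2 / 2) (fun z => ferm (- z) - 1 / 2) (fun z => z) 0 y y0.
  rewrite oppr0 expr0n /= !mul0r !subr0 addrAC; apply => z /andP[z0 _].
  - eapply der_eq; first by apply: dD; [apply: (@dcomp _ (@lexp R) (fun z => - z)); [exact: dlexp | der_step; exact: dI] | der; reflexivity].
    by rewrite /=; field.
  - by der; field.
  have := ferm_near0 z0; rewrite fermN; have -> : 1 - ferm z - 1 / 2 = - (ferm z - 1 / 2) by field.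
  by rewrite normrN.
move=> x1; have s0 := sqr_ge0 x; have [x0|x0] := leP 0 x; first by apply: (le_trans (h _ x0)); lra.
have := h (- x); rewrite opprK sqrrN; have := lexpN x => e hh.
have -> : lexp (- x) - ln 2 - x / 2 = lexp x - ln 2 - - x / 2 by rewrite e; field.
apply: (le_trans (hh _)); lra.
Qed.
End Symmetry.

(** The class of N is represented by N, not by 0, so the classes are indexed by g < N through g + 1;
    the only delicate case is the residue 0. *)
Lemma residue_eq (N g c : nat) : (g < N)%N -> (1 <= c <= N)%N -> (g.+1 == c %[mod N]) = (g == c.-1).
Proof.
move=> gN /andP[c1 cN]; have [gE|gn] := eqVneq g.+1 N; have [cE|cn] := eqVneq c N.
- by rewrite gE cE eqxx; apply/esym/eqP; lia.
- rewrite gE modnn modn_small; last by lia.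
  by apply/eqP/eqP; lia.
- rewrite cE modnn modn_small; last by lia.
  by apply/eqP/eqP; lia.
- by rewrite !modn_small; [apply/eqP/eqP; lia | lia | lia].
Qed.

Section MomentSums.
Variable R : realType.
Variables N alpha beta : nat.
Hypotheses (hN2 : (2 <= N)%N) (halpha : (1 <= alpha <= N)%N) (hbeta : (1 <= beta <= N)%N).
Hypothesis (hab : alpha <> beta).
Implicit Types (F : R -> R) (x y : R).

(* The contribution of the part [k] to [pd]. *)
Definition eps (k : nat) : R :=
  (k == alpha %[mod N] : nat)%:R - (k == beta %[mod N] : nat)%:R.

Lemma eps_class g j : eps (g + N * j) = eps g.
Proof. by rewrite /eps mulnC addnC !modnMDl. Qed.

Lemma sum_eps_index (G : nat -> R -> R) :
  \sum_(g < N) G g (eps g.+1) =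
  \sum_(g < N) G g 0 + (G alpha.-1 1 - G alpha.-1 0) + (G beta.-1 (-1) - G beta.-1 0).
Proof.
have aN : (alpha.-1 < N)%N by lia.
have bN : (beta.-1 < N)%N by lia.
have ab : Ordinal bN != Ordinal aN by apply/eqP => /(congr1 val) /=; lia.
rewrite (bigD1 (Ordinal aN)) // (bigD1 (Ordinal bN)) //= /eps !residue_eq // !eqxx.
rewrite [in RHS](bigD1 (Ordinal aN)) // [in RHS](bigD1 (Ordinal bN)) //=.
have -> : (alpha.-1 == beta.-1) = false by apply/eqP; lia.
have -> : (beta.-1 == alpha.-1) = false by apply/eqP; lia.
rewrite subr0 sub0r.
under eq_bigr => i hi.
  rewrite !residue_eq //.
  have -> : (val i == alpha.-1) = false by apply: negbTE; case/andP: hi => hi _; apply: contra hi => /eqP h; apply/eqP/val_inj.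
  have -> : (val i == beta.-1) = false by apply: negbTE; case/andP: hi => _ hi; apply: contra hi => /eqP h; apply/eqP/val_inj.
  rewrite subrr; over.
ring.
Qed.

Lemma sum_eps F : \sum_(g < N) F (eps g.+1) = F 1 + F (-1) + (N%:R - 2) * F 0.
Proof.
rewrite (sum_eps_index (fun _ => F)) sumr_const card_ord -[F 0 *+ N]mulr_natr; ring.
Qed.

Lemma sum_by_class (V : nmodType) (F : nat -> V) J :
  \sum_(k < N * J) F k.+1 = \sum_(g < N) \sum_(j < J) F (g.+1 + N * j)%N.
Proof.
elim: J => [|J IH].
  by rewrite muln0 big_ord0 big1 // => g _; rewrite big_ord0.
rewrite mulnS addnC big_split_ord /= IH -big_split /=.
by apply: eq_bigr => g _; rewrite big_ord_recr /=; congr (_ + F _); rewrite addnC addSn.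
Qed.

Variables (tau : R) (J : nat).
Local Notation T := (tau ^+ 2).
Local Notation s := (N%:R * T).
Hypotheses (tau01 : 0 < tau <= 1) (s1 : s <= 1).
Hypothesis hJ : expR (- (s * J%:R) / 2) <= s ^+ 2.

Definition ksum (Phi : R -> R -> R) : R := \sum_(k < N * J) Phi (eps k.+1) (k.+1%:R * T).

Let N0 : 0 < N%:R :> R. Proof. by rewrite ltr0n; lia. Qed.
Let N2 : 2 <= N%:R :> R. Proof. by rewrite ler_nat. Qed.
Let t0 : 0 < tau. Proof. by case/andP: tau01. Qed.
Let T0 : 0 < T. Proof. by rewrite exprn_gt0. Qed.
Let s01 : 0 < s <= 1. Proof. by rewrite s1 mulr_gt0. Qed.

(** The part g + 1 + N j has rescaled size s (j + (g + 1) / N), which makes (g + 1) / N the offset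
    of its class. *)
Lemma ksum_class Phi :
  s * ksum Phi = \sum_(g < N) class_sum s (g.+1%:R / N%:R) J (Phi (eps g.+1)).
Proof.
rewrite /ksum (sum_by_class (fun k => Phi (eps k) (k%:R * T))) mulr_sumr.
apply: eq_bigr => g _; rewrite /class_sum; congr (_ * _); apply: eq_bigr => j _.
rewrite eps_class natrD natrM; congr Phi; field.
by rewrite gt_eqF.
Qed.

Lemma index01 g : (g < N)%N -> 0 <= (g.+1%:R / N%:R : R) <= 1.
Proof.
move=> gN; rewrite divr_ge0 //= ler_pdivrMr // mul1r ler_nat //.
Qed.

Lemma eps_abs k : `|eps k| <= 1.
Proof.
rewrite /eps; case: (_ == _); case: (_ == _); rewrite ?subrr ?subr0 ?sub0r ?normrN ?normr0 ?normr1 //.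
Qed.

Lemma ksum_bound Phi (I : R -> R) K :
  (forall e a, 0 <= a <= 1 -> `|e| <= 1 -> `|class_sum s a J (Phi e) - I e| <= K) ->
  `|s * ksum Phi - (I 1 + I (-1) + (N%:R - 2) * I 0)| <= N%:R * K.
Proof.
move=> h; rewrite ksum_class -sum_eps -sumrB; apply: (le_trans (ler_norm_sum _ _ _)).
apply: (@le_trans _ _ (\sum_(g < N) K)); last by rewrite sumr_const card_ord mulr_natl.
by apply: ler_sum => g _; apply: h; [exact: index01 | exact: eps_abs].
Qed.

Lemma class_sumZ a (c : R) (h : R -> R) : class_sum s a J (fun x => c * h x) = c * class_sum s a J h.
Proof. by rewrite /class_sum -mulr_sumr mulrCA. Qed.

Let dsym : dilog tau + dilog (- tau) = 2 * dilog 0 - T / 2 := dilog_sym (introT andP (conj (ltW t0) (proj2 (andP tau01)))).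

Lemma divT_bound (A B K : R) : `|s * A - B| <= N%:R * (K * s) -> `|A - B / s| <= N%:R * K.
Proof.
have /andP[s0 _] := s01.
have -> : s * A - B = s * (A - B / s) by field; rewrite gt_eqF // gt_eqF.
rewrite normrM (ger0_norm (ltW s0)) mulrA [leRHS]mulrC ler_pM2l //.
Qed.

Lemma ksum_energy :
  `|ksum (fun e x => x * ferm (x - e * tau)) - (cdilog R / T + (2 * N%:R)^-1)| <= N%:R * 500.
Proof.
have := @ksum_bound (fun e x => x * ferm (x - e * tau)) (fun e => dilog 0 + cdilog R - dilog (- (e * tau))) (500 * s).
move=> h; have {h} := h (fun e a a01 e1 => class_x_ferm tau01 s01 a01 e1 hJ).
move/divT_bound; rewrite mul1r mulN1r opprK mul0r oppr0.
have -> // : (dilog 0 + cdilog R - dilog (- tau) + (dilog 0 + cdilog R - dilog tau) +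
   (N%:R - 2) * (dilog 0 + cdilog R - dilog 0)) / s = cdilog R / T + (2 * N%:R)^-1.
have -> : dilog 0 + cdilog R - dilog (- tau) + (dilog 0 + cdilog R - dilog tau) +
   (N%:R - 2) * (dilog 0 + cdilog R - dilog 0) = N%:R * cdilog R + 2 * dilog 0 - (dilog tau + dilog (- tau)) by ring.
by rewrite dsym; field; rewrite !gt_eqF.
Qed.

Lemma ksum_var_energy :
  `|ksum (fun e x => x ^+ 2 * fvar (x - e * tau)) - (2 * cdilog R / T + N%:R^-1)| <= N%:R * 500.
Proof.
have := @ksum_bound (fun e x => x ^+ 2 * fvar (x - e * tau)) (fun e => 2 * (dilog 0 + cdilog R - dilog (- (e * tau)))) (500 * s).
move=> h; have {h} := h (fun e a a01 e1 => class_x2_fvar tau01 s01 a01 e1 hJ).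
move/divT_bound; rewrite mul1r mulN1r opprK mul0r oppr0.
set X := _ + _ + _; have -> // : X / s = 2 * cdilog R / T + N%:R^-1.
have -> : X = 2 * N%:R * cdilog R + 4 * dilog 0 - 2 * (dilog tau + dilog (- tau)) by rewrite /X; ring.
by rewrite dsym; field; rewrite !gt_eqF.
Qed.

Lemma ksum_cov :
  `|ksum (fun e x => e * (x * fvar (x - e * tau))) - (N%:R * tau)^-1| <= N%:R * 500.
Proof.
have := @ksum_bound (fun e x => e * (x * fvar (x - e * tau))) (fun e => e * lexp (- (e * tau))) (500 * s).
have {1}-> : (N%:R * tau)^-1 = (1 * lexp (- (1 * tau)) + -1 * lexp (- (-1 * tau)) + (N%:R - 2) * (0 * lexp (- (0 * tau)))) / s.
  rewrite mul1r mul1r !mulN1r opprK mul0r mulr0 addr0 lexp_sym; field.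
  by rewrite !gt_eqF.
move=> h; apply: divT_bound; apply: h => e a a01 e1.
rewrite class_sumZ -mulrBr normrM; have := class_x_fvar tau01 s01 a01 e1 hJ.
set A := `|_ - _| => hA; have := normr_ge0 e; have : 0 <= A by exact: normr_ge0.
nra.
Qed.

Lemma ksum_var_diff :
  `|ksum (fun e x => e ^+ 2 * fvar (x - e * tau)) - s^-1| <= N%:R * 500.
Proof.
have := @ksum_bound (fun e x => e ^+ 2 * fvar (x - e * tau)) (fun e => e ^+ 2 * ferm (- (e * tau))) (500 * s).
have {1}-> : s^-1 = (1 ^+ 2 * ferm (- (1 * tau)) + (-1) ^+ 2 * ferm (- (-1 * tau)) + (N%:R - 2) * (0 ^+ 2 * ferm (- (0 * tau)))) / s.
  rewrite sqrrN !expr1n expr0n /= !mul1r mulN1r opprK mul0r mulr0 addr0 addrC ferm_sym mul1r //.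
move=> h; apply: divT_bound; apply: h => e a a01 e1.
rewrite class_sumZ -mulrBr normrM; have := class_fvar tau01 s01 a01 e1 hJ.
have : `|e ^+ 2| <= 1 by rewrite normrX expr_le1.
set A := `|_ - _| => he hA; have := normr_ge0 (e ^+ 2); have : 0 <= A by exact: normr_ge0.
nra.
Qed.

Lemma ksum_skew21 :
  `|ksum (fun e x => e * (x ^+ 2 * fskew (x - e * tau))) - 2 * (N%:R * tau)^-1| <= N%:R * 500.
Proof.
have := @ksum_bound (fun e x => e * (x ^+ 2 * fskew (x - e * tau))) (fun e => e * (2 * lexp (- (e * tau)))) (500 * s).
have {1}-> : 2 * (N%:R * tau)^-1 = (1 * (2 * lexp (- (1 * tau))) + -1 * (2 * lexp (- (-1 * tau))) + (N%:R - 2) * (0 * (2 * lexp (- (0 * tau))))) / s.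
  rewrite !mul1r !mulN1r opprK mul0r mulr0 addr0 -mulrN -mulrDr lexp_sym; field.
  by rewrite !gt_eqF.
move=> h; apply: divT_bound; apply: h => e a a01 e1.
rewrite class_sumZ -mulrBr normrM; have := class_x2_fskew tau01 s01 a01 e1 hJ.
set A := `|_ - _| => hA; have := normr_ge0 e; have : 0 <= A by exact: normr_ge0.
nra.
Qed.

(** The term of order 1 / s vanishes because [fvar] is even while e^3 has opposite signs on the two
    classes. *)
Lemma ksum_skew03 :
  `|ksum (fun e x => e ^+ 3 * fskew (x - e * tau))| <= N%:R * 500.
Proof.
have := @ksum_bound (fun e x => e ^+ 3 * fskew (x - e * tau)) (fun e => e ^+ 3 * fvar (- (e * tau))) (500 * s).
rewrite -[X in `|X| <= _ * 500]subr0.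
have E0 : 0 = (1 ^+ 3 * fvar (- (1 * tau)) + (-1) ^+ 3 * fvar (- (-1 * tau)) + (N%:R - 2) * (0 ^+ 3 * fvar (- (0 * tau)))) / s :> R.
  by rewrite !fvarN mulN1r fvarN mul1r expr1n expr0n /=; ring.
move=> h; rewrite [X in _ - X]E0; apply: divT_bound; apply: h => e a a01 e1.
rewrite class_sumZ -mulrBr normrM; have := class_fskew tau01 s01 a01 e1 hJ.
have : `|e ^+ 3| <= 1 by rewrite normrX expr_le1.
set A := `|_ - _| => he hA; have := normr_ge0 (e ^+ 3); have : 0 <= A by exact: normr_ge0.
nra.
Qed.

Lemma ksum_abs n : ksum (fun e x => x ^+ n * fvar (x - e * tau)) <= n`!%:R * 2 ^+ n * 12 / T.
Proof.
have T01 : 0 < T <= 1 by rewrite T0 /= expr_le1 //; [case/andP: tau01 | exact: ltW].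
have C0 : 0 <= n`!%:R * 2 ^+ n * 3 :> R by rewrite !mulr_ge0 // exprn_ge0.
apply: (@le_trans _ _ (\sum_(k < N * J) n`!%:R * 2 ^+ n * 3 * expR (- (T * k%:R) / 2))).
  apply: ler_sum => k _; have x0 : 0 <= k.+1%:R * T by rewrite mulr_ge0 // ltW.
  have := fvar_sh tau01 (eps_abs k.+1) n x0; rewrite ler_norml => /andP[_ h].
  apply: (le_trans h); rewrite ler_wpM2l // ler_expR -natr1; nra.
rewrite -mulr_sumr; have := geometric_decay (N * J) T01.
rewrite -ler_pdivlMl //; set S := \sum_(j < _) _ => hS.
have -> : n`!%:R * 2 ^+ n * 12 / T = n`!%:R * 2 ^+ n * 3 * (T^-1 * 4) by ring.
by rewrite ler_wpM2l.
Qed.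

(* The bounded term of the mean of [pd]. *)
Definition mu0 : R := (beta%:R - alpha%:R) / (2 * N%:R).

Lemma ksum_bound_index Phi (I : R -> R -> R) K :
  (forall e a, 0 <= a <= 1 -> `|e| <= 1 -> `|class_sum s a J (Phi e) - I a e| <= K) ->
  `|s * ksum Phi - (\sum_(g < N) I (g.+1%:R / N%:R) 0
      + (I (alpha%:R / N%:R) 1 - I (alpha%:R / N%:R) 0) + (I (beta%:R / N%:R) (-1) - I (beta%:R / N%:R) 0))| <= N%:R * K.
Proof.
move=> h; rewrite ksum_class; have := sum_eps_index (fun g e => I (g.+1%:R / N%:R) e).
rewrite !prednK; [|by case/andP: hbeta|by case/andP: halpha].
move=> <-; rewrite -sumrB; apply: (le_trans (ler_norm_sum _ _ _)).
apply: (@le_trans _ _ (\sum_(g < N) K)); last by rewrite sumr_const card_ord mulr_natl.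
by apply: ler_sum => g _; apply: h; [exact: index01 | exact: eps_abs].
Qed.

Lemma ratio01 c : (1 <= c <= N)%N -> 0 <= (c%:R / N%:R : R) <= 1.
Proof. by move=> /andP[_ cN]; rewrite divr_ge0 //= ler_pdivrMr // mul1r ler_nat. Qed.

(** [lexp_sym] yields the leading term tau / s. In the boundary terms [ferm] at - tau and at tau is
    close to 1/2, and half the difference of (1/2 - alpha / N) and (1/2 - beta / N) is [mu0]. *)
Lemma ksum_mean_diff :
  `|ksum (fun e x => e * ferm (x - e * tau)) - ((N%:R * tau)^-1 + mu0)| <= (600 * N%:R ^+ 2 + 2) * tau.
Proof.
have := @ksum_bound_index (fun e x => e * ferm (x - e * tau)) (fun a e => e * (lexp (- (e * tau)) + s * (2^-1 - a) * ferm (- (e * tau)))) (600 * s ^+ 2).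
rewrite big1; last by move=> g _; rewrite mul0r.
rewrite !mul0r !subr0 add0r !mul1r !mulN1r opprK fermN => h.
(* The boundary terms are computed with [ferm tau] replaced by 1/2; the product subtracted here is
   the exact cost of that replacement. *)
have {h} : `|s * (ksum (fun e x => e * ferm (x - e * tau)) - ((N%:R * tau)^-1 + mu0) - (ferm tau - 1 / 2) * (alpha%:R / N%:R + beta%:R / N%:R - 1))| <= N%:R * (600 * s ^+ 2).
  apply: le_trans (h _); last first.
    move=> e a a01 e1; rewrite class_sumZ -mulrBr normrM; have := class_ferm tau01 s01 a01 e1 hJ.
    rewrite div1r opprD addrA; set A := `|_ - _| => hA; have := normr_ge0 e; have : 0 <= A by exact: normr_ge0.
    by have := sqr_ge0 s; nra.
  have := lexp_sym tau => hl.
  rewrite le_eqVlt; apply/orP; left; apply/eqP; congr `|_|.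
  have -> : lexp (- tau) = tau + lexp tau by lra.
  rewrite /mu0; field; rewrite !gt_eqF //.
have /andP[s0 _] := s01.
have -> : N%:R * (600 * s ^+ 2) = s * (N%:R * 600 * s) by ring.
rewrite normrM (ger0_norm (ltW s0)) ler_pM2l // => h1.
have h2 : `|(ferm tau - 1 / 2) * (alpha%:R / N%:R + beta%:R / N%:R - 1)| <= tau.
  have := ferm_near0 (ltW t0); have /andP[? ?] := ratio01 halpha; have /andP[? ?] := ratio01 hbeta.
  rewrite normrM => hf; have hr : `|alpha%:R / N%:R + beta%:R / N%:R - 1| <= 1 :> R by rewrite ler_norml; apply/andP; split; lra.
  by rewrite -[leRHS]mulr1; apply: ler_pM.
have t1 : tau <= 1 by case/andP: tau01.
have h3 : N%:R * 600 * s <= 600 * N%:R ^+ 2 * tau.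
  have -> : N%:R * 600 * s = 600 * N%:R ^+ 2 * tau * tau by ring.
  rewrite -mulrA; apply: ler_wpM2l; last by have := ler_wpM2l (ltW t0) t1; rewrite mulr1.
  by apply: mulr_ge0; [exact: ler0n | exact: sqr_ge0].
move: h1 h2; set A := ksum _ - _; set B := (_ - _) * _ => h1 h2.
have -> : A = (A - B) + B by ring.
have t0' : 0 < tau by exact: t0.
rewrite mulrDl; move: (600 * _ * tau) h3 => Y h3.
by apply: (le_trans (ler_normD _ _)); lra.
Qed.

(** The boundary terms of all classes together; they create the - ln 2 / 2 of the partition
    function, hence a factor 1 / sqrt 2 in the count. *)
Lemma sum_half_index : \sum_(g < N) (2^-1 - g.+1%:R / N%:R) = - (1 / 2) :> R.
Proof.
rewrite sumrB sumr_const card_ord -mulr_suml.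
have -> : \sum_(g < N) g.+1%:R = N%:R * (N%:R + 1) / 2 :> R.
  elim: (N) => [|m IH]; first by rewrite big_ord0 !mul0r.
  by rewrite big_ord_recr /= IH -natr1; field.
by rewrite -[_ *+ N]mulr_natr; field; rewrite gt_eqF.
Qed.

(** The term (2 N)^{-1} comes from the quadratic term of [dilog_sym], and tau * [mu0] from the
    linear terms of [lexp] at - tau and tau in the boundary terms of the two classes. *)
Lemma ksum_logZ :
  `|ksum (fun e x => lexp (x - e * tau)) - (cdilog R / T + (2 * N%:R)^-1 - ln 2 / 2 + tau * mu0)| <= (600 * N%:R ^+ 2 + 2) * T.
Proof.
have := @ksum_bound_index (fun e x => lexp (x - e * tau)) (fun a e => (dilog 0 + cdilog R - dilog (- (e * tau))) + s * (2^-1 - a) * lexp (- (e * tau))) (600 * s ^+ 2).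
rewrite mul0r oppr0 !mul1r !mulN1r opprK lexp0.
rewrite big_split /= sumr_const card_ord -mulr_suml -mulr_sumr sum_half_index => h.
pose d1 := lexp (- tau) - ln 2 - tau / 2; pose d2 := lexp tau - ln 2 + tau / 2.
have {h} : `|s * (ksum (fun e x => lexp (x - e * tau)) - (cdilog R / T + (2 * N%:R)^-1 - ln 2 / 2 + tau * mu0) - ((1 / 2 - alpha%:R / N%:R) * d1 + (1 / 2 - beta%:R / N%:R) * d2))| <= N%:R * (600 * s ^+ 2).
  apply: le_trans (h _); last first.
    move=> e a a01 e1; have := class_lexp tau01 s01 a01 e1 hJ.
    rewrite div1r; move: (class_sum _ _ _ _) (dilog 0 + _ - _) (s * _ * _) => A B D.
    by rewrite opprD addrA.
  rewrite le_eqVlt; apply/orP; left; apply/eqP; congr `|_|.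
  have -> : dilog (- tau) = 2 * dilog 0 - T / 2 - dilog tau by rewrite -dsym; ring.
  rewrite -[_ *+ N]mulr_natl /mu0 /d1 /d2; field; rewrite !gt_eqF //.
have /andP[s0 _] := s01.
have -> : N%:R * (600 * s ^+ 2) = s * (N%:R * 600 * s) by ring.
rewrite normrM (ger0_norm (ltW s0)) ler_pM2l // => h1.
have t1 : tau <= 1 by case/andP: tau01.
have hd1 : `|d1| <= T by apply: lexp_near0; rewrite ger0_norm // ltW.
have hd2 : `|d2| <= T.
  have := @lexp_near0 R (- tau); rewrite opprK sqrrN normrN (ger0_norm (ltW t0)) => /(_ t1).
  by rewrite mulNr opprK.
have h2 : `|(1 / 2 - alpha%:R / N%:R) * d1 + (1 / 2 - beta%:R / N%:R) * d2| <= 2 * T.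
  have /andP[? ?] := ratio01 halpha; have /andP[? ?] := ratio01 hbeta.
  apply: (le_trans (ler_normD _ _)); rewrite !normrM.
  have q1 : `|1 / 2 - alpha%:R / N%:R| <= 1 :> R by rewrite ler_norml; apply/andP; split; lra.
  have q2 : `|1 / 2 - beta%:R / N%:R| <= 1 :> R by rewrite ler_norml; apply/andP; split; lra.
  have p1 := ler_pM (normr_ge0 _) (normr_ge0 _) q1 hd1.
  have p2 := ler_pM (normr_ge0 _) (normr_ge0 _) q2 hd2.
  lra.
move: h1 h2; set A := ksum _ - _; set B := _ * d1 + _ => h1 h2.
have -> : A = (A - B) + B by ring.
have -> : (600 * N%:R ^+ 2 + 2) * T = N%:R * 600 * s + 2 * T by ring.
by apply: (le_trans (ler_normD _ _)); lra.
Qed.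

Lemma fvar_lower y : expR (- `|y|) / 4 <= fvar y.
Proof.
wlog y0 : y / 0 <= y.
  move=> h; have [y0|y0] := leP 0 y; first exact: h.
  by rewrite -fvarN -normrN; apply: h; lra.
rewrite ger0_norm // /fvar.
have -> : 1 - ferm y = expR y * ferm y.
  by rewrite /ferm; have := onepexp_gt0 y; set z := expR y => z0; field; rewrite gt_eqF.
have f1 : expR (- y) / 2 <= ferm y.
  rewrite expRN /ferm -invfM lef_pV2 ?posrE ?mulr_gt0 ?expR_gt0 ?onepexp_gt0 //.
  by have : 1 <= expR y by [rewrite -expR0 ler_expR]; lra.
have e0 := expR_gt0 (- y).
have ee : expR y * expR (- y) = 1 by rewrite expRN divff // gt_eqF ?expR_gt0.
have := ler_pM (ltW (divr_gt0 e0 _)) (ltW (divr_gt0 e0 _)) f1 f1.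
have e1 := expR_gt0 y.
rewrite ltr0n => /(_ isT isT) h.
have := ler_wpM2l (ltW e1) h; nra.
Qed.
End MomentSums.

(** * Cumulants of the tilted model *)

Section Moments.
Variable R : realType.
Variables N alpha beta : nat.
Hypotheses (hN2 : (2 <= N)%N) (halpha : (1 <= alpha <= N)%N) (hbeta : (1 <= beta <= N)%N).
Hypothesis (hab : alpha <> beta).
Local Notation eps := (@eps R N alpha beta).
Local Notation mu0 := (@mu0 R N alpha beta).

(* With [h] one of [ferm], [fvar], [fskew] these are the joint cumulants of [pd]
   and of the sum of the parts in the tilted model. *)
Definition msum (tau : R) (J i j : nat) (h : R -> R) : R :=
  \sum_(k < N * J) eps k.+1 ^+ i * k.+1%:R ^+ j * h (k.+1%:R * tau ^+ 2 - eps k.+1 * tau).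

Lemma msum_ksum tau J i j h : 0 < tau ->
  msum tau J i j h = ksum N alpha beta tau J (fun e x => e ^+ i * (x ^+ j * h (x - e * tau))) / (tau ^+ 2) ^+ j.
Proof.
move=> t0; rewrite /msum /ksum mulr_suml; apply: eq_bigr => k _.
have d0 : (tau ^+ 2) ^+ j != 0 by rewrite gt_eqF // !exprn_gt0.
by rewrite [(k.+1%:R * tau ^+ 2) ^+ j]exprMn; move: ((tau ^+ 2) ^+ j) d0 => d d0; field.
Qed.

(* The last condition makes the truncation to the parts up to [N * J] harmless. *)
Definition admissible (tau : R) (J : nat) : Prop :=
  [/\ 0 < tau <= 1, N%:R * tau ^+ 2 <= 1 &
      expR (- (N%:R * tau ^+ 2 * J%:R) / 2) <= (N%:R * tau ^+ 2) ^+ 2].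

Lemma msum_skew_abs tau J i j : `|msum tau J i j (@fskew R)| <= msum tau J 0 j (@fvar R).
Proof.
apply: (le_trans (ler_norm_sum _ _ _)); apply: ler_sum => k _.
rewrite expr0 mul1r [leLHS]normrM [X in X * _]normrM !normrX normr_nat.
apply: ler_pM; rewrite ?mulr_ge0 ?exprn_ge0 ?fskew_abs //.
rewrite -[leRHS]mul1r; apply: ler_wpM2r; rewrite ?exprn_ge0 //.
by rewrite exprn_ile1 // eps_abs.
Qed.

(** A factor k^j contributes T^{-j} and the number of relevant parts T^{-1}. The entries with an odd
    power of [eps] are smaller than this by at least a factor tau, because the two classes cancel to
    leading order. *)
Lemma moment_bounds : exists2 K : R, 1 <= K & forall tau J, admissible tau J ->
  let T := tau ^+ 2 in
  [/\ [/\ `|msum tau J 0 1 (@ferm R) - cdilog R / T ^+ 2| <= K / T,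
      `|msum tau J 1 0 (@ferm R) - ((N%:R * tau)^-1 + mu0)| <= K * tau,
      `|msum tau J 0 2 (@fvar R) - 2 * cdilog R / T ^+ 3| <= K / T ^+ 2,
      `|msum tau J 1 1 (@fvar R)| <= K / (tau * T) &
      `|msum tau J 2 0 (@fvar R) - (N%:R * T)^-1| <= K],
      [/\ `|msum tau J 0 3 (@fskew R)| <= K / T ^+ 4,
      `|msum tau J 1 2 (@fskew R)| <= K / (tau * T ^+ 2),
      `|msum tau J 2 1 (@fskew R)| <= K / T ^+ 2 &
      `|msum tau J 3 0 (@fskew R)| <= K],
      [/\ msum tau J 0 0 (@fvar R) <= K / T, msum tau J 0 4 (@fvar R) <= K / T ^+ 5
        & msum tau J 0 6 (@fvar R) <= K / T ^+ 7] &
      `|msum tau J 0 0 (@lexp R) - (cdilog R / T + (2 * N%:R)^-1 - ln 2 / 2 + tau * mu0)| <= K * T].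
Proof.
have [C [C0 hC]] : exists C : nat -> R, (forall n, 0 <= C n) /\ (forall n, n`!%:R * 2 ^+ n * 12 <= C n).
  by exists (fun n => n`!%:R * 2 ^+ n * 12); split => // n; rewrite !mulr_ge0 // exprn_ge0.
have N2 : 2 <= N%:R :> R by rewrite ler_nat.
have [C6 C60 hC6] : exists2 C6 : R, 0 <= C6 & 600 * N%:R ^+ 2 + 2 <= C6.
  exists (600 * N%:R ^+ 2 + 2); last exact: lexx.
  by apply: addr_ge0; [apply: mulr_ge0; [exact: ler0n|exact: sqr_ge0]|exact: ler0n].
have [C5 C50 hC5] : exists2 C5 : R, 0 <= C5 & N%:R * 500 <= C5.
  by exists (N%:R * 500); [apply: mulr_ge0; exact: ler0n | exact: lexx].
exists (C6 + C5 + 2 + C 0%N + C 1%N + C 3%N + C 4%N + C 6%N).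
  have := C0 0%N; have := C0 1%N; have := C0 3%N; have := C0 4%N; have := C0 6%N; lra.
set K := _ + C 6%N.
have KC6 : C6 <= K by have := C0 0%N; have := C0 1%N; have := C0 3%N; have := C0 4%N; have := C0 6%N; rewrite /K; lra.
have KC5 : C5 + 2 <= K by have := C0 0%N; have := C0 1%N; have := C0 3%N; have := C0 4%N; have := C0 6%N; rewrite /K; lra.
have KC n : n \in [:: 0; 1; 3; 4; 6]%N -> C n <= K.
  have := C0 0%N; have := C0 1%N; have := C0 3%N; have := C0 4%N; have := C0 6%N => c0 c1 c3 c4 c6.
  by clear - n C60 C50 c0 c1 c3 c4 c6 hN2 halpha hbeta hab; rewrite !inE /K => /or4P[/eqP->|/eqP->|/eqP->|/orP[]/eqP->]; lra.
move: K KC6 KC5 KC => K KC6 KC5 KC tau J [tau01 s1 hJ] T.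
have /andP[t0 t1] := tau01.
have T0 : 0 < T by rewrite exprn_gt0.
have invN : 0 < (N%:R)^-1 :> R by rewrite invr_gt0; lra.
have invN2 : N%:R^-1 <= 1 :> R by clear - N2 hN2 halpha hbeta hab; rewrite invf_le1; lra.
have K0 : 0 <= K by lra.
have dv (A B X : R) j : `|A - B| <= X -> `|A / T ^+ j - B / T ^+ j| <= X / T ^+ j.
  have Tj : 0 <= (T ^+ j)^-1 by rewrite invr_ge0 exprn_ge0 // ltW.
  by move=> h; rewrite -mulrBl normrM (ger0_norm Tj); apply: ler_wpM2r.
have absn n : n \in [:: 0; 1; 3; 4; 6]%N -> msum tau J 0 n (@fvar R) <= K / T ^+ n.+1.
  move=> hn; rewrite msum_ksum //; under [X in ksum _ _ _ _ _ X / _]eq_fun do under eq_fun do rewrite expr0 mul1r.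
  have := ksum_abs N alpha beta J tau01 n; have h1 := KC n hn; have h0 := hC n; rewrite -/T => h2.
  rewrite exprS invfM mulrA; apply: ler_wpM2r; first by rewrite invr_ge0 exprn_ge0 // ltW.
  by apply: (le_trans h2); apply: ler_wpM2r; [rewrite invr_ge0 ltW | exact: le_trans h1].
split.
- split.
  + rewrite msum_ksum //; under [X in ksum _ _ _ _ _ X / _]eq_fun do under eq_fun do rewrite expr0 mul1r expr1.
    have h := ksum_energy hN2 halpha hbeta hab tau01 s1 hJ.
    have h2 : `|ksum N alpha beta tau J (fun e x => x * ferm (x - e * tau)) - cdilog R / T| <= K.
      have : (2 * N%:R)^-1 <= 1 :> R by clear - invN invN2 hN2 halpha hbeta hab; rewrite invfM; lra.
      have : 0 < (2 * N%:R)^-1 :> R by rewrite invfM mulr_gt0.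
      move: h; clear - KC5 KC6 hC5 hC6 C50 C60 K0 invN invN2 s1 t0 t1 T0 hN2 halpha hbeta hab; rewrite -/T; set A := ksum _ _ _ _ _ _; rewrite !ler_norml => /andP[? ?] ? ?; apply/andP; split; lra.
    have := dv _ _ _ 1%N h2; rewrite -/T expr1.
    by have -> : cdilog R / T / T = cdilog R / T ^+ 2 by field; rewrite gt_eqF.
  + rewrite msum_ksum //; under [X in ksum _ _ _ _ _ X / _]eq_fun do under eq_fun do rewrite expr1 expr0 mul1r.
    rewrite expr0 divr1; have := ksum_mean_diff hN2 halpha hbeta hab tau01 s1 hJ.
    move=> h; apply: (le_trans h); apply: ler_wpM2r; [exact: ltW | clear - KC5 KC6 hC5 hC6 C50 C60 K0 invN invN2 s1 t0 t1 T0 hN2 halpha hbeta hab; lra].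
  + rewrite msum_ksum //; under [X in ksum _ _ _ _ _ X / _]eq_fun do under eq_fun do rewrite expr0 mul1r.
    have h := ksum_var_energy hN2 halpha hbeta hab tau01 s1 hJ.
    have h2 : `|ksum N alpha beta tau J (fun e x => x ^+ 2 * fvar (x - e * tau)) - 2 * cdilog R / T| <= K.
      move: h; clear - KC5 KC6 hC5 hC6 C50 C60 K0 invN invN2 s1 t0 t1 T0 hN2 halpha hbeta hab; rewrite -/T; set A := ksum _ _ _ _ _ _; rewrite !ler_norml => /andP[? ?]; apply/andP; split; lra.
    have := dv _ _ _ 2%N h2; rewrite -/T.
    by have -> : 2 * cdilog R / T / T ^+ 2 = 2 * cdilog R / T ^+ 3 by field; rewrite gt_eqF.
  + rewrite msum_ksum //; under [X in ksum _ _ _ _ _ X / _]eq_fun do under eq_fun do rewrite !expr1.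
    have h := ksum_cov hN2 halpha hbeta hab tau01 s1 hJ.
    have h2 : `|ksum N alpha beta tau J (fun e x => e * (x * fvar (x - e * tau))) - 0| <= K / tau.
      have e1 : (N%:R * tau)^-1 <= tau^-1 by rewrite invfM ler_piMl // invr_ge0 ltW.
      have e0 : 0 < (N%:R * tau)^-1 by rewrite invfM mulr_gt0 // invr_gt0.
      have e2 : C5 <= C5 / tau by rewrite ler_pdivlMr // ler_piMr.
      have e3 : (C5 + 1) / tau <= K / tau by apply: ler_wpM2r; [rewrite invr_ge0 ltW | clear - KC5 hN2 halpha hbeta hab; lra].
      rewrite subr0; move: h e3; clear - e0 e1 e2 hC5 C50 hN2 halpha hbeta hab; rewrite mulrDl mul1r; set A := ksum _ _ _ _ _ _; rewrite !ler_norml => /andP[? ?] ?; apply/andP; split; lra.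
    have := dv _ _ _ 1%N h2; rewrite -/T mul0r subr0 expr1.
    by have -> : K / tau / T = K / (tau * T) by field; rewrite !gt_eqF.
  + rewrite msum_ksum //; under [X in ksum _ _ _ _ _ X / _]eq_fun do under eq_fun do rewrite expr0 mul1r.
    rewrite expr0 divr1; have := ksum_var_diff hN2 halpha hbeta hab tau01 s1 hJ.
    by move=> h; apply: (le_trans h); clear - KC5 KC6 hC5 hC6 C50 C60 K0 invN invN2 s1 t0 t1 T0 hN2 halpha hbeta hab; lra.
- split.
  + by apply: (le_trans (msum_skew_abs _ _ _ _)); exact: absn.
  + rewrite msum_ksum //; under [X in ksum _ _ _ _ _ X / _]eq_fun do under eq_fun do rewrite !expr1.
    have h := ksum_skew21 hN2 halpha hbeta hab tau01 s1 hJ.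
    have h2 : `|ksum N alpha beta tau J (fun e x => e * (x ^+ 2 * fskew (x - e * tau))) - 0| <= K / tau.
      have e1 : (N%:R * tau)^-1 <= tau^-1 by rewrite invfM ler_piMl // invr_ge0 ltW.
      have e0 : 0 < (N%:R * tau)^-1 by rewrite invfM mulr_gt0 // invr_gt0.
      have e2 : C5 <= C5 / tau by rewrite ler_pdivlMr // ler_piMr.
      have e3 : (C5 + 2) / tau <= K / tau by apply: ler_wpM2r; [rewrite invr_ge0 ltW | clear - KC5 hN2 halpha hbeta hab; lra].
      rewrite subr0; move: h e3; clear - e0 e1 e2 hC5 C50 hN2 halpha hbeta hab; rewrite mulrDl; set A := ksum _ _ _ _ _ _; rewrite !ler_norml => /andP[? ?] ?; apply/andP; split; lra.
    have := dv _ _ _ 2%N h2; rewrite -/T mul0r subr0.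
    by have -> : K / tau / T ^+ 2 = K / (tau * T ^+ 2) by field; rewrite !gt_eqF.
  + by apply: (le_trans (msum_skew_abs _ _ _ _)); exact: absn.
  + rewrite msum_ksum //; under [X in ksum _ _ _ _ _ X / _]eq_fun do under eq_fun do rewrite expr0 mul1r.
    rewrite expr0 divr1; have := ksum_skew03 hN2 halpha hbeta hab tau01 s1 hJ.
    by move=> h; apply: (le_trans h); clear - KC5 KC6 hC5 hC6 C50 C60 K0 invN invN2 s1 t0 t1 T0 hN2 halpha hbeta hab; lra.
- by split; [exact: (absn 0%N) | exact: (absn 4%N) | exact: (absn 6%N)].
- rewrite msum_ksum //; under [X in ksum _ _ _ _ _ X / _]eq_fun do under eq_fun do rewrite !expr0 !mul1r.
  rewrite expr0 divr1; have := ksum_logZ hN2 halpha hbeta hab tau01 s1 hJ.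
  by move=> h; apply: (le_trans h); apply: ler_wpM2r; [exact: ltW | clear - KC5 KC6 hC5 hC6 C50 C60 K0 invN invN2 s1 t0 t1 T0 hN2 halpha hbeta hab; lra].
Qed.
End Moments.

(** * The characteristic function of one Bernoulli variable *)

Section Bernoulli.
Variable R : realType.
Local Open Scope complex_scope.
Local Notation Re := complex.Re.
Local Notation Im := complex.Im.
Implicit Types (p psi v : R).

Definition bern p psi : R[i] := (1 - p)%:C + p%:C * expi psi.

(** The squared modulus equals 1 - 2z, with z the exponent in the bound, and 1 - 2z <= e^{-2z}. *)
Lemma bern_abs p psi : 0 <= p <= 1 -> cabs (bern p psi) <= expR (- (p * (1 - p) * (1 - cos psi))).
Proof.
move=> /andP[p0 p1]; rewrite -[leLHS]ger0_norm ?cabs_ge0 // -sqrtr_sqr cabs_sqr.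
rewrite /bern expiE /=; set c := cos psi; have cs := cos2Dsin2 psi; rewrite -/c in cs.
have -> : (1 - p + (p * c - 0 * sin psi)) ^+ 2 + (0 + (p * sin psi + 0 * c)) ^+ 2 = 1 - 2 * (p * (1 - p) * (1 - c)).
  by have -> : (0 + (p * sin psi + 0 * c)) ^+ 2 = p ^+ 2 * (1 - c ^+ 2) by [rewrite -cs; ring]; ring.
set z := p * (1 - p) * (1 - c).
rewrite -[leRHS]ger0_norm ?expR_ge0 // -sqrtr_sqr; apply: ler_wsqrtr.
rewrite expr2 -expRD; have := expR_ge1Dx (- z - z); lra.
Qed.

(** After centring, the factor is a convex combination of e^{-ip psi} and e^{i(1-p) psi}, whose
    linear terms cancel. The remainders combine to p (1 - p) times p^3 + (1 - p)^3 <= 1. *)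
Lemma bern_taylor p psi v : 0 <= p <= 1 -> v = p * (1 - p) ->
  cabs (expi (- p * psi) * bern p psi - ((1 - v * psi ^+ 2 / 2) +i* (- (v * (1 - 2 * p) * psi ^+ 3 / 6)))) <= v * psi ^+ 4 / 12.
Proof.
move=> /andP[p0 p1] vE.
have h1 := expi_taylor4 (- p * psi); have h2 := expi_taylor4 ((1 - p) * psi).
set A := _ - _ in h1; set B := _ - _ in h2.
have -> : expi (- p * psi) * bern p psi - ((1 - v * psi ^+ 2 / 2) +i* (- (v * (1 - 2 * p) * psi ^+ 3 / 6)))
  = (1 - p)%:C * A + p%:C * B.
  have -> : expi (- p * psi) * bern p psi = (1 - p)%:C * expi (- p * psi) + p%:C * expi ((1 - p) * psi).
    rewrite /bern mulrDr mulrCA -expiD mulrC; congr (_ + _ * expi _); ring.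
  rewrite /A /B !expiE vE; apply/eqP; rewrite eq_complex /=; apply/andP; split; apply/eqP; by field.
apply: (le_trans (cabsD _ _)); rewrite !cabsM !cabs_real !ger0_norm //; last lra.
have q1 := ler_wpM2l (_ : 0 <= 1 - p) h1; have q2 := ler_wpM2l p0 h2.
have p1' : 0 <= 1 - p by lra.
have s4 : 0 <= psi ^+ 4 by rewrite (_ : psi ^+ 4 = (psi ^+ 2) ^+ 2); [exact: sqr_ge0 | ring].
apply: (le_trans (lerD (q1 p1') q2)).
have -> : (1 - p) * ((- p * psi) ^+ 4 / 12) + p * (((1 - p) * psi) ^+ 4 / 12) =
  v * psi ^+ 4 / 12 * (p ^+ 3 + (1 - p) ^+ 3) by rewrite vE; field.
rewrite ler_piMr //; last by nra.
by rewrite divr_ge0 // mulr_ge0 // vE mulr_ge0.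
Qed.

(* The cumulant expansion to third order, without the mean. *)
Definition gfac p psi : R[i] :=
  (- (p * (1 - p) * psi ^+ 2 / 2)) +i* (- (p * (1 - p) * (1 - 2 * p) * psi ^+ 3 / 6)).

(** Both sides are close to 1 + [gfac p psi]. Keeping the factor p (1 - p) in the error is
    essential: summed over all parts it becomes [msum] of [fvar], which converges. *)
Lemma bern_gauss p psi : 0 <= p <= 1 ->
  cabs (expi (- p * psi) * bern p psi - cexp (gfac p psi)) <= p * (1 - p) * (psi ^+ 4 + psi ^+ 6).
Proof.
move=> p01; have /andP[p0 p1] := p01; have h1 := bern_taylor psi p01 (erefl _).
have v0 : 0 <= p * (1 - p) by rewrite mulr_ge0 //; lra.
have v1 : p * (1 - p) <= 1 / 4 by have := sqr_ge0 (p - 1 / 2); nra.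
have h2 := cexp_taylor2 (gfac p psi).
have s2 : 0 <= psi ^+ 2 by exact: sqr_ge0.
have s4 : 0 <= psi ^+ 4 by rewrite (_ : psi ^+ 4 = (psi ^+ 2) ^+ 2); [exact: sqr_ge0 | ring].
have s6 : 0 <= psi ^+ 6 by rewrite (_ : psi ^+ 6 = (psi ^+ 3) ^+ 2); [exact: sqr_ge0 | ring].
set v := p * (1 - p) in h1 v0 v1 *.
move: h2; rewrite max_l; last by rewrite /= -/v; nra.
rewrite expR0 mulr1 cabs_sqr /= -/v => h2.
set X := expi _ * _ in h1 *; set w := gfac p psi in h2 *.
have -> : X - cexp w = (X - ((1 - v * psi ^+ 2 / 2) +i* (- (v * (1 - 2 * p) * psi ^+ 3 / 6)))) - (cexp w - 1 - w).
  have -> : (1 - v * psi ^+ 2 / 2) +i* (- (v * (1 - 2 * p) * psi ^+ 3 / 6)) = 1 + w.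
    by rewrite /w /gfac -/v; apply/eqP; rewrite eq_complex /= add0r !eqxx.
  by ring.
apply: (le_trans (cabsB _ _)); apply: (le_trans (lerD h1 h2)).
have e1 : (- (v * psi ^+ 2 / 2)) ^+ 2 = v * v * psi ^+ 4 / 4 by field.
have e2 : (- (v * (1 - 2 * p) * psi ^+ 3 / 6)) ^+ 2 = v * v * (1 - 2 * p) ^+ 2 * psi ^+ 6 / 36 by field.
rewrite e1 e2.
have q : (1 - 2 * p) ^+ 2 <= 1 by nra.
have vv : v * v <= v / 4 by nra.
have vv0 : 0 <= v * v by rewrite mulr_ge0.
have a1 : v * v * psi ^+ 4 <= v / 4 * psi ^+ 4 by apply: ler_wpM2r.
have a2 : v * v * (1 - 2 * p) ^+ 2 * psi ^+ 6 <= v / 4 * psi ^+ 6.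
  apply: ler_wpM2r => //; apply: le_trans vv; rewrite -[leRHS]mulr1; exact: ler_wpM2l.
have := mulr_ge0 v0 s4; have := mulr_ge0 v0 s6; rewrite mulrDr; lra.
Qed.
End Bernoulli.

(** * The integrand near the origin *)

Section Center.
Variable R : realType.
Variables N alpha beta : nat.
Hypotheses (hN2 : (2 <= N)%N) (halpha : (1 <= alpha <= N)%N) (hbeta : (1 <= beta <= N)%N).
Hypothesis (hab : alpha <> beta).
Local Notation eps := (@eps R N alpha beta).
Local Notation mu0 := (@mu0 R N alpha beta).
Local Notation msum := (@msum R N alpha beta).
Local Open Scope complex_scope.
Local Notation Re := complex.Re.
Local Notation Im := complex.Im.

Definition prob (tau : R) (k : nat) : R := ferm (k%:R * tau ^+ 2 - eps k * tau).
Definition psi (phi theta : R) (k : nat) : R := k%:R * phi + eps k * theta.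
(* The characteristic function of the pair (sum of the parts, [pd]). *)
Definition charprod tau J phi theta : R[i] :=
  \prod_(k < N * J) bern (prob tau k.+1) (psi phi theta k.+1).

Lemma prob01 tau k : 0 <= prob tau k <= 1.
Proof. by rewrite (ltW (ferm_gt0 _)) (ltW (ferm_lt1 _)). Qed.

Lemma fvar_prob tau k : prob tau k * (1 - prob tau k) = fvar (k%:R * tau ^+ 2 - eps k * tau).
Proof. by []. Qed.

Lemma sum_shift_le (F : nat -> R) m J : (forall j, 0 <= F j) -> (m < J)%N ->
  \sum_(j < m) F j.+1 <= \sum_(j < J) F j.
Proof.
move=> F0 mJ; have -> : J = (m.+1 + (J - m.+1))%N by rewrite subnKC.
elim: (J - m.+1)%N => [|r IH]; first by rewrite addn0 big_ord_recl lerDr.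
by rewrite addnS big_ord_recr /= (le_trans IH) // lerDl.
Qed.

Lemma eps_alpha j : eps (alpha + N * j) = 1.
Proof.
rewrite eps_class /eps eqxx.
have -> : (alpha == beta %[mod N]) = false.
  have aN : (alpha.-1 < N)%N by lia.
  have := residue_eq aN hbeta; rewrite prednK; last by lia.
  by move=> ->; apply/eqP; lia.
by rewrite subr0.
Qed.

Lemma eps_beta j : eps (beta + N * j) = -1.
Proof.
rewrite eps_class /eps eqxx.
have -> : (beta == alpha %[mod N]) = false.
  have bN : (beta.-1 < N)%N by lia.
  have := residue_eq bN halpha; rewrite prednK; last by lia.
  by move=> ->; apply/eqP; lia.
by rewrite sub0r.
Qed.

(** The smallest part of each class is skipped (hence m < J), so that the parts kept are at least N
    (j + 1), as [two_class_form] requires. *)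
Lemma two_class_sum (F : nat -> R) J m : (forall k, 0 <= F k) -> (m < J)%N ->
  \sum_(j < m) (F (alpha + N * j.+1)%N + F (beta + N * j.+1)%N) <= \sum_(k < N * J) F k.+1.
Proof.
move=> F0 mJ; rewrite sum_by_class.
have aN : (alpha.-1 < N)%N by lia.
have bN : (beta.-1 < N)%N by lia.
have ab : Ordinal bN != Ordinal aN by apply/eqP => /(congr1 val) /=; lia.
rewrite (bigD1 (Ordinal aN)) // (bigD1 (Ordinal bN)) //= !prednK; try lia.
rewrite big_split /= addrA -[leLHS]addr0.
apply: lerD; last by apply: sumr_ge0 => g _; apply: sumr_ge0.
by apply: lerD; apply: (sum_shift_le (F := fun j => F (_ + N * j)%N)).
Qed.

(** A lower bound for the decay exponent of [bern_abs] in the central region: [cos_gap] applies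
    where k tau^2 <= 1, and 0 is the trivial bound elsewhere. *)
Definition wgt tau phi theta k : R :=
  if k%:R * tau ^+ 2 <= 1 then fvar (k%:R * tau ^+ 2 - eps k * tau) * psi phi theta k ^+ 2 / 4 else 0.

Lemma wgt_ge0 tau phi theta k : 0 <= wgt tau phi theta k.
Proof.
rewrite /wgt; case: ifP => // _; rewrite divr_ge0 // mulr_ge0 ?sqr_ge0 //.
exact/ltW/fvar_gt0.
Qed.

Lemma fvar_low tau k : 0 < tau <= 1 -> k%:R * tau ^+ 2 <= 1 ->
  expR (- 2) / 4 <= fvar (k%:R * tau ^+ 2 - eps k * tau).
Proof.
move=> /andP[t0 t1] k1; apply: le_trans (fvar_lower _).
rewrite ler_pM2r // ler_expR lerN2 (le_trans (ler_normB _ _)) //.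
have k0 : 0 <= k%:R * tau ^+ 2 by rewrite mulr_ge0 // sqr_ge0.
rewrite (ger0_norm k0) normrM (ger0_norm (ltW t0)).
have := eps_abs R N alpha beta k; have := normr_ge0 (eps k); nra.
Qed.

Lemma sum_squares m : m%:R ^+ 3 / 3 <= \sum_(j < m) j.+1%:R ^+ 2 :> R.
Proof.
elim: m => [|m IH]; first by rewrite big_ord0 expr0n /= mul0r.
rewrite big_ord_recr /=; apply: le_trans (lerD IH (lexx _)).
rewrite -natr1; have := ler0n R m; nra.
Qed.

(** Subtracting the square of (A - B) p + q from the right side leaves q^2 plus p^2 times A^2 + B^2
    - (A - B)^2, and this coefficient is at least 2 (n j)^2 - n^2 >= (n j)^2. *)
Lemma two_class_form (n A B j p q : R) : 0 <= n -> 1 <= j -> n * j <= A -> n * j <= B ->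
  `|A - B| <= n -> n ^+ 2 * j ^+ 2 * p ^+ 2 + q ^+ 2 <= (A * p + q) ^+ 2 + (B * p - q) ^+ 2.
Proof.
move=> n0 j1 hA hB hAB; have nj0 : 0 <= n * j by nra.
have AA : (n * j) ^+ 2 <= A ^+ 2 by nra.
have BB : (n * j) ^+ 2 <= B ^+ 2 by nra.
have j2 : 1 <= j ^+ 2 by nra.
have NN : n ^+ 2 <= (n * j) ^+ 2 by rewrite exprMn; have := ler_wpM2l (sqr_ge0 n) j2; rewrite mulr1.
have DD : (A - B) ^+ 2 <= n ^+ 2 by rewrite -real_normK ?num_real // lerXn2r ?nnegrE.
have p0 := sqr_ge0 p; have := sqr_ge0 ((A - B) * p + q).
have := ler_wpM2r p0 DD; have := ler_wpM2r p0 AA; have := ler_wpM2r p0 BB; have := ler_wpM2r p0 NN.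
lra.
Qed.

(** About 1 / s pairs of parts contribute. The sum of their squares is of order tau^{-6} and their
    number of order tau^{-2}, which matches the scales phi = tau^3 x and theta = tau y. *)
Lemma wgt_lower : exists2 c1 : R, 0 < c1 & forall tau J, admissible N tau J ->
  N%:R * tau ^+ 2 <= 1 / 4 -> 1 <= N%:R * tau ^+ 2 * J%:R -> forall x y,
  c1 * (x ^+ 2 + y ^+ 2) <= \sum_(k < N * J) wgt tau (tau ^+ 3 * x) (tau * y) k.+1.
Proof.
have N2 : 2 <= N%:R :> R by rewrite ler_nat.
set vl : R := expR (- 2) / 4.
have vl0 : 0 < vl by rewrite divr_gt0 ?expR_gt0.
exists (vl / 4 / (24 * N%:R)); first by rewrite !divr_gt0 ?mulr_gt0 //; lra.
move=> tau J [tau01 _ _] s4 sJ x y; have /andP[t0 t1] := tau01.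
set T := tau ^+ 2 in s4 sJ *; have T0 : 0 < T by rewrite exprn_gt0.
set s := N%:R * T in s4 sJ *; have s0 : 0 < s by rewrite mulr_gt0 //; lra.
(* m + 1 is the integer part of 1 / s; one is subtracted for the skipped parts, and s <= 1/4 keeps m
   s >= 1/2. *)
have [m [mJ ms m2]] : exists m : nat, [/\ (m < J)%N, m.+1%:R * s <= 1 & 1 <= 2 * m%:R * s].
  have is0 : 0 <= s^-1 by rewrite invr_ge0 ltW.
  have /andP[M1 M2] := truncn_itv is0; set M := Num.truncn _ in M1 M2.
  have ss : s^-1 * s = 1 by rewrite mulVf // gt_eqF.
  have Ms : M%:R * s <= 1 by have := ler_wpM2r (ltW s0) M1; rewrite ss.
  have Ms2 : 1 < (M%:R + 1) * s by rewrite natr1 -[X in X < _]ss ltr_pM2r.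
  have M0 : (0 < M)%N by rewrite lt0n; apply/eqP => M0; move: Ms2; rewrite M0; lra.
  exists M.-1; rewrite prednK //; split => //.
    by rewrite -(ler_nat R) -(ler_pM2r s0) (le_trans Ms) // mulrC.
  have : M.-1%:R = M%:R - 1 :> R by rewrite -subn1 natrB.
  by move=> ->; nra.
set phi := tau ^+ 3 * x; set theta := tau * y.
apply: le_trans (two_class_sum (wgt_ge0 tau phi theta) mJ).
have key j : (j < m)%N -> vl / 4 * (N%:R ^+ 2 * j.+1%:R ^+ 2 * phi ^+ 2 + theta ^+ 2) <=
    wgt tau phi theta (alpha + N * j.+1) + wgt tau phi theta (beta + N * j.+1).
  move=> jm.
  have bnd c : (1 <= c <= N)%N -> N%:R * j.+1%:R <= (c + N * j.+1)%:R :> R /\ (c + N * j.+1)%:R * T <= 1.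
    move=> /andP[c1 cN]; split; first by rewrite -natrM ler_nat leq_addl.
    apply: le_trans ms; rewrite /s mulrA; apply: ler_wpM2r; first exact: ltW.
    by rewrite -natrM ler_nat; nia.
  have [a1 a2] := bnd _ halpha; have [b1 b2] := bnd _ hbeta.
  rewrite /wgt a2 b2 /psi eps_alpha eps_beta mul1r mulN1r.
  have va := fvar_low tau01 a2; have vb := fvar_low tau01 b2.
  rewrite eps_alpha mul1r in va; rewrite eps_beta mulN1r in vb.
  have dAB : `|(alpha + N * j.+1)%:R - (beta + N * j.+1)%:R| <= N%:R :> R.
    rewrite !natrD opprD addrACA subrr addr0 ler_norml.
    have aN : alpha%:R <= N%:R :> R by rewrite ler_nat; case/andP: halpha.
    have bN : beta%:R <= N%:R :> R by rewrite ler_nat; case/andP: hbeta.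
    by have := ler0n R alpha; have := ler0n R beta; move=> ? ?; apply/andP; split; lra.
  move: va vb dAB a1 b1; rewrite -/vl.
  move: ((alpha + N * j.+1)%:R : R) ((beta + N * j.+1)%:R : R) => A B.
  move: (fvar _) (fvar _) => fb fa va vb dAB a1 b1.
  have n1 : 1 <= j.+1%:R :> R by rewrite ler1n.
  move: (j.+1%:R : R) n1 a1 b1 => jj n1 a1 b1.
  have g1 : vl * (A * phi + theta) ^+ 2 <= fa * (A * phi + theta) ^+ 2 by apply: ler_wpM2r; rewrite ?sqr_ge0.
  have g2 : vl * (B * phi - theta) ^+ 2 <= fb * (B * phi - theta) ^+ 2 by apply: ler_wpM2r; rewrite ?sqr_ge0.
  have N0 : 0 <= N%:R :> R by [].
  have g3 := two_class_form phi theta N0 n1 a1 b1 dAB.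
  have := ler_wpM2l (ltW vl0) g3; lra.
apply: (@le_trans _ _ (\sum_(j < m) vl / 4 * (N%:R ^+ 2 * j.+1%:R ^+ 2 * phi ^+ 2 + theta ^+ 2))); last first.
  by apply: ler_sum => j _; exact: key.
rewrite -mulr_sumr -mulrA; apply: ler_wpM2l; first by rewrite divr_ge0 // ltW.
rewrite big_split /= sumr_const card_ord -mulr_suml -mulr_sumr -[theta ^+ 2 *+ m]mulr_natl.
have S3 := sum_squares m; set S := \sum_(j < m) _ in S3 *.
have m0 : 0 <= m%:R :> R by [].
have m2' : (2 * s)^-1 <= m%:R :> R by rewrite -[leLHS]div1r ler_pdivrMr ?mulr_gt0 //; lra.
have i0 : 0 < (2 * s)^-1 by rewrite invr_gt0 mulr_gt0.
have c3 : (2 * s)^-1 ^+ 3 / 3 <= S.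
  by apply: le_trans S3; rewrite ler_pM2r // lerXn2r // nnegrE ltW.
have q1 : N%:R ^+ 2 * ((2 * s)^-1 ^+ 3 / 3) * phi ^+ 2 <= N%:R ^+ 2 * S * phi ^+ 2.
  by apply: ler_wpM2r; rewrite ?sqr_ge0 // ler_wpM2l // sqr_ge0.
have q2 : (2 * s)^-1 * theta ^+ 2 <= m%:R * theta ^+ 2 by apply: ler_wpM2r; rewrite ?sqr_ge0.
apply: le_trans (lerD q1 q2).
have e1 : N%:R ^+ 2 * ((2 * s)^-1 ^+ 3 / 3) * phi ^+ 2 = x ^+ 2 / (24 * N%:R).
  by rewrite /s /phi /T; field; rewrite !gt_eqF //; lra.
have e2 : (2 * s)^-1 * theta ^+ 2 = y ^+ 2 / (2 * N%:R).
  by rewrite /s /theta /T; field; rewrite !gt_eqF //; lra.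
rewrite e1 e2.
have : y ^+ 2 / (24 * N%:R) <= y ^+ 2 / (2 * N%:R).
  by apply: ler_wpM2l; rewrite ?sqr_ge0 // lef_pV2 ?posrE ?mulr_gt0 //; lra.
by rewrite mulrDr ![_^-1 * _]mulrC; lra.
Qed.

Lemma psi_pow4 phi theta k : psi phi theta k ^+ 4 <= 8 * (k%:R ^+ 4 * phi ^+ 4 + theta ^+ 4).
Proof.
rewrite /psi; set a := k%:R * phi; set b := eps k * theta.
have bt : b ^+ 4 <= theta ^+ 4.
  rewrite exprMn ler_piMl //; first by rewrite (_ : theta ^+ 4 = (theta ^+ 2) ^+ 2); [exact: sqr_ge0 | ring].
  by apply: (le_trans (ler_norm _)); rewrite normrX exprn_ile1 // eps_abs.
have -> : k%:R ^+ 4 * phi ^+ 4 = a ^+ 4 by rewrite exprMn.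
have h : (a + b) ^+ 2 <= 2 * (a ^+ 2 + b ^+ 2) by have := sqr_ge0 (a - b); nra.
have h2 : (a + b) ^+ 4 <= 4 * (a ^+ 2 + b ^+ 2) ^+ 2.
  have -> : (a + b) ^+ 4 = ((a + b) ^+ 2) ^+ 2 by ring.
  have -> : 4 * (a ^+ 2 + b ^+ 2) ^+ 2 = (2 * (a ^+ 2 + b ^+ 2)) ^+ 2 by ring.
  by rewrite lerXn2r // nnegrE ?sqr_ge0 // mulr_ge0 // addr_ge0 ?sqr_ge0.
have := sqr_ge0 (a ^+ 2 - b ^+ 2); nra.
Qed.

Lemma psi_pow6 phi theta k : psi phi theta k ^+ 6 <= 32 * (k%:R ^+ 6 * phi ^+ 6 + theta ^+ 6).
Proof.
rewrite /psi; set a := k%:R * phi; set b := eps k * theta.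
have bt : b ^+ 6 <= theta ^+ 6.
  rewrite exprMn ler_piMl //; first by rewrite (_ : theta ^+ 6 = (theta ^+ 3) ^+ 2); [exact: sqr_ge0 | ring].
  by apply: (le_trans (ler_norm _)); rewrite normrX exprn_ile1 // eps_abs.
have -> : k%:R ^+ 6 * phi ^+ 6 = a ^+ 6 by rewrite exprMn.
have h : (a + b) ^+ 2 <= 2 * (a ^+ 2 + b ^+ 2) by have := sqr_ge0 (a - b); nra.
have h2 : (a + b) ^+ 6 <= (2 * (a ^+ 2 + b ^+ 2)) ^+ 3.
  have -> : (a + b) ^+ 6 = ((a + b) ^+ 2) ^+ 3 by ring.
  by rewrite lerXn2r // nnegrE ?sqr_ge0 // mulr_ge0 // addr_ge0 ?sqr_ge0.
have A0 := sqr_ge0 a; have B0 := sqr_ge0 b.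
have h3 : (a ^+ 2 + b ^+ 2) ^+ 3 <= 4 * (a ^+ 6 + b ^+ 6).
  have -> : a ^+ 6 = (a ^+ 2) ^+ 3 by ring.
  have -> : b ^+ 6 = (b ^+ 2) ^+ 3 by ring.
  move: (a ^+ 2) (b ^+ 2) A0 B0 => A B A0 B0.
  have : 0 <= (A + B) * (A - B) ^+ 2 by rewrite mulr_ge0 ?sqr_ge0 // addr_ge0.
  nra.
move: h2; rewrite exprMn; lra.
Qed.
End Center.

Lemma mul_le_sqrD (R : realType) (x y : R) : x * y <= x ^+ 2 + y ^+ 2.
Proof. by have := sqr_ge0 (x - y); have := sqr_ge0 (x + y); lra. Qed.

(** The left sides collect the sizes of the terms of [odd_corr] and [small_corr] in the rescaled
    variables. *)
Lemma cubic_bounds (R : realType) (x y : R) : 0 <= x -> 0 <= y ->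
  x * y + x + x ^+ 3 / 6 + 3 * (x * y ^+ 2) / 6 <= 4 * (1 + (x ^+ 2 + y ^+ 2)) ^+ 2 /\
  x ^+ 2 / 2 + y ^+ 2 / 2 + y + 3 * (x ^+ 2 * y) / 6 + y ^+ 3 / 6 <= 4 * (1 + (x ^+ 2 + y ^+ 2)) ^+ 2.
Proof.
move=> x0 y0; have x2 := sqr_ge0 x; have y2 := sqr_ge0 y.
have a (z : R) : z <= 1 + z ^+ 2 by have := sqr_ge0 (z - 1); have := sqr_ge0 z; lra.
have a1 := mul_le_sqrD x y.
have a2 : x ^+ 3 <= (1 + x ^+ 2) * x ^+ 2 by rewrite exprS; apply: ler_wpM2r.
have a3 : x * y ^+ 2 <= (1 + x ^+ 2) * y ^+ 2 by apply: ler_wpM2r.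
have a4 : y ^+ 3 <= (1 + y ^+ 2) * y ^+ 2 by rewrite exprS; apply: ler_wpM2r.
have a5 : x ^+ 2 * y <= x ^+ 2 * (1 + y ^+ 2) by apply: ler_wpM2l.
have b1 := a x; have b2 := a y.
have := mulr_ge0 x2 y2; have := sqr_ge0 (x ^+ 2); have := sqr_ge0 (y ^+ 2) => c1 c2 c3.
by split; lra.
Qed.

Section CenterApprox.
Variable R : realType.
Variables N alpha beta : nat.
Hypotheses (hN2 : (2 <= N)%N) (halpha : (1 <= alpha <= N)%N) (hbeta : (1 <= beta <= N)%N).
Hypothesis (hab : alpha <> beta).
Local Notation eps := (@eps R N alpha beta).
Local Notation mu0 := (@mu0 R N alpha beta).
Local Notation msum := (@msum R N alpha beta).
Local Notation prob := (@prob R N alpha beta).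
Local Notation psi := (@psi R N alpha beta).
Local Notation charprod := (@charprod R N alpha beta).
Local Notation wgt := (@wgt R N alpha beta).
Local Open Scope complex_scope.
Local Notation Re := complex.Re.
Local Notation Im := complex.Im.

Lemma ReD (z w : R[i]) : Re (z + w) = Re z + Re w. Proof. by case: z; case: w. Qed.
Lemma ImD (z w : R[i]) : Im (z + w) = Im z + Im w. Proof. by case: z; case: w. Qed.

Definition gauss_exp tau J phi theta : R[i] :=
  \sum_(k < N * J) gfac (prob tau k.+1) (psi phi theta k.+1).

Definition large_enough (tau : R) (J : nat) : Prop :=
  [/\ admissible N tau J, N%:R * tau ^+ 2 <= 1 / 4 & 1 <= N%:R * tau ^+ 2 * J%:R].

Lemma psi_le1 tau phi theta k : 0 < tau -> `|phi| <= tau ^+ 2 / 2 -> `|theta| <= 1 / 2 ->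
  k%:R * tau ^+ 2 <= 1 -> `|psi phi theta k| <= 1.
Proof.
move=> t0 hp ht hk; apply: (le_trans (ler_normD _ _)); rewrite !normrM normr_nat.
have h1 := ler_wpM2l (ler0n R k) hp.
have h2 : `|eps k| * `|theta| <= 1 * (1 / 2) by apply: ler_pM => //; exact: eps_abs.
lra.
Qed.

(** [cabs_prod_diff] with the weights [wgt]. The errors of [bern_gauss] involve the fourth and sixth
    moments; for instance phi^4 = tau^12 x^4 against tau^{-10} leaves tau^2 x^4. *)
Lemma center_telescope : exists c1 K : R, [/\ 0 < c1, 1 <= K & forall tau J, large_enough tau J ->
  forall x y, `|tau ^+ 3 * x| <= tau ^+ 2 / 2 -> `|tau * y| <= 1 / 2 ->
  cabs (\prod_(k < N * J) (expi (- prob tau k.+1 * psi (tau ^+ 3 * x) (tau * y) k.+1) * bern (prob tau k.+1) (psi (tau ^+ 3 * x) (tau * y) k.+1))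
     - cexp (gauss_exp tau J (tau ^+ 3 * x) (tau * y))) <=
  K * tau ^+ 2 * (x ^+ 4 + y ^+ 4 + x ^+ 6 + y ^+ 6) * expR (- (c1 * (x ^+ 2 + y ^+ 2)))].
Proof.
have [c1 c10 hc1] := wgt_lower R hN2 halpha hbeta hab.
have [K K1 hK] := moment_bounds R hN2 halpha hbeta hab.
exists c1, (100 * K); split => //; first lra.
move=> tau J [adm s4 sJ] x y hx hy; have [tau01 _ _] := adm; have /andP[t0 t1] := tau01.
have K0 : 0 <= K by lra.
set phi := tau ^+ 3 * x in hx *; set theta := tau * y in hy *.
rewrite /gauss_exp cexp_sum.
set W := fun k : nat => wgt tau phi theta k.+1.
set A := fun k : nat => expi (- prob tau k.+1 * psi phi theta k.+1) * bern (prob tau k.+1) (psi phi theta k.+1).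
set B := fun k : nat => cexp (gfac (prob tau k.+1) (psi phi theta k.+1)).
have v0 k : 0 <= prob tau k * (1 - prob tau k) by rewrite fvar_prob ltW // fvar_gt0.
have hA k : (k < N * J)%N -> cabs (A k) <= expR (- W k).
  move=> _; rewrite /A cabsM cabs_expi mul1r; apply: (le_trans (bern_abs _ (prob01 _ _ _ _ _))).
  rewrite ler_expR lerN2 /W /wgt; case: ifP => [k1|_]; last first.
    by rewrite mulr_ge0 // subr_ge0 cos_le1.
  rewrite -fvar_prob -mulrA; apply: ler_wpM2l => //; apply: cos_gap.
  exact: psi_le1 hx hy k1.
have hB k : (k < N * J)%N -> cabs (B k) <= expR (- W k).
  move=> _; rewrite /B cabs_cexp ler_expR /W /wgt /=; case: ifP => [k1|_].
    rewrite -fvar_prob; have := mulr_ge0 (v0 k.+1) (sqr_ge0 (psi phi theta k.+1)); lra.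
  by rewrite oppr0 oppr_le0 divr_ge0 // mulr_ge0 // sqr_ge0.
apply: (le_trans (cabs_prod_diff hA hB)).
(* One weight is at most 1, since phases are at most 1 where it is nonzero, so the compensating
   factor is bounded by e. *)
have W1 k : expR (W k) <= 3.
  apply: (le_trans _ (exp1_le3 R)); rewrite ler_expR /W /wgt; case: ifP => // k1.
  have := psi_le1 t0 hx hy k1 => p1.
  have : psi phi theta k.+1 ^+ 2 <= 1 by rewrite -real_normK ?num_real // expr_le1.
  have := fvar_le1 (k.+1%:R * tau ^+ 2 - eps k.+1 * tau); have := fvar_gt0 (k.+1%:R * tau ^+ 2 - eps k.+1 * tau).
  have := sqr_ge0 (psi phi theta k.+1); nra.
have hE : expR (- \sum_(k < N * J) W k) <= expR (- (c1 * (x ^+ 2 + y ^+ 2))).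
  by rewrite ler_expR lerN2; exact: hc1.
rewrite -mulr_suml; set E := expR (- (c1 * _)) in hE *.
have E0 : 0 <= E by exact: expR_ge0.
apply: (@le_trans _ _ ((\sum_(k < N * J) prob tau k.+1 * (1 - prob tau k.+1) * (8 * (k.+1%:R ^+ 4 * phi ^+ 4 + theta ^+ 4) + 32 * (k.+1%:R ^+ 6 * phi ^+ 6 + theta ^+ 6)) * 3) * E)).
  apply: ler_pM => //; first by apply: sumr_ge0 => k _; rewrite mulr_ge0 ?cabs_ge0 ?expR_ge0.
  apply: ler_sum => k _; apply: ler_pM; rewrite ?cabs_ge0 ?expR_ge0 //.
  apply: (le_trans (bern_gauss _ (prob01 _ _ _ _ _))); apply: ler_wpM2l => //.
  by apply: lerD; [exact: psi_pow4 | exact: psi_pow6].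
apply: ler_wpM2r => //.
have [_ _ [h0 h4 h6] _] := hK tau J adm.
have -> : \sum_(k < N * J) prob tau k.+1 * (1 - prob tau k.+1) * (8 * (k.+1%:R ^+ 4 * phi ^+ 4 + theta ^+ 4) + 32 * (k.+1%:R ^+ 6 * phi ^+ 6 + theta ^+ 6)) * 3 =
  24 * phi ^+ 4 * msum tau J 0 4 (@fvar R) + (24 * theta ^+ 4 + 96 * theta ^+ 6) * msum tau J 0 0 (@fvar R) + 96 * phi ^+ 6 * msum tau J 0 6 (@fvar R).
  rewrite /msum !mulr_sumr -!big_split /=; apply: eq_bigr => k _.
  by rewrite fvar_prob !expr0; ring.
have T0 : 0 < tau ^+ 2 by rewrite exprn_gt0.
have T1 : tau ^+ 2 <= 1 by rewrite expr_le1 // ltW.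
have sq4 (z : R) : 0 <= z ^+ 4 by rewrite (_ : z ^+ 4 = (z ^+ 2) ^+ 2); [exact: sqr_ge0 | ring].
have sq6 (z : R) : 0 <= z ^+ 6 by rewrite (_ : z ^+ 6 = (z ^+ 3) ^+ 2); [exact: sqr_ge0 | ring].
have q1 : 24 * phi ^+ 4 * msum tau J 0 4 (@fvar R) <= 24 * K * tau ^+ 2 * x ^+ 4.
  have -> : 24 * K * tau ^+ 2 * x ^+ 4 = 24 * phi ^+ 4 * (K / (tau ^+ 2) ^+ 5).
    by rewrite /phi; field; rewrite gt_eqF.
  by apply: ler_wpM2l => //; rewrite mulr_ge0.
have q2 : 24 * theta ^+ 4 * msum tau J 0 0 (@fvar R) <= 24 * K * tau ^+ 2 * y ^+ 4.
  have -> : 24 * K * tau ^+ 2 * y ^+ 4 = 24 * theta ^+ 4 * (K / tau ^+ 2).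
    by rewrite /theta; field; rewrite gt_eqF.
  by apply: ler_wpM2l => //; rewrite mulr_ge0.
have KT : K * (tau ^+ 2 * tau ^+ 2) <= K * tau ^+ 2 by apply: ler_wpM2l => //; rewrite ler_piMr // ltW.
have q3 : 96 * theta ^+ 6 * msum tau J 0 0 (@fvar R) <= 96 * (K * tau ^+ 2) * y ^+ 6.
  apply: (@le_trans _ _ (96 * (K * (tau ^+ 2 * tau ^+ 2)) * y ^+ 6)).
    have -> : 96 * (K * (tau ^+ 2 * tau ^+ 2)) * y ^+ 6 = 96 * theta ^+ 6 * (K / tau ^+ 2).
      by rewrite /theta; field; rewrite gt_eqF.
    by apply: ler_wpM2l => //; rewrite mulr_ge0.
  by apply: ler_wpM2r => //; apply: ler_wpM2l.
have q4 : 96 * phi ^+ 6 * msum tau J 0 6 (@fvar R) <= 96 * (K * tau ^+ 2) * x ^+ 6.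
  apply: (@le_trans _ _ (96 * (K * (tau ^+ 2 * tau ^+ 2)) * x ^+ 6)).
    have -> : 96 * (K * (tau ^+ 2 * tau ^+ 2)) * x ^+ 6 = 96 * phi ^+ 6 * (K / (tau ^+ 2) ^+ 7).
      by rewrite /phi; field; rewrite gt_eqF.
    by apply: ler_wpM2l => //; rewrite mulr_ge0.
  by apply: ler_wpM2r => //; apply: ler_wpM2l.
have z (w : R) : 0 <= w -> 0 <= K * tau ^+ 2 * w by move=> w0; rewrite !mulr_ge0 // ltW.
have := z _ (sq4 x); have := z _ (sq4 y); have := z _ (sq6 x); have := z _ (sq6 y).
rewrite mulrDl; lra.
Qed.

Definition energy_gap tau J : R := msum tau J 0 1 (@ferm R) - cdilog R / (tau ^+ 2) ^+ 2.
Definition mean_gap tau J : R := msum tau J 1 0 (@ferm R) - ((N%:R * tau)^-1 + mu0).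

(* [gauss_exp] plus the centring term is the main quadratic form plus [odd_corr],
   which is odd in [phi] and of relative size tau, plus [small_corr], of relative
   size tau^2. *)
Definition odd_corr tau J phi theta : R[i] :=
  (- (phi * theta * msum tau J 1 1 (@fvar R))) +i*
  (phi * energy_gap tau J - (phi ^+ 3 * msum tau J 0 3 (@fskew R) + 3 * phi * theta ^+ 2 * msum tau J 2 1 (@fskew R)) / 6).

Definition small_corr tau J phi theta : R[i] :=
  (- (phi ^+ 2 * (msum tau J 0 2 (@fvar R) - 2 * cdilog R / (tau ^+ 2) ^+ 3) / 2) -
    theta ^+ 2 * (msum tau J 2 0 (@fvar R) - (N%:R * tau ^+ 2)^-1) / 2) +i*
  (theta * mean_gap tau J - (3 * phi ^+ 2 * theta * msum tau J 1 2 (@fskew R) + theta ^+ 3 * msum tau J 3 0 (@fskew R)) / 6).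

(* The quadratic form in the rescaled variables [x = phi / tau ^ 3] and
   [y = theta / tau]; [energy] and [mean] are the leading terms of the means of the
   sum of the parts and of [pd], and [energy tau] will be equal to [n]. *)
Definition quad (x y : R) : R := cdilog R * x ^+ 2 + y ^+ 2 / (2 * N%:R).

Definition energy (tau : R) : R := cdilog R / (tau ^+ 2) ^+ 2.
Definition mean (tau : R) : R := (N%:R * tau)^-1 + mu0.

Let N0 : 0 < N%:R :> R. Proof. by rewrite ltr0n; lia. Qed.

Lemma gauss_exp_split tau J x y (m : R) : 0 < tau ->
  let phi := tau ^+ 3 * x in let theta := tau * y in
  gauss_exp tau J phi theta
    + (0 +i* (\sum_(k < N * J) prob tau k.+1 * psi phi theta k.+1 - (energy tau * phi + m * theta)))
  = (- quad x y) +i* (theta * (mean tau - m)) + (odd_corr tau J phi theta + small_corr tau J phi theta).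
Proof.
move=> t0 phi theta.
have e2 : \sum_(k < N * J) prob tau k.+1 * (1 - prob tau k.+1) * psi phi theta k.+1 ^+ 2 =
  phi ^+ 2 * msum tau J 0 2 (@fvar R) + 2 * phi * theta * msum tau J 1 1 (@fvar R) + theta ^+ 2 * msum tau J 2 0 (@fvar R).
  rewrite /msum !mulr_sumr -!big_split /=; apply: eq_bigr => k _.
  by rewrite fvar_prob /psi !expr0; ring.
have e3 : \sum_(k < N * J) prob tau k.+1 * (1 - prob tau k.+1) * (1 - 2 * prob tau k.+1) * psi phi theta k.+1 ^+ 3 =
  phi ^+ 3 * msum tau J 0 3 (@fskew R) + 3 * phi ^+ 2 * theta * msum tau J 1 2 (@fskew R) + 3 * phi * theta ^+ 2 * msum tau J 2 1 (@fskew R) + theta ^+ 3 * msum tau J 3 0 (@fskew R).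
  rewrite /msum !mulr_sumr -!big_split /=; apply: eq_bigr => k _.
  by rewrite -/(@fskew R _) /psi !expr0 !expr1 /fskew -fvar_prob; ring.
have e1 : \sum_(k < N * J) prob tau k.+1 * psi phi theta k.+1 =
  phi * msum tau J 0 1 (@ferm R) + theta * msum tau J 1 0 (@ferm R).
  rewrite /msum !mulr_sumr -!big_split /=; apply: eq_bigr => k _.
  by rewrite /prob /psi !expr0 !expr1; ring.
rewrite e1; apply/eqP; rewrite eq_complex /gauss_exp; apply/andP; split; apply/eqP.
  rewrite ReD Re_sum /= addr0 sumrN -mulr_suml e2.
  by rewrite /quad /phi /theta; field; rewrite !gt_eqF.
rewrite ImD Im_sum /= sumrN -mulr_suml e3.
by rewrite /energy_gap /mean_gap /mean /energy; field; rewrite !gt_eqF.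
Qed.

Lemma charprod_split tau J phi theta :
  charprod tau J phi theta = expi (\sum_(k < N * J) prob tau k.+1 * psi phi theta k.+1) *
    \prod_(k < N * J) (expi (- prob tau k.+1 * psi phi theta k.+1) * bern (prob tau k.+1) (psi phi theta k.+1)).
Proof.
rewrite /charprod; have -> : expi (\sum_(k < N * J) prob tau k.+1 * psi phi theta k.+1) = \prod_(k < N * J) expi (prob tau k.+1 * psi phi theta k.+1).
  apply: (big_morph (@expi R)); first exact: expiD.
  by rewrite expiE cos0 sin0.
rewrite -big_split /=; apply: eq_bigr => k _.
by rewrite mulrA -expiD mulNr subrr expiE cos0 sin0 mul1r.
Qed.

(** Half of the exponent pays for the polynomial, by [exprn_le_expR] at a (1 + r) / 2. *)
Lemma pow_gauss (a : R) (n : nat) : 0 < a -> exists2 C : R, 0 < C & forall r, 0 <= r ->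
  (1 + r) ^+ n * expR (- (a * r)) <= C * expR (- (a / 2 * r)).
Proof.
move=> a0; exists (n`!%:R * (2 / a) ^+ n * expR (a / 2)).
  by rewrite !mulr_gt0 ?expR_gt0 ?exprn_gt0 ?divr_gt0 // ltr0n fact_gt0.
move=> r r0; have := @exprn_le_expR R n (a / 2 * (1 + r)).
rewrite mulr_ge0 //; [|by rewrite divr_ge0 // ltW|by rewrite addr_ge0] => /(_ isT) h.
have -> : (1 + r) ^+ n = (2 / a) ^+ n * (a / 2 * (1 + r)) ^+ n.
  by rewrite -exprMn; congr (_ ^+ _); field; rewrite gt_eqF.
have p0 : 0 <= (2 / a) ^+ n by rewrite exprn_ge0 // divr_ge0 // ltW.
apply: (@le_trans _ _ ((2 / a) ^+ n * (n`!%:R * expR (a / 2 * (1 + r))) * expR (- (a * r)))).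
  by apply: ler_wpM2r; rewrite ?expR_ge0 //; apply: ler_wpM2l.
have -> : expR (a / 2 * (1 + r)) = expR (a / 2) * (expR (a * r) * expR (- (a / 2 * r))).
  by rewrite -!expRD; congr expR; field.
rewrite [expR (- (a * r))]expRN; have e0 := expR_gt0 (a * r).
by rewrite le_eqVlt; apply/orP; left; apply/eqP; field; rewrite gt_eqF.
Qed.

(** The third bound is of a different kind: a multiple of x^2 + y^2 without constant term, so that
    for small tau the quadratic form absorbs it in the exponent. *)
Lemma corr_bounds : exists2 K : R, 1 <= K & forall tau J, admissible N tau J -> forall x y,
  let phi := tau ^+ 3 * x in let theta := tau * y in let r := 1 + (x ^+ 2 + y ^+ 2) in
  [/\ cabs (odd_corr tau J phi theta) <= K * tau * r ^+ 2,
      cabs (small_corr tau J phi theta) <= K * tau ^+ 2 * r ^+ 2 &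
      Re (odd_corr tau J phi theta + small_corr tau J phi theta) <= K * tau * (x ^+ 2 + y ^+ 2)].
Proof.
have [K K1 hK] := moment_bounds R hN2 halpha hbeta hab.
exists (4 * K); first lra.
move=> tau J adm x y phi theta r; have [/andP[t0 t1] _ _] := adm.
have K0 : 0 <= K by lra.
have [[b1 b2 b3 b4 b5] [c1 c2 c3 c4] _ _] := hK tau J adm.
have T0 : 0 < tau ^+ 2 by rewrite exprn_gt0.
have x0 := normr_ge0 x; have y0 := normr_ge0 y.
have phiE n : `|phi ^+ n| = tau ^+ (3 * n) * `|x| ^+ n.
  by rewrite normrX normrM exprMn normrX (ger0_norm (ltW t0)) -exprM.
have thetaE n : `|theta ^+ n| = tau ^+ n * `|y| ^+ n.
  by rewrite normrX normrM exprMn (ger0_norm (ltW t0)).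
have phi1 : `|phi| = tau ^+ 3 * `|x| by have := phiE 1%N; rewrite !expr1.
have theta1 : `|theta| = tau * `|y| by have := thetaE 1%N; rewrite !expr1.
have mul (A B X Y : R) : `|A| = X -> `|B| <= Y -> `|A * B| <= X * Y.
  by move=> <- h; rewrite normrM; apply: ler_wpM2l.
have tn n : 0 <= tau ^+ n by rewrite exprn_ge0 // ltW.
have h1 : `|phi * theta * msum tau J 1 1 (@fvar R)| <= K * tau * (`|x| * `|y|).
  have -> : K * tau * (`|x| * `|y|) = (tau ^+ 3 * `|x|) * (tau * `|y|) * (K / (tau * tau ^+ 2)) by field; rewrite gt_eqF.
  by apply: mul => //; rewrite normrM phi1 theta1.
have h2 : `|phi * energy_gap tau J| <= K * tau * `|x|.
  have -> : K * tau * `|x| = (tau ^+ 3 * `|x|) * (K / tau ^+ 2) by field; rewrite gt_eqF.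
  exact: mul.
have h3 : `|phi ^+ 3 * msum tau J 0 3 (@fskew R)| <= K * tau * `|x| ^+ 3.
  have -> : K * tau * `|x| ^+ 3 = (tau ^+ (3 * 3) * `|x| ^+ 3) * (K / (tau ^+ 2) ^+ 4) by field; rewrite gt_eqF.
  exact: mul.
have h4 : `|phi * theta ^+ 2 * msum tau J 2 1 (@fskew R)| <= K * tau * (`|x| * `|y| ^+ 2).
  have -> : K * tau * (`|x| * `|y| ^+ 2) = (tau ^+ 3 * `|x|) * (tau ^+ 2 * `|y| ^+ 2) * (K / (tau ^+ 2) ^+ 2) by field; rewrite gt_eqF.
  by apply: mul => //; rewrite normrM phi1 thetaE.
have h5 : `|phi ^+ 2 * (msum tau J 0 2 (@fvar R) - 2 * cdilog R / (tau ^+ 2) ^+ 3)| <= K * tau ^+ 2 * `|x| ^+ 2.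
  have -> : K * tau ^+ 2 * `|x| ^+ 2 = (tau ^+ (3 * 2) * `|x| ^+ 2) * (K / (tau ^+ 2) ^+ 2) by field; rewrite gt_eqF.
  exact: mul.
have h6 : `|theta ^+ 2 * (msum tau J 2 0 (@fvar R) - (N%:R * tau ^+ 2)^-1)| <= K * tau ^+ 2 * `|y| ^+ 2.
  have -> : K * tau ^+ 2 * `|y| ^+ 2 = (tau ^+ 2 * `|y| ^+ 2) * K by ring.
  exact: mul.
have h7 : `|theta * mean_gap tau J| <= K * tau ^+ 2 * `|y|.
  have -> : K * tau ^+ 2 * `|y| = (tau * `|y|) * (K * tau) by ring.
  exact: mul.
have h8 : `|phi ^+ 2 * theta * msum tau J 1 2 (@fskew R)| <= K * tau ^+ 2 * (`|x| ^+ 2 * `|y|).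
  have -> : K * tau ^+ 2 * (`|x| ^+ 2 * `|y|) = (tau ^+ (3 * 2) * `|x| ^+ 2) * (tau * `|y|) * (K / (tau * (tau ^+ 2) ^+ 2)) by field; rewrite gt_eqF.
  by apply: mul => //; rewrite normrM theta1 phiE.
have h9 : `|theta ^+ 3 * msum tau J 3 0 (@fskew R)| <= K * tau ^+ 2 * `|y| ^+ 3.
  have -> : K * tau ^+ 2 * `|y| ^+ 3 = K * (tau ^+ 2 * `|y| ^+ 3) by ring.
  apply: (@le_trans _ _ ((tau ^+ 3 * `|y| ^+ 3) * K)); first exact: mul.
  rewrite mulrC; apply: ler_wpM2l => //; apply: ler_wpM2r; first by rewrite exprn_ge0.
  by rewrite exprS ler_piMl.
have rE : r = 1 + (`|x| ^+ 2 + `|y| ^+ 2) by rewrite !real_normK ?num_real.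
have xyE : x ^+ 2 + y ^+ 2 = `|x| ^+ 2 + `|y| ^+ 2 by rewrite !real_normK ?num_real.
rewrite rE xyE; move: (`|x|) (`|y|) x0 y0 h1 h2 h3 h4 h5 h6 h7 h8 h9 {phiE thetaE phi1 theta1 rE xyE b1 b2 b3 b4 b5 c1 c2 c3 c4 adm T0} => X Y x0 y0 h1 h2 h3 h4 h5 h6 h7 h8 h9.
have Kt : 0 <= K * tau by rewrite mulr_ge0 // ltW.
have Kt2 : 0 <= K * tau ^+ 2 by rewrite mulr_ge0.
have KtL : K * tau ^+ 2 <= K * tau by apply: ler_wpM2l => //; rewrite expr2 ler_piMl // ltW.
have X2 := sqr_ge0 X; have Y2 := sqr_ge0 Y.
have [p1 p2] := cubic_bounds x0 y0.
split.
- clear h5 h6 h7 h8 h9 p2 Kt2 KtL; apply: (le_trans (cabs_le_ReIm _)); rewrite /= normrN.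
  apply: (@le_trans _ _ (K * tau * (X * Y + X + X ^+ 3 / 6 + 3 * (X * Y ^+ 2) / 6))); last first.
    rewrite (_ : 4 * K * _ * _ = K * tau * (4 * (1 + (X ^+ 2 + Y ^+ 2)) ^+ 2)); last by ring.
    exact: ler_wpM2l.
  set A := phi * theta * _ in h1 *; set B := phi * _ in h2 *; set D := phi ^+ 3 * _ in h3 *.
  have -> : 3 * phi * theta ^+ 2 * msum tau J 2 1 (@fskew R) = 3 * (phi * theta ^+ 2 * msum tau J 2 1 (@fskew R)) by ring.
  set E := phi * theta ^+ 2 * _ in h4 *.
  have := ler_normB B ((D + 3 * E) / 6); have : `|(D + 3 * E) / 6| <= (`|D| + 3 * `|E|) / 6.
    rewrite [leLHS]normrM (@ger0_norm _ 6^-1) //; apply: ler_wpM2r => //.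
    by apply: (le_trans (ler_normD _ _)); rewrite [ `|3 * _|]normrM (@ger0_norm _ 3).
  lra.
- clear h1 h2 h3 h4 p1 Kt KtL; apply: (le_trans (cabs_le_ReIm _)); rewrite /=.
  apply: (@le_trans _ _ (K * tau ^+ 2 * (X ^+ 2 / 2 + Y ^+ 2 / 2 + Y + 3 * (X ^+ 2 * Y) / 6 + Y ^+ 3 / 6))); last first.
    rewrite (_ : 4 * K * _ * _ = K * tau ^+ 2 * (4 * (1 + (X ^+ 2 + Y ^+ 2)) ^+ 2)); last by ring.
    exact: ler_wpM2l.
  set A := phi ^+ 2 * _ in h5 *; set B := theta ^+ 2 * _ in h6 *; set D := theta * mean_gap _ _ in h7 *.
  have -> : 3 * phi ^+ 2 * theta * msum tau J 1 2 (@fskew R) = 3 * (phi ^+ 2 * theta * msum tau J 1 2 (@fskew R)) by ring.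
  set E := phi ^+ 2 * theta * _ in h8 *; set G := theta ^+ 3 * _ in h9 *.
  have := ler_normB D ((3 * E + G) / 6); have : `|(3 * E + G) / 6| <= (3 * `|E| + `|G|) / 6.
    rewrite [leLHS]normrM (@ger0_norm _ 6^-1) //; apply: ler_wpM2r => //.
    by apply: (le_trans (ler_normD _ _)); rewrite [ `|3 * _|]normrM (@ger0_norm _ 3).
  have : `|- (A / 2) - B / 2| <= `|A| / 2 + `|B| / 2.
    by apply: (le_trans (ler_normB _ _)); rewrite normrN [ `|A / 2|]normrM [ `|B / 2|]normrM (@ger0_norm _ 2^-1).
  lra.
- clear h2 h3 h4 h7 h8 h9 p1 p2 Kt2; rewrite ReD /=.
  have l1 := ler_norm (- (phi * theta * msum tau J 1 1 (@fvar R))); rewrite normrN in l1.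
  have l2 := ler_norm (- (phi ^+ 2 * (msum tau J 0 2 (@fvar R) - 2 * cdilog R / (tau ^+ 2) ^+ 3))); rewrite normrN in l2.
  have l3 := ler_norm (- (theta ^+ 2 * (msum tau J 2 0 (@fvar R) - (N%:R * tau ^+ 2)^-1))); rewrite normrN in l3.
  have a2 := mul_le_sqrD X Y.
  have e1 := ler_wpM2l Kt a2.
  have e2 := ler_wpM2r X2 KtL; have e3 := ler_wpM2r Y2 KtL.
  have := mulr_ge0 Kt X2; have := mulr_ge0 Kt Y2; clear - h1 h5 h6 l1 l2 l3 e1 e2 e3; lra.
Qed.

Lemma odd_corrN tau J phi theta : odd_corr tau J (- phi) theta = - odd_corr tau J phi theta.
Proof. by rewrite /odd_corr; apply/eqP; rewrite eq_complex /=; apply/andP; split; apply/eqP; ring. Qed.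
End CenterApprox.

Section CenterFinal.
Variable R : realType.
Variables N alpha beta : nat.
Hypotheses (hN2 : (2 <= N)%N) (halpha : (1 <= alpha <= N)%N) (hbeta : (1 <= beta <= N)%N).
Hypothesis (hab : alpha <> beta).
Local Notation eps := (@eps R N alpha beta).
Local Notation charprod := (@charprod R N alpha beta).
Local Notation odd_corr := (@odd_corr R N alpha beta).
Local Notation small_corr := (@small_corr R N alpha beta).
Local Notation quad := (@quad R N).
Local Notation mean := (@mean R N alpha beta).
Local Notation energy := (@energy R).
Local Open Scope complex_scope.
Local Notation Re := complex.Re.
Local Notation Im := complex.Im.

Lemma quad_lower : exists2 q : R, 0 < q & forall x y, q * (x ^+ 2 + y ^+ 2) <= quad x y.
Proof.
have N0 : 0 < N%:R :> R by rewrite ltr0n; lia.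
have c0 : 0 < cdilog R by rewrite /cdilog divr_gt0 // exprn_gt0 // pi_gt0.
have n0 : 0 < (2 * N%:R)^-1 :> R by rewrite invr_gt0 mulr_gt0.
exists (Num.min (cdilog R) (2 * N%:R)^-1); first by rewrite lt_min c0.
move=> x y; rewrite /quad mulrDr; apply: lerD.
  by apply: ler_wpM2r; rewrite ?sqr_ge0 // ge_min lexx.
by rewrite [leRHS]mulrC; apply: ler_wpM2r; rewrite ?sqr_ge0 // ge_min lexx orbT.
Qed.

(** [cexp_taylor2] is applied to w = [odd_corr] + [small_corr]. Only 1 + [odd_corr] is kept;
    [small_corr] and the remainder |w|^2 are both of order tau^2. *)
Lemma center_approx : exists c K tau0 : R, [/\ 0 < c, 0 < K, 0 < tau0 & forall tau J,
  large_enough N tau J -> tau <= tau0 -> forall x y m,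
  `|tau ^+ 3 * x| <= tau ^+ 2 / 2 -> `|tau * y| <= 1 / 2 ->
  cabs (charprod tau J (tau ^+ 3 * x) (tau * y) * expi (- (energy tau * (tau ^+ 3 * x) + m * (tau * y)))
    - cexp ((- quad x y) +i* (tau * y * (mean tau - m))) * (1 + odd_corr tau J (tau ^+ 3 * x) (tau * y)))
  <= K * tau ^+ 2 * expR (- (c * (x ^+ 2 + y ^+ 2)))].
Proof.
have [c1 [K1 [c10 K11 hT]]] := center_telescope R hN2 halpha hbeta hab.
have [K2 K21 hK2] := corr_bounds R hN2 halpha hbeta hab.
have [q q0 hq] := quad_lower.
have q20 : 0 < q / 2 by rewrite divr_gt0.
have [C1 C10 hC1] := pow_gauss 3 c10.
have [C2 C20 hC2] := pow_gauss 4 q20.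
have c20 : 0 < c1 / 2 by rewrite divr_gt0.
have q40 : 0 < q / 2 / 2 by rewrite divr_gt0.
have K20 : 0 < K2 by lra.
(* For tau <= q / (2 K2) the real part of the corrections is at most half of [quad], so half of the
   Gaussian survives; [pow_gauss] halves the exponents again. The 12 K2^2 is 3 (2 K2)^2. *)
exists (Num.min (c1 / 2) (q / 2 / 2)), (2 * K1 * C1 + (12 * K2 ^+ 2 + K2) * C2), (q / (2 * K2)).
split.
- by rewrite lt_min c20.
- by apply: addr_gt0; rewrite !mulr_gt0 // ?addr_gt0 ?mulr_gt0 ?exprn_gt0 //; lra.
- by rewrite divr_gt0 // mulr_gt0.
move=> tau J le tauS x y m hx hy; have [adm _ _] := le; have [/andP[t0 t1] _ _] := adm.
have T0 : 0 <= tau ^+ 2 by exact: sqr_ge0.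
have tele := hT tau J le x y hx hy; have [ho s1 r1] := hK2 tau J adm x y.
have split_exp := gauss_exp_split hN2 halpha hbeta hab J x y m t0; cbv zeta in split_exp.
rewrite charprod_split.
set phi := tau ^+ 3 * x in hx tele ho s1 r1 split_exp *; set theta := tau * y in hy tele ho s1 r1 split_exp *.
set PA := \prod_(k < _) _ in tele *; set Th := \sum_(k < _) _ in split_exp *.
set ge := gauss_exp _ _ _ _ _ _ _ in tele split_exp.
set o := odd_corr _ _ _ _ in ho r1 split_exp *; set sm := small_corr _ _ _ _ in s1 r1 split_exp.
set z0 := (- quad x y) +i* _ in split_exp *.
set th2 := energy tau * phi + m * theta in split_exp *.
have -> : expi Th * PA * expi (- th2) = expi (Th - th2) * PA by rewrite expiD; ring.
have e2 : expi (Th - th2) * cexp ge = cexp z0 * cexp (o + sm) by rewrite -[RHS]cexpD -split_exp cexpD mulrC.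
have -> : expi (Th - th2) * PA - cexp z0 * (1 + o) =
  expi (Th - th2) * (PA - cexp ge) + cexp z0 * ((cexp (o + sm) - 1 - (o + sm)) + sm).
  by rewrite mulrBr e2; ring.
apply: (le_trans (cabsD _ _)); rewrite !cabsM cabs_expi mul1r cabs_cexp.
set rho := x ^+ 2 + y ^+ 2 in tele ho s1 r1 *.
have x20 := sqr_ge0 x; have y20 := sqr_ge0 y.
have rho0 : 0 <= rho by rewrite addr_ge0.
rewrite mulrDl mulrDl; apply: lerD.
  apply: (le_trans tele); clear tele ho s1 r1 hx hy split_exp e2.
  have h6 : x ^+ 4 + y ^+ 4 + x ^+ 6 + y ^+ 6 <= 2 * (1 + rho) ^+ 3.
    have -> : x ^+ 4 = (x ^+ 2) ^+ 2 by ring. have -> : y ^+ 4 = (y ^+ 2) ^+ 2 by ring.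
    have -> : x ^+ 6 = (x ^+ 2) ^+ 3 by ring. have -> : y ^+ 6 = (y ^+ 2) ^+ 3 by ring.
    rewrite /rho; move: (x ^+ 2) (y ^+ 2) x20 y20 => X Y X0 Y0.
    have XY := mulr_ge0 X0 Y0; have X2 := sqr_ge0 X; have Y2 := sqr_ge0 Y.
    have X3 : 0 <= X ^+ 3 by rewrite exprn_ge0. have Y3 : 0 <= Y ^+ 3 by rewrite exprn_ge0.
    have := mulr_ge0 X2 Y0; have := mulr_ge0 X0 Y2; lra.
  have := hC1 rho rho0; set E1 := expR _; set E2 := expR _ => hE.
  have E12 : E2 <= expR (- (Num.min (c1 / 2) (q / 2 / 2) * rho)).
    by rewrite ler_expR lerN2; apply: ler_wpM2r => //; rewrite ge_min lexx.
  set E3 := expR _ in E12 *.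
  have KT0 : 0 <= K1 * tau ^+ 2 by rewrite mulr_ge0 //; lra.
  apply: (@le_trans _ _ (K1 * tau ^+ 2 * (2 * (C1 * E3)))); last by rewrite le_eqVlt; apply/orP; left; apply/eqP; ring.
  rewrite -mulrA; apply: ler_wpM2l => //.
  apply: (@le_trans _ _ (2 * ((1 + rho) ^+ 3 * E1))).
    by rewrite mulrA; apply: ler_wpM2r; rewrite ?expR_ge0.
  by apply: ler_wpM2l => //; apply: (le_trans hE); apply: ler_wpM2l => //; exact: ltW.
have Kt : K2 * tau <= q / 2.
  have := ler_wpM2l (ltW K20) tauS.
  by have -> : K2 * (q / (2 * K2)) = q / 2 by field; rewrite gt_eqF.
have hR : Re (o + sm) <= quad x y / 2.
  by apply: (le_trans r1); have := hq x y; have := ler_wpM2r rho0 Kt; rewrite -/rho; lra.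
have Q0 : 0 <= quad x y by apply: le_trans (hq x y); rewrite mulr_ge0 // ltW.
have hmax : expR (Num.max 0 (Re (o + sm))) <= expR (quad x y / 2).
  by rewrite ler_expR ge_max hR andbT divr_ge0.
have r0 : 0 <= (1 + rho) ^+ 2 by exact: sqr_ge0.
have tt : tau ^+ 2 <= tau by rewrite expr2 ler_piMl // ltW.
have w1 : cabs (o + sm) <= 2 * K2 * tau * (1 + rho) ^+ 2.
  apply: (le_trans (cabsD _ _)).
  have : K2 * tau ^+ 2 * (1 + rho) ^+ 2 <= K2 * tau * (1 + rho) ^+ 2.
    by apply: ler_wpM2r => //; apply: ler_wpM2l => //; exact: ltW.
  lra.
have w2 : cabs (o + sm) ^+ 2 <= (2 * K2 * tau * (1 + rho) ^+ 2) ^+ 2.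
  by rewrite lerXn2r // nnegrE ?cabs_ge0 // (le_trans (cabs_ge0 _) w1).
have g1 := cexp_taylor2 (o + sm).
have r24 : (1 + rho) ^+ 2 <= (1 + rho) ^+ 4.
  have -> : (1 + rho) ^+ 4 = (1 + rho) ^+ 2 * (1 + rho) ^+ 2 by ring.
  by rewrite ler_peMr //; nra.
have main : cabs (cexp (o + sm) - 1 - (o + sm) + sm) <= (12 * K2 ^+ 2 + K2) * tau ^+ 2 * (1 + rho) ^+ 4 * expR (quad x y / 2).
  have E1 : 1 <= expR (quad x y / 2) by rewrite -expR0 ler_expR divr_ge0.
  apply: (le_trans (cabsD _ _)).
  have p1 : cabs (cexp (o + sm) - 1 - (o + sm)) <= 3 * (2 * K2 * tau * (1 + rho) ^+ 2) ^+ 2 * expR (quad x y / 2).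
    apply: (le_trans g1); apply: ler_pM => //; rewrite ?expR_ge0 //.
      by rewrite mulr_ge0 // sqr_ge0.
    exact: ler_wpM2l.
  have p2 : cabs sm <= K2 * tau ^+ 2 * (1 + rho) ^+ 4 * expR (quad x y / 2).
    apply: (le_trans s1); rewrite -[leLHS]mulr1; apply: ler_pM => //.
      by rewrite mulr_ge0 // mulr_ge0 // ltW.
    by apply: ler_wpM2l => //; rewrite mulr_ge0 // ltW.
  apply: (le_trans (lerD p1 p2)); rewrite le_eqVlt; apply/orP; left; apply/eqP; ring.
rewrite -/rho /z0 /=.
apply: (le_trans (ler_wpM2l (expR_ge0 _) main)).
clear tele ho s1 r1 hx hy split_exp e2 w1 w2 g1 r24 hmax hR tt Kt main.
have := hC2 rho rho0; set E1 := expR (- (q / 2 * rho)); set E2 := expR (- (q / 2 / 2 * rho)) => hE.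
have E23 : E2 <= expR (- (Num.min (c1 / 2) (q / 2 / 2) * rho)).
  by rewrite ler_expR lerN2; apply: ler_wpM2r => //; rewrite ge_min lexx orbT.
set E3 := expR (- (Num.min _ _ * _)) in E23 *.
have EQ : expR (- quad x y) * expR (quad x y / 2) <= E1.
  rewrite -expRD ler_expR; have := hq x y; rewrite -/rho; lra.
have A0 : 0 <= (12 * K2 ^+ 2 + K2) * tau ^+ 2.
  by apply: mulr_ge0 => //; apply: addr_ge0; [apply: mulr_ge0 => //; exact: sqr_ge0 | exact: ltW].
have r4 : 0 <= (1 + rho) ^+ 4 by rewrite exprn_ge0 // addr_ge0.
apply: (@le_trans _ _ ((12 * K2 ^+ 2 + K2) * tau ^+ 2 * ((1 + rho) ^+ 4 * E1))).
  have -> : expR (- quad x y) * ((12 * K2 ^+ 2 + K2) * tau ^+ 2 * (1 + rho) ^+ 4 * expR (quad x y / 2)) =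
    (12 * K2 ^+ 2 + K2) * tau ^+ 2 * ((1 + rho) ^+ 4 * (expR (- quad x y) * expR (quad x y / 2))) by ring.
  by apply: ler_wpM2l => //; apply: ler_wpM2l.
have -> : (12 * K2 ^+ 2 + K2) * C2 * tau ^+ 2 * E3 = (12 * K2 ^+ 2 + K2) * tau ^+ 2 * (C2 * E3) by ring.
apply: ler_wpM2l => //; apply: (le_trans hE); apply: ler_wpM2l => //; exact: ltW.
Qed.

Definition integrand tau J (m phi theta : R) : R :=
  Re (charprod tau J phi theta * expi (- (energy tau * phi + m * theta))).

Lemma center_symmetrized : exists c K tau0 : R, [/\ 0 < c, 0 < K, 0 < tau0 & forall tau J,
  large_enough N tau J -> tau <= tau0 -> forall x y m,
  `|tau ^+ 3 * x| <= tau ^+ 2 / 2 -> `|tau * y| <= 1 / 2 ->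
  `|integrand tau J m (tau ^+ 3 * x) (tau * y) + integrand tau J m (- (tau ^+ 3 * x)) (tau * y)
    - 2 * (expR (- quad x y) * cos (tau * y * (mean tau - m)))|
  <= K * tau ^+ 2 * expR (- (c * (x ^+ 2 + y ^+ 2)))].
Proof.
have [c [K [tau0 [c0 K0 t00 h]]]] := center_approx.
exists c, (2 * K), tau0; split => //; first by rewrite mulr_gt0.
move=> tau J le lt x y m hx hy.
have h1 := h tau J le lt x y m hx hy.
have := h tau J le lt (- x) y m; rewrite mulrN normrN => /(_ hx hy).
rewrite (_ : quad (- x) y = quad x y) ?sqrrN; last by rewrite /quad sqrrN.
rewrite odd_corrN => h2.
set P1 := charprod _ _ _ _ * _ in h1; set P2 := charprod _ _ _ _ * _ in h2.
set Z := cexp _ in h1 h2; set o := odd_corr _ _ _ _ in h1 h2.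
have -> : integrand tau J m (tau ^+ 3 * x) (tau * y) + integrand tau J m (- (tau ^+ 3 * x)) (tau * y) - 2 * (expR (- quad x y) * cos (tau * y * (mean tau - m)))
  = Re ((P1 - Z * (1 + o)) + (P2 - Z * (1 - o))).
  have -> : P1 - Z * (1 + o) + (P2 - Z * (1 - o)) = P1 + P2 + (- Z) + (- Z) by ring.
  by rewrite !ReD /integrand -/P1 -/P2 /Z /cexp /=; ring.
apply: (le_trans (Re_cabs _)); apply: (le_trans (cabsD _ _)); apply: (le_trans (lerD h1 h2)).
by rewrite le_eqVlt; apply/orP; left; apply/eqP; ring.
Qed.
End CenterFinal.

(** * The integrand away from the origin *)

Section Chord.
Variable R : realType.
Implicit Types a b z theta phi : R.
Local Open Scope complex_scope.

Lemma cos_decr a b : 0 <= a -> a <= b -> b <= pi -> cos b <= cos a.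
Proof.
move=> a0 ab bp.
have := @le_increment R (@cos R) (fun=> 0) (fun z => - sin z) (fun=> 0) a b ab.
move=> h; suff : cos b - cos a <= 0 - 0 by lra.
apply: h => z /andP[z1 z2]; [exact: dcos | exact: dC | ].
by rewrite oppr_le0; apply: sin_ge0_pi; apply/andP; split; lra.
Qed.

Lemma sin_ge_half z : 0 <= z -> z <= 1 / 2 -> z / 2 <= `|sin z|.
Proof.
move=> z0 z12; have := sin_taylor3_ge0 z0; rewrite ler_norml => /andP[_ hz].
have z2 : z ^+ 2 <= 1 by rewrite exprn_ile1 //; lra.
have z3 := ler_wpM2l z0 z2; rewrite -exprS mulr1 in z3.
by apply: le_trans (ler_norm _); lra.
Qed.

Lemma cos_gap_far d theta : 0 <= d <= 1 -> d <= `|theta| <= pi -> d ^+ 2 / 4 <= 1 - cos theta.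
Proof.
move=> /andP[d0 d1] /andP[h1 h2].
have -> : cos theta = cos `|theta| by case: (ger0P theta) => // _; rewrite cosN.
have := cos_decr d0 h1 h2; have := @cos_gap R d; rewrite (ger0_norm d0) => /(_ d1); lra.
Qed.

(** A subadditive measure of the distance of a from the multiples of 2 pi. Combinations of phases
    can be estimated with it without reducing angles. *)
Definition chord a : R := cabs (expi a - 1).

Lemma chord_ge0 a : 0 <= chord a. Proof. exact: cabs_ge0. Qed.
Lemma chord_sqr a : chord a ^+ 2 = 2 * (1 - cos a). Proof. exact: expi_gap. Qed.
Lemma chordD a b : chord (a + b) <= chord a + chord b.
Proof.
rewrite /chord expiD; have -> : expi a * expi b - 1 = expi a * (expi b - 1) + (expi a - 1) by ring.
by apply: (le_trans (cabsD _ _)); rewrite cabsM cabs_expi mul1r addrC.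
Qed.
Lemma chordN a : chord (- a) = chord a.
Proof.
have : chord (- a) ^+ 2 = chord a ^+ 2 by rewrite !chord_sqr cosN.
by move=> /eqP; rewrite eqrXn2 ?chord_ge0 // => /eqP.
Qed.
Lemma chordB a b : chord (a - b) <= chord a + chord b.
Proof. by rewrite -(chordN b) chordD. Qed.
Lemma chordMn n a : chord (n%:R * a) <= n%:R * chord a.
Proof.
elim: n => [|n IH]; first by rewrite !mul0r /chord expiE cos0 sin0 subrr /cabs /= expr0n addr0 sqrtr0.
by rewrite -natr1 !mulrDl !mul1r; apply: (le_trans (chordD _ _)); rewrite lerD2r.
Qed.
Lemma chord_sin a : chord a = 2 * `|sin (a / 2)|.
Proof.
have : chord a ^+ 2 = (2 * `|sin (a / 2)|) ^+ 2.
  rewrite chord_sqr exprMn real_normK ?num_real //.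
  have {1}-> : a = (a / 2) *+ 2 by rewrite mulr2n; field.
  by rewrite cos_mulr2n; have := cos2Dsin2 (a / 2); lra.
by move=> /eqP; rewrite eqrXn2 ?chord_ge0 // ?mulr_ge0 // => /eqP.
Qed.

(** Multiplied by 2 sin (h / 2), the sum of cosines telescopes to a difference of two sines. *)
Lemma dirichlet_kernel a h n : `|sin (h / 2)| * `|\sum_(j < n) cos (a + j%:R * h)| <= 1.
Proof.
have e : 2 * sin (h / 2) * \sum_(j < n) cos (a + j%:R * h) = sin (a + (n%:R - 1 / 2) * h) - sin (a - h / 2).
  elim: n => [|n IH]; first by rewrite big_ord0 mulr0 sub0r (_ : a + - (1 / 2) * h = a - h / 2) ?subrr //; field.
  have -> : n.+1%:R = n%:R + 1 :> R by rewrite natr1.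
  rewrite big_ord_recr /= mulrDr IH.
  have -> : a + (n%:R + 1 - 1 / 2) * h = (a + n%:R * h) + h / 2 by field.
  have -> : a + (n%:R - 1 / 2) * h = (a + n%:R * h) - h / 2 by field.
  by rewrite (sinB (a + n%:R * h) (h / 2)) (sinD (a + n%:R * h) (h / 2)); ring.
have := ler_normB (sin (a + (n%:R - 1 / 2) * h)) (sin (a - h / 2)).
rewrite -e !normrM (@ger0_norm _ 2) //.
have := sin_max (a + (n%:R - 1 / 2) * h); have := sin_max (a - h / 2); lra.
Qed.
End Chord.

Section MinorArcs.
Variable R : realType.
Variables N alpha beta : nat.
Hypothesis (hN : N = 2%N \/ (5 <= N)%N).
Hypotheses (halpha : (1 <= alpha <= N)%N) (hbeta : (1 <= beta <= N)%N).
Hypothesis (hab : alpha <> beta).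
Local Notation eps := (@eps R N alpha beta).
Local Notation psi := (@psi R N alpha beta).
Local Notation prob := (@prob R N alpha beta).
Local Notation charprod := (@charprod R N alpha beta).

Let hN2 : (2 <= N)%N. Proof. by case: hN => [->|]; lia. Qed.
Let N0 : 0 < N%:R :> R. Proof. by rewrite ltr0n (leq_trans _ hN2). Qed.
Let N1 : 1 <= N%:R :> R. Proof. by rewrite ler1n (leq_trans _ hN2). Qed.

Lemma eps_other g : (1 <= g <= N)%N -> g != alpha -> g != beta -> eps g = 0.
Proof.
move=> /andP[g1 gN] ga gb.
have gN' : (g.-1 < N)%N by rewrite prednK.
have e c : (1 <= c <= N)%N -> g != c -> (g == c %[mod N]) = false.
  move=> hc gc; have := residue_eq gN' hc; rewrite prednK // => ->.
  by apply/eqP => h; move/eqP: gc; apply; case/andP: hc => c1 _; rewrite -(prednK g1) h prednK.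
by rewrite /eps !e // subrr.
Qed.

(* This is where [N = 3] and [N = 4] have to be excluded: for [5 <= N]
   there are two consecutive classes, or the class of 1, on which [eps] vanishes. *)
Lemma phases_small eta phi theta : 0 <= eta ->
  (forall g, (1 <= g <= N)%N -> chord (psi phi theta g) <= eta) -> chord (N%:R * phi) <= eta ->
  chord phi <= 3 * eta /\ chord theta <= (1 + 3 * N%:R) * eta.
Proof.
move=> eta0 h hNphi.
have free g : (1 <= g <= N)%N -> g != alpha -> g != beta -> chord (g%:R * phi) <= eta.
  by move=> hg ga gb; have := h g hg; rewrite /psi eps_other // mul0r addr0.
have pair g : (1 <= g)%N -> (g.+1 <= N)%N -> g != alpha -> g != beta -> g.+1 != alpha -> g.+1 != beta -> chord phi <= 3 * eta.
  move=> g1 gN ga gb ga' gb'.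
  have h1 : chord (g%:R * phi) <= eta by apply: free => //; rewrite g1 ltnW.
  have h2 : chord (g.+1%:R * phi) <= eta by apply: free.
  have -> : phi = g.+1%:R * phi - g%:R * phi by rewrite -natr1; ring.
  by apply: (le_trans (chordB _ _)); lra.
have hphi : chord phi <= 3 * eta.
  case: hN => [N2|N5].
    have ha := h alpha halpha; have hb := h beta hbeta.
    rewrite N2 in hNphi.
    have ea := eps_alpha R hN2 halpha hbeta hab 0; have eb := eps_beta R hN2 halpha hbeta hab 0.
    rewrite muln0 addn0 in ea; rewrite muln0 addn0 in eb; rewrite /psi ea mul1r in ha; rewrite /psi eb mulN1r in hb.
    (* For N = 2 the classes are 1 and 2, so adding their phases cancels theta and leaves 3 phi; 2
       phi is small as well. *)
    have h3 : chord (3 * phi) <= 2 * eta.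
      have -> : 3 * phi = (alpha%:R * phi + theta) + (beta%:R * phi - theta).
        have : (alpha + beta = 3)%N by move: halpha hbeta hab; rewrite N2; lia.
        by move=> /(congr1 (fun n => n%:R : R)); rewrite natrD => e; rewrite -[3]e; ring.
      by apply: (le_trans (chordD _ _)); lra.
    have -> : phi = 3 * phi - 2 * phi by ring.
    by apply: (le_trans (chordB _ _)); lra.
  (* If one of the two classes is 1, the other one cannot meet all of the pairs 2, 3 and 3, 4 and 4,
     5; otherwise the class of 1 itself is free. *)
  have [a1|a1] := eqVneq alpha 1%N; last have [b1|b1] := eqVneq beta 1%N.
  - have [b2|b2] := eqVneq beta 2%N; first by apply: (pair 3%N); rewrite ?a1 ?b2 //; lia.
    have [b3|b3] := eqVneq beta 3%N; first by apply: (pair 4%N); rewrite ?a1 ?b3 //; lia.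
    by apply: (pair 2%N); rewrite ?a1 //; [lia | rewrite eq_sym | rewrite eq_sym].
  - have [b2|b2] := eqVneq alpha 2%N; first by apply: (pair 3%N); rewrite ?b1 ?b2 //; lia.
    have [b3|b3] := eqVneq alpha 3%N; first by apply: (pair 4%N); rewrite ?b1 ?b3 //; lia.
    by apply: (pair 2%N); rewrite ?b1 //; [lia | rewrite eq_sym | rewrite eq_sym].
  - have := free 1%N; rewrite mul1r => hf; apply: (@le_trans _ _ eta); last by lra.
    by apply: hf; rewrite ?[1%N == _]eq_sym // (leq_trans _ hN2).
split => //.
have ea := eps_alpha R hN2 halpha hbeta hab 0; rewrite muln0 addn0 in ea.
have ha := h alpha halpha; rewrite /psi ea mul1r in ha.
have -> : theta = (alpha%:R * phi + theta) - alpha%:R * phi by ring.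
apply: (le_trans (chordB _ _)); have := chordMn alpha phi.
have aN : alpha%:R <= N%:R :> R by rewrite ler_nat; case/andP: halpha.
have := ler_wpM2l (ler0n R alpha) hphi; have : alpha%:R * (3 * eta) <= N%:R * (3 * eta) by apply: ler_wpM2r => //; lra.
lra.
Qed.

Lemma class_le_sum (F : nat -> R) g m J : (forall k, 0 <= F k) -> (1 <= g <= N)%N -> (m <= J)%N ->
  \sum_(j < m) F (g + N * j)%N <= \sum_(k < N * J) F k.+1.
Proof.
move=> F0 /andP[g1 gN] mJ; rewrite sum_by_class.
have gN' : (g.-1 < N)%N by rewrite prednK.
rewrite (bigD1 (Ordinal gN')) //= prednK // -[leLHS]addr0; apply: lerD.
  rewrite -(subnKC mJ); elim: (J - m)%N => [|r IH]; first by rewrite addn0.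
  by rewrite addnS big_ord_recr /= (le_trans IH) // lerDl.
by apply: sumr_ge0 => i _; apply: sumr_ge0.
Qed.

Lemma truncated_length (s B : R) (J : nat) : 0 < s -> 0 < B -> 2 * s <= B -> B <= s * J%:R ->
  exists m : nat, [/\ (m <= J)%N, m%:R * s <= B & B <= 2 * (m%:R * s)].
Proof.
move=> s0 B0 sB hJ; have q0 : 0 <= B / s by rewrite divr_ge0 // ltW.
have /andP[M1 M2] := truncn_itv q0; set M := Num.truncn _ in M1 M2.
have Ms : M%:R * s <= B by rewrite -ler_pdivlMr.
exists M; split => //.
  by rewrite -(ler_nat R) -(ler_pM2r s0) (le_trans Ms) // mulrC.
by move: M2; rewrite ltr_pdivrMr // -natr1 mulrDl mul1r; lra.
Qed.

Lemma charprod_decay tau J phi theta :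
  cabs (charprod tau J phi theta) <=
  expR (- \sum_(k < N * J) fvar (k.+1%:R * tau ^+ 2 - eps k.+1 * tau) * (1 - cos (psi phi theta k.+1))).
Proof.
rewrite /charprod cabs_prod -sumrN expR_sum; apply: ler_prod => k _.
by rewrite cabs_ge0 /= (le_trans (bern_abs _ (prob01 _ _ _ _ _))) // fvar_prob.
Qed.

Lemma fvar_range tau k B : 0 < tau <= 1 -> k%:R * tau ^+ 2 <= B ->
  expR (- (B + 1)) / 4 <= fvar (k%:R * tau ^+ 2 - eps k * tau).
Proof.
move=> /andP[t0 t1] kB; apply: le_trans (fvar_lower _).
rewrite ler_pM2r // ler_expR lerN2 (le_trans (ler_normB _ _)) //.
have k0 : 0 <= k%:R * tau ^+ 2 by rewrite mulr_ge0 // sqr_ge0.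
rewrite (ger0_norm k0) normrM (ger0_norm (ltW t0)).
have := eps_abs R N alpha beta k; have := normr_ge0 (eps k); nra.
Qed.

(** Three cases. If N phi is not close to a multiple of 2 pi, the phases rotate within the class of
    1 and [dirichlet_kernel] bounds their cosines. Otherwise the phases are nearly constant along
    each class; a class whose phase is far from 0 loses a fixed amount per part. If there is none,
    [phases_small] brings phi and theta close to 0, and sin (N phi / 2) is too large for the second
    alternative. *)
Lemma minor_arcs : exists c B : R, [/\ 0 < c, 1 <= B & forall tau J, large_enough N tau J ->
  B <= N%:R * tau ^+ 2 * J%:R -> forall phi theta, `|phi| <= pi -> `|theta| <= pi ->
  (tau ^+ 2 / 2 < `|phi|) || (1 / 2 < `|theta|) ->
  cabs (charprod tau J phi theta) <= expR (- (c / tau ^+ 2))].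
Proof.
(* This [eta] is so small that the bounds of [phases_small] exclude |theta| > 1/2 and |phi| > 1 / N.
   The choice of [B] gives at least 4 / (d T) parts of the class of 1, against a cosine sum of at
   most 1 / (d T). *)
pose eta : R := (100 * N%:R)^-1.
have eta0 : 0 < eta by rewrite invr_gt0 mulr_gt0.
have etaN : N%:R * eta = 1 / 100 by rewrite /eta; field; rewrite gt_eqF.
have etaE : eta = N%:R^-1 / 100 by rewrite /eta invfM mulrC.
clearbody eta.
have eta1 : eta <= 1 / 100 by rewrite -etaN ler_peMl // ltW.
pose d := eta / 2; have d0 : 0 < d by rewrite divr_gt0.
pose B := 8 * N%:R / d.
have B1 : 1 <= B by rewrite /B ler_pdivlMr // mul1r; have := N1; rewrite /d; lra.
pose vB := expR (- (B + 1 + 1)) / 4; have vB0 : 0 < vB by rewrite divr_gt0 ?expR_gt0.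
pose vl := expR (- (2 + 1)) / 4 : R; have vl0 : 0 < vl by rewrite divr_gt0 ?expR_gt0.
pose c1 := vB * (1 / d); pose c2 := vl * (eta ^+ 2 / 8) / (2 * N%:R).
have c10 : 0 < c1 by rewrite mulr_gt0 // divr_gt0.
have c20 : 0 < c2 by rewrite divr_gt0 ?mulr_gt0 // divr_gt0 // exprn_gt0.
exists (Num.min c1 c2), B; split => //; first by rewrite lt_min c10.
move=> tau J [adm s4 sJ1] sJ phi theta hp ht out.
have [tau01 _ _] := adm; have /andP[t0 t1] := tau01.
set T := tau ^+ 2 in s4 sJ1 sJ out *; have T0 : 0 < T by rewrite exprn_gt0.
have s0 : 0 < N%:R * T by rewrite mulr_gt0.
apply: (le_trans (charprod_decay tau J phi theta)); rewrite ler_expR lerN2 -/T.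
pose F k := fvar (k%:R * T - eps k * tau) * (1 - cos (psi phi theta k)).
have F0 k : 0 <= F k by rewrite mulr_ge0 ?(ltW (fvar_gt0 _)) // subr_ge0 cos_le1.
have psiE g j : psi phi theta (g + N * j) = psi phi theta g + j%:R * (N%:R * phi).
  by rewrite /psi eps_class natrD natrM; ring.
have arg g j m D : (1 <= g <= N)%N -> (j < m)%N -> m%:R * (N%:R * T) <= D -> (g + N * j)%:R * T <= D.
  move=> /andP[_ gN] jm; apply: le_trans; rewrite mulrA; apply: ler_wpM2r; first exact: ltW.
  by rewrite -natrM ler_nat (leq_trans (leq_add gN (leqnn _))) // -mulnS mulnC leq_mul2r jm orbT.
have halpha1 : (1 <= 1 <= N)%N by rewrite (leq_trans _ hN2).
have [big|small] := leP (d * T) `|sin (N%:R * phi / 2)|.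
  clear out hp ht c20 vl0 sJ1 etaE etaN eta1 t0 t1.
  have [m [mJ m1 m2]] : exists m : nat, [/\ (m <= J)%N, m%:R * (N%:R * T) <= B & B <= 2 * (m%:R * (N%:R * T))].
    apply: truncated_length => //; lra.
  apply: (@le_trans _ _ (c1 / T)); first by apply: ler_wpM2r; rewrite ?invr_ge0 ?ge_min ?lexx // ltW.
  apply: le_trans (class_le_sum F0 halpha1 mJ).
  apply: (@le_trans _ _ (\sum_(j < m) vB * (1 - cos (psi phi theta 1 + j%:R * (N%:R * phi))))); last first.
    apply: ler_sum => j _; rewrite /F psiE; apply: ler_wpM2r; first by rewrite subr_ge0 cos_le1.
    apply: fvar_range => //; apply: (arg 1%N j m) => //; lra.
  rewrite -mulr_sumr sumrB sumr_const card_ord /c1 -mulrA; apply: ler_wpM2l; first exact: ltW.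
  have dk := dirichlet_kernel (psi phi theta 1) (N%:R * phi) m.
  set S := \sum_(j < m) _ in dk *.
  have dT0 : 0 < d * T by rewrite mulr_gt0.
  have S1 : d * T * `|S| <= 1.
    by apply: le_trans dk; apply: ler_wpM2r.
  have mB : 4 <= m%:R * (d * T).
    move: m2; rewrite /B ler_pdivrMr // => m2.
    have : N%:R * 8 <= N%:R * (2 * (m%:R * (d * T))) by move: m2; rewrite /T; lra.
    by rewrite ler_pM2l //; lra.
  have -> : 1 / d / T = (d * T)^-1 by field; rewrite !gt_eqF.
  rewrite -[leLHS]div1r ler_pdivrMr //; have := ler_norm S.
  move=> S2; have := ler_wpM2l (ltW dT0) S2; rewrite mulrBl; lra.
have chN : chord (N%:R * phi) <= eta * T.
  by rewrite chord_sin; move: small; rewrite /d; lra.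
clear c10 vB0 B1 sJ t0 t1.
have [m [mJ m1 m2]] : exists m : nat, [/\ (m <= J)%N, m%:R * (N%:R * T) <= 1 & 1 <= 2 * (m%:R * (N%:R * T))].
  by apply: truncated_length => //; lra.
apply: (@le_trans _ _ (c2 / T)); first by apply: ler_wpM2r; rewrite ?invr_ge0 ?ge_min ?lexx ?orbT // ltW.
have [[g [hg far]]|near] := pselect (exists g, (1 <= g <= N)%N /\ eta < chord (psi phi theta g)).
  clear out hp ht etaE etaN eta1.
  apply: le_trans (class_le_sum F0 hg mJ).
  apply: (@le_trans _ _ (\sum_(j < m) vl * (eta ^+ 2 / 8))); last first.
    apply: ler_sum => j _; rewrite /F; apply: ler_pM.
    - exact: ltW.
    - by rewrite divr_ge0 // sqr_ge0.
    - by apply: fvar_range => //; apply: (arg g j m) => //; lra.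
    have hj : chord (j%:R * (N%:R * phi)) <= eta / 2.
      apply: (le_trans (chordMn _ _)); apply: (@le_trans _ _ (j%:R * (eta * T))); first exact: ler_wpM2l.
      have jm : j%:R <= m%:R :> R by rewrite ler_nat ltnW.
      have N2 : 2 <= N%:R :> R by rewrite ler_nat.
      have : m%:R * T <= 1 / 2.
        have : 2 * (m%:R * T) <= m%:R * (N%:R * T) by rewrite [leRHS]mulrCA; apply: ler_wpM2r => //; apply: mulr_ge0; [exact: ler0n | exact: ltW].
        lra.
      have : j%:R * T <= m%:R * T by apply: ler_wpM2r; rewrite // ltW.
      move=> q1 q2; have := ler_wpM2l (ltW eta0) (le_trans q1 q2); lra.
    have : eta / 2 <= chord (psi phi theta (g + N * j)).
      rewrite psiE; have := chordB (psi phi theta g + j%:R * (N%:R * phi)) (j%:R * (N%:R * phi)).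
      rewrite addrK; lra.
    move=> q; have : (eta / 2) ^+ 2 <= chord (psi phi theta (g + N * j)) ^+ 2.
      by rewrite lerXn2r // nnegrE ?chord_ge0 // divr_ge0 // ltW.
    by rewrite chord_sqr exprMn; lra.
  rewrite sumr_const card_ord -[_ *+ m]mulr_natl /c2.
  have w0 : 0 < vl * (eta ^+ 2 / 8) by rewrite mulr_gt0 // divr_gt0 // exprn_gt0.
  rewrite -mulrA mulrC; apply: ler_wpM2r; first exact: ltW.
  have -> : (2 * N%:R)^-1 / T = 1 / (2 * (N%:R * T)) by field; rewrite !gt_eqF.
  by rewrite ler_pdivrMr ?mulr_gt0 //; lra.
clear vl0 c20 sJ1 mJ m1 m2.
have T4 : T <= 1 / 4 by have := N1; nra.
have near' g : (1 <= g <= N)%N -> chord (psi phi theta g) <= eta.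
  by move=> hg; rewrite leNgt; apply/negP => hgt; apply: near; exists g.
have chN' : chord (N%:R * phi) <= eta by apply: (le_trans chN); rewrite ler_piMr ?(ltW eta0) //; lra.
have [cp ct] := phases_small (ltW eta0) near' chN'.
have thS : `|theta| <= 1 / 2.
  rewrite leNgt; apply/negP => th.
  have d01 : 0 <= (1 / 2 : R) <= 1 by rewrite divr_ge0 //= ler_pdivrMr // mul1r ler1n.
  have := @cos_gap_far R (1 / 2) theta d01; rewrite (ltW th) ht => /(_ isT).
  have := chord_sqr theta; have := chord_ge0 theta; nra.
have phS : N%:R * `|phi| <= 1.
  rewrite leNgt; apply/negP => hph.
  have i0 : 0 < (N%:R)^-1 :> R by rewrite invr_gt0.
  have i1 : (N%:R)^-1 <= 1 :> R by rewrite invf_le1.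
  have hi : (N%:R)^-1 <= `|phi| by rewrite -[leLHS]mulr1 ler_pdivrMl // ltW.
  have d01 : 0 <= (N%:R^-1 : R) <= 1 by rewrite i1 ltW.
  have := @cos_gap_far R (N%:R^-1) phi d01; rewrite hi hp => /(_ isT).
  have := chord_sqr phi; have := chord_ge0 phi.
  move: cp; rewrite etaE; set i := N%:R^-1 in i0 *; nra.
move: out; rewrite [1 / 2 < _]ltNge thS orbF => hph.
have z0 : 0 <= N%:R * `|phi| / 2 by rewrite divr_ge0 // mulr_ge0 // ltW.
have sE : `|sin (N%:R * phi / 2)| = `|sin (N%:R * `|phi| / 2)|.
  by case: (ger0P phi) => // _; rewrite mulrN mulNr sinN normrN.
have z12 : N%:R * `|phi| / 2 <= 1 / 2 by rewrite ler_wpM2r // invr_ge0.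
have := sin_ge_half z0 z12; set z := N%:R * `|phi| / 2 in z0 sE z12 * => hs.
have zT : T / 2 <= z.
  apply: (le_trans (ltW hph)); rewrite /z ler_pdivlMr // mulrC.
  by apply: ler_wpM2r; rewrite ?normr_ge0 // ler_nat.
exfalso; move: small; rewrite sE ltNge => /negP; apply.
by apply: le_trans hs; rewrite /d; nra.
Qed.
End MinorArcs.

Section Pointwise.
Variable R : realType.
Variables N alpha beta : nat.
Hypothesis (hN : N = 2%N \/ (5 <= N)%N).
Hypotheses (halpha : (1 <= alpha <= N)%N) (hbeta : (1 <= beta <= N)%N).
Hypothesis (hab : alpha <> beta).
Local Notation quad := (@quad R N).
Local Notation mean := (@mean R N alpha beta).
Local Notation integrand := (@integrand R N alpha beta).
Local Notation charprod := (@charprod R N alpha beta).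

Let hN2 : (2 <= N)%N. Proof. by case: hN => [->|]; lia. Qed.

Lemma exp_inv_sqr_le (a : R) : 0 < a -> exists2 C : R, 0 < C &
  forall tau, 0 < tau -> expR (- (a / tau ^+ 2)) <= C * tau ^+ 6.
Proof.
move=> a0; exists (6 / a ^+ 3); first by rewrite divr_gt0 // exprn_gt0.
move=> tau t0; have T0 : 0 < tau ^+ 2 by rewrite exprn_gt0.
have u0 : 0 <= a / tau ^+ 2 by rewrite divr_ge0 // ltW.
have := exprn_le_expR 3 u0; rewrite expRN => h.
have e0 := expR_gt0 (a / tau ^+ 2).
rewrite -[leLHS]div1r ler_pdivrMr //.
have -> : 6 / a ^+ 3 * tau ^+ 6 * expR (a / tau ^+ 2) = (6 * expR (a / tau ^+ 2)) / (a / tau ^+ 2) ^+ 3.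
  by field; rewrite !gt_eqF.
by rewrite ler_pdivlMr ?mul1r // exprn_gt0 // divr_gt0.
Qed.

Lemma integrand_abs tau J m phi theta : `|integrand tau J m phi theta| <= cabs (charprod tau J phi theta).
Proof. by rewrite /integrand (le_trans (Re_cabs _)) // cabsM cabs_expi mulr1. Qed.

(** Outside the centre the integrand and the Gaussian are both exponentially small. The bound tau^6
    suffices there, because the central error tau^2, integrated over a Gaussian of widths tau^3 and
    tau, also gives tau^6. *)
Lemma pointwise_bound : exists c K tau0 B : R, [/\ 0 < c, 0 < K, 0 < tau0 & forall tau J,
  large_enough N tau J -> B <= N%:R * tau ^+ 2 * J%:R -> tau <= tau0 -> forall m phi theta,
  `|phi| <= pi -> `|theta| <= pi ->
  `|integrand tau J m phi theta + integrand tau J m (- phi) theta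
    - 2 * (expR (- quad (phi / tau ^+ 3) (theta / tau)) * cos (theta * (mean tau - m)))|
  <= K * (tau ^+ 2 * expR (- (c * ((phi / tau ^+ 3) ^+ 2 + (theta / tau) ^+ 2))) + tau ^+ 6)].
Proof.
have [c [K [tau0 [c0 K0 t00 hcenter]]]] := center_symmetrized R hN2 halpha hbeta hab.
have [c' [B [c'0 B1 hminor]]] := minor_arcs R hN halpha hbeta hab.
have [q q0 hq] := quad_lower R hN2 halpha hbeta hab.
have q40 : 0 < q / 4 by rewrite divr_gt0.
have [C1 C10 hC1] := exp_inv_sqr_le c'0.
have [C2 C20 hC2] := exp_inv_sqr_le q40.
exists c, (K + 2 * C1 + 2 * C2), tau0, B; split => //; first by rewrite !addr_gt0 // mulr_gt0.
move=> tau J large sJ tt0 m phi theta hp ht.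
have [[/andP[t0 t1] _ _] _ _] := large.
have T0 : 0 < tau ^+ 2 by rewrite exprn_gt0.
have T30 : 0 < tau ^+ 3 by rewrite exprn_gt0.
have T60 : 0 < tau ^+ 6 by rewrite exprn_gt0.
have nn : tau != 0 by rewrite gt_eqF.
set x := phi / tau ^+ 3; set y := theta / tau.
have ephi : phi = tau ^+ 3 * x by rewrite /x; field.
have etheta : theta = tau * y by rewrite /y; field.
set X := expR (- (c * (x ^+ 2 + y ^+ 2))).
have X0 : 0 <= X by exact: expR_ge0.
have TX : 0 <= tau ^+ 2 * X by rewrite mulr_ge0 // ltW.
have CT : 0 <= (C1 + C2) * (tau ^+ 2 * X) by rewrite mulr_ge0 // addr_ge0 // ltW.
have KX : 0 <= K * (tau ^+ 2 * X) by rewrite mulr_ge0 // ltW.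
have KT : 0 <= K * tau ^+ 6 by rewrite mulr_ge0 // ltW.
have [out|/norP[]] := boolP ((tau ^+ 2 / 2 < `|phi|) || (1 / 2 < `|theta|)); last first.
  rewrite -!leNgt => hp' ht'; have C6 : 0 <= (C1 + C2) * tau ^+ 6 by rewrite mulr_ge0 ?addr_ge0 // ltW.
  have := hcenter tau J large tt0 x y m; rewrite -ephi -etheta => /(_ hp' ht') h.
  by apply: (le_trans h); rewrite -/X; lra.
have i1 := integrand_abs tau J m phi theta.
have i2 := integrand_abs tau J m (- phi) theta.
have m1 := hminor tau J large sJ phi theta hp ht out.
have m2 := hminor tau J large sJ (- phi) theta; rewrite normrN in m2.
have {}m2 := m2 hp ht out.
have e1 := hC1 tau t0.
have e2 : expR (- quad x y) <= C2 * tau ^+ 6.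
  apply: le_trans (hC2 tau t0); rewrite ler_expR lerN2.
  apply: le_trans (hq x y); rewrite -[leLHS]mulrA; apply: ler_wpM2l; first exact: ltW.
  rewrite ler_pdivrMr //.
  have far (u : R) : 1 / 2 < `|u| -> 1 / 4 <= u ^+ 2.
    by move=> hu; rewrite -(real_normK (num_real u)); have := normr_ge0 u; nra.
  have xx := sqr_ge0 (tau * x); have yy := sqr_ge0 (tau * y).
  have -> : (x ^+ 2 + y ^+ 2) * tau ^+ 2 = (tau * x) ^+ 2 + (tau * y) ^+ 2 by ring.
  case/orP: out => hout; last first.
    by have := far (tau * y); rewrite -etheta => /(_ hout); rewrite -etheta in yy; lra.
  have := far (tau * x); suff hx : 1 / 2 < `|tau * x| by move=> /(_ hx); lra.
  rewrite -(ltr_pM2l T0) -[X in X * `|_|](gtr0_norm T0) -normrM.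
  by have -> : tau ^+ 2 * (tau * x) = phi; [rewrite ephi; ring | rewrite mulrA mulr1].
rewrite -/X.
have gc : `|expR (- quad x y) * cos (theta * (mean tau - m))| <= C2 * tau ^+ 6.
  rewrite normrM (ger0_norm (expR_ge0 _)) (le_trans _ e2) // ler_piMr ?expR_ge0 // ler_norml.
  by rewrite cos_geN1 cos_le1.
set g := expR _ * cos _ in gc *.
apply: (le_trans (ler_normB _ _)); rewrite [ `|2 * g|]normrM (@ger0_norm _ 2) //.
apply: le_trans (lerD (ler_normD _ _) (lexx _)) _.
lra.
Qed.
End Pointwise.

(** * Gaussian integrals *)

Section Integral.
Variable R : realType.
Implicit Types (f g F : R -> R) (a b x : R).
Local Notation mu := (@lebesgue_measure R).

(** A quadratic bound on the increment suffices for a derivative. It serves to differentiate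
    integrals, both in a limit of integration ([gtail]) and in a parameter ([gauss_cos]). *)
Lemma der_of_quadratic F x (d C : R) : (forall h, `|h| <= 1 -> `|F (x + h) - F x - d * h| <= C * h ^+ 2) ->
  der_at F x d.
Proof.
move=> hF.
have C0 : 0 <= C.
  have := hF 1; rewrite normr1 expr1n !mulr1 => /(_ (lexx _)) h1.
  exact: le_trans (normr_ge0 _) h1.
have cvgF : h^-1 *: (F (h *: 1 + x) - F x) @[h --> 0^'] --> d.
  apply/cvgrPdist_le => e e0.
  have del0 : 0 < Num.min 1 (e / (C + 1)) by rewrite lt_min ltr01 divr_gt0 //; lra.
  near=> h.
  have hn : h != 0 by near: h; exact: nbhs_dnbhs_neq.
  have hh : `|h| <= Num.min 1 (e / (C + 1)).
    by near: h; apply/dnbhs0_le.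
  move: hh; rewrite le_min => /andP[h1 he].
  have h0 : 0 < `|h| by rewrite normr_gt0.
  have := hF h h1.
  have -> : d - h^-1 *: (F (h *: 1 + x) - F x) = - (F (x + h) - F x - d * h) / h.
    have -> : h *: (1 : R) + x = x + h by rewrite addrC -[in RHS](mulr1 h).
    by rewrite /GRing.scale /=; field.
  rewrite normrM normrN normfV ler_pdivrMr // => q; apply: (le_trans q).
  rewrite -(real_normK (num_real h)) expr2 mulrA; apply: ler_wpM2r => //.
  move: he; rewrite ler_pdivlMr; last by lra.
  by have := normr_ge0 h; nra.
split; first by apply/cvg_ex; exists d.
exact/cvg_lim.
Unshelve. all: by end_near.
Qed.

Definition Int a b f : R := \int[mu]_(x in `[a, b]) f x.

Lemma Int_integrable a b f : continuous f -> mu.-integrable `[a, b] (EFin \o f).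
Proof.
by move=> cf; apply: continuous_compact_integrable; [exact: segment_compact | exact: continuous_subspaceT].
Qed.

Lemma IntD a b f g : continuous f -> continuous g -> Int a b (fun x => f x + g x) = Int a b f + Int a b g.
Proof. by move=> cf cg; rewrite /Int RintegralD //; exact: Int_integrable. Qed.

Lemma IntZ a b k f : continuous f -> Int a b (fun x => k * f x) = k * Int a b f.
Proof. by move=> cf; rewrite /Int RintegralZl //; exact: Int_integrable. Qed.

Lemma IntB a b f g : continuous f -> continuous g -> Int a b (fun x => f x - g x) = Int a b f - Int a b g.
Proof. by move=> cf cg; rewrite /Int RintegralB //; exact: Int_integrable. Qed.

Lemma eq_Int a b f g : (forall x, a <= x <= b -> f x = g x) -> Int a b f = Int a b g.
Proof. by move=> fg; apply: eq_Rintegral => x; rewrite inE /= in_itv /= => /fg. Qed.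

Lemma Int_cst a b k : a <= b -> Int a b (fun=> k) = k * (b - a).
Proof.
move=> ab; rewrite /Int Rintegral_cst //= lebesgue_measure_itv /= lte_fin.
by have [//|ba] := ltP a b; rewrite (_ : a = b) ?subrr //; apply/eqP; rewrite eq_le ab.
Qed.

Lemma Int_le a b f g : continuous f -> continuous g -> (forall x, a <= x <= b -> f x <= g x) ->
  Int a b f <= Int a b g.
Proof.
move=> cf cg fg; apply: le_Rintegral => //; try exact: Int_integrable.
Qed.

Lemma Int_abs a b f g : continuous f -> continuous g -> (forall x, a <= x <= b -> `|f x| <= g x) ->
  `|Int a b f| <= Int a b g.
Proof.
move=> cf cg fg; rewrite ler_norml; apply/andP; split; last first.
  by apply: Int_le => // x /fg; exact/le_trans/ler_norm.
have -> : - Int a b g = Int a b (fun x => -1 * g x) by rewrite IntZ // mulN1r.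
apply: Int_le => //; first by move=> x; apply: cvgM; [exact: cvg_cst | exact: cg].
by move=> x /fg; rewrite mulN1r ler_norml => /andP[].
Qed.

Lemma Int_sum a b (I : Type) (r : seq I) (F : I -> R -> R) : (forall i, continuous (F i)) ->
  continuous (fun x => \sum_(i <- r) F i x) /\
  Int a b (fun x => \sum_(i <- r) F i x) = \sum_(i <- r) Int a b (F i).
Proof.
move=> cF; elim: r => [|i r [IH1 IH2]].
  rewrite big_nil; under eq_fun do rewrite big_nil; split; first by move=> x; exact: cvg_cst.
  have [ab|ba] := leP a b; first by rewrite Int_cst // mul0r.
  by rewrite /Int set_itv_ge ?Rintegral_set0 // bnd_simp -ltNge.
rewrite big_cons; under eq_fun do rewrite big_cons.
split; first by move=> x; apply: cvgD; [exact: cF | exact: IH1].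
by rewrite IntD // IH2.
Qed.

Lemma Int_ftc a b f F : a < b -> continuous f -> (forall x, der_at F x (f x)) -> Int a b f = F b - F a.
Proof.
move=> ab cf dF; rewrite /Int /Rintegral (@continuous_FTC2 R f F a b) //.
- exact: continuous_subspaceT.
- split.
  + by move=> x _; have [] := dF x.
  + exact/cvg_at_right_filter/(derive_cont (dF a)).
  + exact/cvg_at_left_filter/(derive_cont (dF b)).
- by move=> x _; rewrite derive1E; have [_ ->] := dF x.
Qed.
End Integral.

Section GaussTail.
Variable R : realType.
Implicit Types a b x : R.
Local Notation mu := (@lebesgue_measure R).

Definition gtail x : R := \int[mu]_(t in `[x, +oo[) gauss_fun t.

Lemma gauss_integrable (D : set R) : measurable D -> mu.-integrable D (EFin \o (@gauss_fun R)).
Proof. by move=> mD; apply: (integrableS _ _ _ (@integrableT_gauss R)). Qed.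

Lemma gtail_split a b : a <= b -> gtail a = Int a b (@gauss_fun R) + gtail b.
Proof.
move=> ab; have := @Rintegral_itvB R (@gauss_fun R) (BLeft a) +oo%O b.
rewrite !bnd_simp => /(_ (gauss_integrable (measurable_itv _)) ab isT).
have ib := gauss_integrable (measurable_itv (Interval (BRight b) +oo%O)).
rewrite (Rintegral_itv_obnd_cbnd ib).
by rewrite -/(gtail a) -/(gtail b) -/(Int a b _) => <-; rewrite addrC subrK.
Qed.

Lemma dgauss x : der_at (@gauss_fun R) x (- 2 * x * gauss_fun x).
Proof.
apply: (der_eq (dcomp (dexp _) (dN (dX 2 (dI x))))).
by rewrite /gauss_fun /=; ring.
Qed.

Lemma gauss_lip a b : `|gauss_fun b - gauss_fun a| <= `|b - a| :> R.
Proof.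
have bound z : `|- 2 * z * gauss_fun z| <= 1 :> R.
  rewrite normrM (ger0_norm (gauss_fun_ge0 _)) /gauss_fun expRN.
  rewrite ler_pdivrMr ?expR_gt0 // mul1r normrM normrN (@ger0_norm _ 2) //.
  apply: le_trans (expR_ge1Dx _); have := sqr_ge0 (`|z| - 1); rewrite -(real_normK (num_real z)); lra.
wlog ab : a b / a <= b.
  move=> h; have [|/ltW] := leP a b; first exact: h.
  by move/h; rewrite distrC [X in _ <= X -> _]distrC.
have := @abs_increment R (@gauss_fun R) id (fun z => - 2 * z * gauss_fun z) (fun=> 1) a b ab.
rewrite [in X in _ -> X](ger0_norm (_ : 0 <= b - a)) ?subr_ge0 //; apply=> z _; [exact: dgauss | exact: dI | exact: bound].
Qed.

Lemma gtail_taylor x h : `|gtail (x + h) - gtail x - - gauss_fun x * h| <= 2 * h ^+ 2.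
Proof.
have key a b : a <= b -> `|Int a b (@gauss_fun R) - gauss_fun x * (b - a)| <= (`|a - x| + (b - a)) * (b - a).
  move=> ab; rewrite -!(Int_cst _ ab) -IntB; first last.
  - by move=> z; exact: cvg_cst.
  - exact: continuous_gauss_fun.
  apply: Int_abs => [z|z|z /andP[z1 z2]]; first 1 last.
  - exact: cvg_cst.
  - apply: (le_trans (gauss_lip _ _)).
    have -> : z - x = (a - x) + (z - a) by ring.
    by apply: (le_trans (ler_normD _ _)); rewrite lerD2l ger0_norm ?subr_ge0 // lerD2r.
  - by apply: cvgB; [exact: continuous_gauss_fun | exact: cvg_cst].
have [h0|/ltW h0] := leP 0 h.
  have xh : x <= x + h by rewrite lerDl.
  have := key _ _ xh; rewrite (gtail_split xh) subrr normr0 add0r addrAC subrr add0r => k.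
  have -> : gtail (x + h) - (Int x (x + h) (@gauss_fun R) + gtail (x + h)) - - gauss_fun x * h = - (Int x (x + h) (@gauss_fun R) - gauss_fun x * h) by ring.
  rewrite normrN; apply: (le_trans k); have := sqr_ge0 h; rewrite expr2; lra.
have xh : x + h <= x by rewrite gerDl.
have := key _ _ xh; rewrite (gtail_split xh) => k.
have -> : Int (x + h) x (@gauss_fun R) + gtail x - gtail x - - gauss_fun x * h = Int (x + h) x (@gauss_fun R) - gauss_fun x * (x - (x + h)) by ring.
apply: (le_trans k); rewrite (_ : x + h - x = h) ?(ler0_norm h0); last by ring.
have := sqr_ge0 h; lra.
Qed.

Lemma dgtail x : der_at gtail x (- gauss_fun x).
Proof. by apply: (@der_of_quadratic _ _ _ _ 2) => h _; exact: gtail_taylor. Qed.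

Lemma gtail0 : gtail 0 = Num.sqrt pi / 2.
Proof. by rewrite /gtail /Rintegral integral0y_gauss. Qed.

Lemma gtailN x : gtail x + gtail (- x) = Num.sqrt pi.
Proof.
have d z : der_at (fun z => gtail z + gtail (- z)) z 0.
  apply: (der_eq (dD (dgtail z) (dcomp (dgtail (- z)) (dN (dI z))))).
  by rewrite /gauss_fun sqrrN; ring.
have e y : 0 <= y -> gtail y + gtail (- y) = Num.sqrt pi.
  move=> y0; have := @abs_increment R (fun z => gtail z + gtail (- z)) (fun=> 0) (fun=> 0) (fun=> 0) 0 y y0.
  rewrite oppr0 gtail0 addr0 => h.
  have /eqP : gtail y + gtail (- y) - (Num.sqrt pi / 2 + Num.sqrt pi / 2) == 0.
    by rewrite -normr_le0; apply: h => z _; [exact: d | exact: dC | rewrite normr0].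
  by lra.
have [/e//|/ltW x0] := leP 0 x.
by rewrite addrC -[X in _ + gtail X]opprK e // oppr_ge0.
Qed.

Lemma gtail_ge0 x : 0 <= gtail x.
Proof. by apply: Rintegral_ge0 => t _; exact: gauss_fun_ge0. Qed.

Lemma gauss_le_exp x : gauss_fun x <= 3 * expR (- x).
Proof.
have h : expR (- x ^+ 2) <= expR (1 / 4) * expR (- x).
  by rewrite -expRD ler_expR; have := sqr_ge0 (x - 1 / 2); lra.
apply: (le_trans h); apply: ler_wpM2r; first exact: expR_ge0.
apply: le_trans (exp1_le3 R); rewrite ler_expR ler_pdivrMr //; lra.
Qed.

Lemma gtail_le x : gtail x <= 3 * expR (- x).
Proof.
have cE : continuous (fun t : R => 3 * expR (- t)).
  by move=> t; apply: cvgM; [exact: cvg_cst | apply: continuous_comp; [exact: opp_continuous | exact: continuous_expR]].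
have dE z : der_at (fun t : R => - (3 * expR (- t))) z (3 * expR (- z)).
  by apply: (der_eq (dN (dM (dC 3 z) (dcomp (dexp _) (dN (dI z)))))); ring.
have lim0 : - (3 * expR (- t)) @[t --> +oo] --> (0 : R).
  rewrite -oppr0; apply: cvgN; rewrite -(mulr0 3); apply: cvgM; first exact: cvg_cst.
  exact: cvgr_expR.
have cW : {within `[x, +oo[, continuous (fun t : R => 3 * expR (- t))} by exact: continuous_subspaceT.
have pos t : x <= t -> 0 <= 3 * expR (- t) by move=> _; rewrite mulr_ge0 ?expR_ge0.
have E := @ge0_continuous_FTC2y R (fun t => 3 * expR (- t)) (fun t => - (3 * expR (- t))) x 0 pos cW lim0
  (fun t _ => @ex_derive _ _ _ _ _ _ _ (dE t)) (cvg_at_right_filter (derive_cont (dE x))).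
have {}E : (\int[mu]_(t in `[x, +oo[) (3 * expR (- t))%:E)%E = (3 * expR (- x))%:E.
  rewrite E ?sub0r; last by move=> t _; rewrite derive1E; have [_ ->] := dE t.
  by rewrite -EFinB sub0r opprK.
have -> : 3 * expR (- x) = \int[mu]_(t in `[x, +oo[) (3 * expR (- t)) by rewrite /Rintegral E.
apply: le_Rintegral => //; first exact: gauss_integrable.
  apply/integrableP; split.
    by apply/measurable_EFinP; apply: measurable_funTS; exact: continuous_measurable_fun.
  rewrite (_ : (\int[mu]_(_ in _) _)%E = (3 * expR (- x))%:E) ?ltry // -E.
  by apply: eq_integral => t _; rewrite /= ger0_norm // mulr_ge0 ?expR_ge0.
by move=> t _; exact: gauss_le_exp.
Qed.

Lemma Int_gauss (a p : R) : 0 < a -> 0 < p ->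
  Int (- p) p (fun x => expR (- (a * x ^+ 2))) = (Num.sqrt pi - 2 * gtail (Num.sqrt a * p)) / Num.sqrt a.
Proof.
move=> a0 p0; have s0 : 0 < Num.sqrt a by rewrite sqrtr_gt0.
have np : - p < p by lra.
rewrite (@Int_ftc R _ _ _ (fun x => - gtail (Num.sqrt a * x) / Num.sqrt a) np).
- rewrite mulrN; have := gtailN (Num.sqrt a * p); set u := gtail _; set v := gtail _ => <-.
  by field; rewrite gt_eqF.
- move=> x; apply: continuous_comp; last exact: continuous_expR.
  by apply: cvgN; apply: cvgM; [exact: cvg_cst | exact: exprn_continuous].
- move=> x; apply: (der_eq (dM (dN (dcomp (dgtail _) (dM (dC _ x) (dI x)))) (dC _ x))).
  rewrite /gauss_fun exprMn sqr_sqrtr ?ltW //; field; rewrite gt_eqF //.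
Qed.
End GaussTail.

Lemma cos_increment (R : realType) (x u : R) : `|u| <= 4 -> `|cos (x + u) - cos x + u * sin x| <= 2 * u ^+ 2.
Proof.
move=> u4; rewrite cosD.
have -> : cos x * cos u - sin x * sin u - cos x + u * sin x = cos x * (cos u - 1) - sin x * (sin u - u) by ring.
have h1 : `|cos u - 1| <= u ^+ 2 / 2.
  by rewrite distrC; exact: cos_taylor2.
have h2 : `|sin u - u| <= `|u| ^+ 3 / 6.
  have [p|/ltW n] := leP 0 u; first by rewrite distrC (ger0_norm p) sin_taylor3_ge0.
  have n' : 0 <= - u by lra.
  have := sin_taylor3_ge0 n'; rewrite sinN -opprD normrN (ler0_norm n).
  by rewrite distrC.
have h3 : `|u| ^+ 3 <= 4 * u ^+ 2.
  by rewrite exprS real_normK ?num_real //; apply: ler_wpM2r => //; exact: sqr_ge0.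
apply: (le_trans (ler_normB _ _)); rewrite !normrM.
have c1 : `|cos x| * `|cos u - 1| <= 1 * (u ^+ 2 / 2) by apply: ler_pM => //; exact: cos_max.
have s1 : `|sin x| * `|sin u - u| <= 1 * (`|u| ^+ 3 / 6) by apply: ler_pM => //; exact: sin_max.
have := sqr_ge0 u; lra.
Qed.

(** * The Fourier transform of a Gaussian truncated to [-pi, pi] *)

Section GaussFourier.
Variable R : realType.
Variable a : R.
Hypothesis a0 : 0 < a.
Let g (z : R) : R := expR (- (a * z ^+ 2)).
Definition gauss_cos (b : R) : R := Int (- pi) pi (fun z => g z * cos (b * z)).

Let pi0 : 0 < pi :> R := pi_gt0 R.

Let dg z : der_at g z (- (2 * a * z) * g z).
Proof. by apply: (der_eq (dcomp (dexp _) (dN (dM (dC a z) (dX 2 (dI z)))))); rewrite /g /=; ring. Qed.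
Let cg : continuous g. Proof. by move=> z; exact: derive_cont (dg z). Qed.
Let ccos b : continuous ((fun z => cos (b * z)) : R -> R).
Proof. by move=> z; exact: derive_cont (dcomp (dcos _) (dM (dC b z) (dI z))). Qed.
Let csin b : continuous ((fun z => sin (b * z)) : R -> R).
Proof. by move=> z; exact: derive_cont (dcomp (dsin _) (dM (dC b z) (dI z))). Qed.
Let cM (u v : R -> R) : continuous u -> continuous v -> continuous ((fun z => u z * v z) : R -> R).
Proof. by move=> cu cv z; apply: cvgM; [exact: cu | exact: cv]. Qed.
Let cI : continuous ((fun z => z) : R -> R). Proof. by move=> z; exact: cvg_id. Qed.
Let cC (k : R) : continuous ((fun=> k) : R -> R). Proof. by move=> z; exact: cvg_cst. Qed.

(** Differentiation under the integral sign gives - [S]; integration by parts relates [S] to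
    [gauss_cos b], with a boundary term because the integral is truncated. *)
Lemma dgauss_cos b : der_at gauss_cos b
  (- (b / (2 * a)) * gauss_cos b + expR (- (a * pi ^+ 2)) * sin (b * pi) / a).
Proof.
pose S := Int (- pi) pi (fun z => z * (g z * sin (b * z))).
have cS : continuous ((fun z => z * (g z * sin (b * z))) : R -> R) by exact: (cM cI (cM cg (@csin b))).
have cG c : continuous ((fun z => g z * cos (c * z)) : R -> R) by exact: (cM cg (@ccos c)).
have npp : - pi < pi :> R by have := pi_gt0 R; lra.
apply: (@der_eq _ _ _ (- S)).
  apply: (@der_of_quadratic _ _ _ _ (2 * pi ^+ 2 * (2 * pi))) => h h1.
  have -> : gauss_cos (b + h) - gauss_cos b - - S * h =
      Int (- pi) pi (fun z => (g z * cos ((b + h) * z) - g z * cos (b * z)) + h * (z * (g z * sin (b * z)))).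
    rewrite IntD ?IntB ?IntZ //; first by rewrite /gauss_cos -/S; ring.
    - by move=> z; apply: cvgB; exact: cG.
    - exact: (cM (@cC h) cS).
  have -> : 2 * pi ^+ 2 * (2 * pi) * h ^+ 2 = Int (- pi) pi (fun=> 2 * pi ^+ 2 * h ^+ 2).
    by rewrite Int_cst ?ltW //; ring.
  apply: Int_abs => //.
    by move=> z; apply: cvgD; [apply: cvgB; exact: cG | exact: (cM (@cC h) cS)].
  move=> z /andP[z1 z2].
  have -> : g z * cos ((b + h) * z) - g z * cos (b * z) + h * (z * (g z * sin (b * z)))
    = g z * (cos (b * z + h * z) - cos (b * z) + (h * z) * sin (b * z)) by rewrite -mulrDl; ring.
  have zp : `|z| <= pi by rewrite ler_norml z1.
  have hz : `|h * z| <= pi by rewrite normrM -[leRHS]mul1r; exact: ler_pM.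
  have hz4 : `|h * z| <= 4 by apply: (le_trans hz); exact: pi_le4.
  rewrite normrM; apply: (@le_trans _ _ (1 * (2 * (h * z) ^+ 2))).
    apply: ler_pM => //; last exact: cos_increment.
    rewrite ger0_norm ?expR_ge0 // /g -expR0 ler_expR oppr_le0 mulr_ge0 // ?sqr_ge0 //; exact: ltW.
  have z2pi : z ^+ 2 <= pi ^+ 2.
    by rewrite -(real_normK (num_real z)) lerXn2r // nnegrE // ltW.
  have := ler_wpM2l (sqr_ge0 h) z2pi; rewrite exprMn; lra.
have E : Int (- pi) pi (fun z => b * (g z * cos (b * z)) - 2 * a * (z * (g z * sin (b * z))))
   = 2 * expR (- (a * pi ^+ 2)) * sin (b * pi).
  rewrite (@Int_ftc _ _ _ _ (fun z => g z * sin (b * z)) npp).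
  - by rewrite /g sqrrN mulrN sinN; ring.
  - by move=> z; apply: cvgB; [exact: (cM (@cC b) (@cG b)) | exact: (cM (@cC _) cS)].
  - move=> z; apply: (der_eq (dM (dg z) (dcomp (dsin _) (dM (dC b z) (dI z))))); ring.
rewrite IntB ?IntZ // in E; last 2 first.
- exact: (cM (@cC b) (@cG b)).
- exact: (cM (@cC _) cS).
rewrite -/S -/(gauss_cos b) in E.
have -> : - S = (2 * a * - S) / (2 * a) by field; rewrite gt_eqF.
have -> : 2 * a * - S = 2 * expR (- (a * pi ^+ 2)) * sin (b * pi) - b * gauss_cos b by rewrite -E; ring.
by field; rewrite gt_eqF.
Qed.

Lemma gauss_cosN b : gauss_cos (- b) = gauss_cos b.
Proof. by apply: eq_Int => z _; rewrite mulNr cosN. Qed.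

(** The differential equation is solved with the integrating factor [e]. Bounding sin (z pi) by z pi
    makes the boundary term an exact derivative, whence an error uniform in b. *)
Lemma gauss_cos_decay b :
  `|gauss_cos b - expR (- (b ^+ 2 / (4 * a))) * gauss_cos 0| <= 2 * pi * expR (- (a * pi ^+ 2)).
Proof.
wlog b0 : b / 0 <= b.
  by move=> h; have [/h//|/ltW bn] := leP 0 b; have := h (- b); rewrite oppr_ge0 sqrrN gauss_cosN; exact.
pose e z := expR (z ^+ 2 / (4 * a)).
have de z : der_at e z (z / (2 * a) * e z).
  apply: (der_eq (dcomp (dexp _) (dM (dX 2 (dI z)) (dC _ z)))).
  by rewrite /e /=; field; rewrite gt_eqF.
have := @abs_increment R (fun z => gauss_cos z * e z) (fun z => 2 * pi * expR (- (a * pi ^+ 2)) * e z)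
  (fun z => e z * expR (- (a * pi ^+ 2)) * sin (z * pi) / a) (fun z => e z * expR (- (a * pi ^+ 2)) * (z * pi) / a) 0 b b0.
have e0 : e 0 = 1 by rewrite /e expr0n mul0r expR0.
rewrite e0 !mulr1 => h.
have {}h : `|gauss_cos b * e b - gauss_cos 0| <= 2 * pi * expR (- (a * pi ^+ 2)) * e b - 2 * pi * expR (- (a * pi ^+ 2)).
  apply: h => z /andP[z0 _].
  - by apply: (der_eq (dM (dgauss_cos z) (de z))); field; rewrite gt_eqF.
  - by apply: (der_eq (dM (dC _ z) (de z))); field; rewrite gt_eqF.
  - have k0 : 0 <= e z * expR (- (a * pi ^+ 2)) / a by rewrite divr_ge0 ?(ltW a0) // mulr_ge0 ?expR_ge0.
    have -> (s : R) : e z * expR (- (a * pi ^+ 2)) * s / a = (e z * expR (- (a * pi ^+ 2)) / a) * s by ring.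
    have -> (s : R) : e z * expR (- (a * pi ^+ 2)) * s / a = (e z * expR (- (a * pi ^+ 2)) / a) * s by ring.
    rewrite normrM (ger0_norm k0); apply: ler_wpM2l => //; apply: sin_abs_ge0.
    by rewrite mulr_ge0 // ltW.
have eb : 0 < e b by exact: expR_gt0.
have -> : expR (- (b ^+ 2 / (4 * a))) = (e b)^-1 by rewrite expRN.
rewrite -(ler_pM2r eb) -[X in _ * X <= _](gtr0_norm eb) -normrM mulrBl [_^-1 * _]mulrC divfK ?gt_eqF //.
apply: (le_trans h); have : 0 <= 2 * pi * expR (- (a * pi ^+ 2)); last lra.
by rewrite mulr_ge0 ?expR_ge0 // mulr_ge0 // ltW.
Qed.

Lemma gauss_cos0 : gauss_cos 0 = (Num.sqrt pi - 2 * gtail (Num.sqrt a * pi)) / Num.sqrt a.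
Proof.
by rewrite -Int_gauss //; apply: eq_Int => z _; rewrite mul0r cos0 mulr1.
Qed.

(** The constant 14 is 8 >= 2 pi for the boundary term plus 2 * 3 for the two missing tails of the
    integral at b = 0. *)
Lemma gauss_fourier b : 1 <= a ->
  `|gauss_cos b - Num.sqrt pi / Num.sqrt a * expR (- (b ^+ 2 / (4 * a)))| <= 14 * expR (- Num.sqrt a).
Proof.
move=> a1; have s1 : 1 <= Num.sqrt a by rewrite -[leLHS]sqrtr1 ler_wsqrtr.
have s0 : 0 < Num.sqrt a by lra.
have sa : Num.sqrt a ^+ 2 = a by rewrite sqr_sqrtr // ltW.
have p2 : 2 <= pi :> R by exact: pi_ge2.
have p4 := pi_le4 R.
have h1 := gauss_cos_decay b.
have e1 : expR (- (a * pi ^+ 2)) <= expR (- Num.sqrt a).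
  rewrite ler_expR lerN2; apply: (@le_trans _ _ a); first by rewrite -[leRHS]sa expr2 ler_peMr // ltW.
  by rewrite ler_peMr ?(ltW a0) // expr_ge1 //; lra.
have e2 : expR (- (Num.sqrt a * pi)) <= expR (- Num.sqrt a) by rewrite ler_expR lerN2; nra.
have g1 := gtail_le (Num.sqrt a * pi); have g0 := gtail_ge0 (Num.sqrt a * pi).
set G := gtail _ in g1 g0 *; set E := expR (- (b ^+ 2 / (4 * a))) in h1 *.
have E1 : E <= 1 by rewrite -expR0 ler_expR oppr_le0 divr_ge0 ?sqr_ge0 // mulr_ge0 // ltW.
have E0 : 0 <= E by exact: expR_ge0.
have h2 : `|E * gauss_cos 0 - Num.sqrt pi / Num.sqrt a * E| <= 2 * G.
  rewrite gauss_cos0 -/G.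
  have -> : E * ((Num.sqrt pi - 2 * G) / Num.sqrt a) - Num.sqrt pi / Num.sqrt a * E = - (E * (2 * G / Num.sqrt a)).
    by field; rewrite gt_eqF.
  have q0 : 0 <= 2 * G / Num.sqrt a by rewrite divr_ge0 ?mulr_ge0 // ltW.
  rewrite normrN ger0_norm ?mulr_ge0 //.
  apply: (@le_trans _ _ (1 * (2 * G / Num.sqrt a))); first exact: ler_wpM2r.
  by rewrite mul1r ler_pdivrMr // ler_peMr // mulr_ge0.
apply: le_trans (ler_distD (E * gauss_cos 0) _ _) _.
have Q := expR_gt0 (- Num.sqrt a : R).
have : 2 * pi * expR (- (a * pi ^+ 2)) <= 8 * expR (- Num.sqrt a).
  by apply: ler_pM; rewrite ?expR_ge0 //; lra.
lra.
Qed.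
End GaussFourier.

(** * Fourier inversion *)

Section Fourier.
Variable R : realType.
Variables N alpha beta : nat.
Local Notation eps := (@eps R N alpha beta).
Local Notation psi := (@psi R N alpha beta).
Local Notation prob := (@prob R N alpha beta).
Local Notation charprod := (@charprod R N alpha beta).
Local Notation msum := (@msum R N alpha beta).
Local Open Scope complex_scope.
Local Notation Re := complex.Re.

Definition ieps (k : nat) : int := (k == alpha %[mod N] : nat)%:Z - (k == beta %[mod N] : nat)%:Z.

Lemma epsE k : eps k = (ieps k)%:~R.
Proof. by rewrite /eps /ieps intrB. Qed.

(* A set [S] of indices stands for the partition with parts [k.+1], [k] in [S]. *)
Definition weight_sum n (S : {set 'I_n}) : nat := \sum_(k in S) k.+1.
Definition pd_sum n (S : {set 'I_n}) : int := \sum_(k in S) ieps k.+1.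

Variables (tau : R) (J : nat).
Local Notation n0 := (N * J)%N.

Definition set_prob (S : {set 'I_n0}) : R :=
  \prod_(k < n0) (if k \in S then prob tau k.+1 else 1 - prob tau k.+1).

(** The [lexp] terms do not depend on the set, so all sets of given weight and [pd] are equally
    likely and a point probability counts them. *)
Lemma set_probE S : set_prob S =
  expR (- msum tau J 0 0 (@lexp R) - tau ^+ 2 * (weight_sum S)%:R + tau * (pd_sum S)%:~R).
Proof.
have q x : 1 - ferm x = expR (- lexp x) :> R.
  by rewrite expRN exp_lexp -fermN /ferm.
have p x : ferm x = expR (- lexp x - x) :> R.
  by rewrite expRD -q expRN /ferm; field; rewrite !gt_eqF ?expR_gt0 // addr_gt0 // expR_gt0.
pose x k : R := k%:R * tau ^+ 2 - eps k * tau.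
have -> : set_prob S = \prod_(k < n0) expR (- lexp (x k.+1) - (if k \in S then x k.+1 else 0)).
  apply: eq_bigr => k _; case: ifP => _; rewrite /prob -/(x _); first exact: p.
  by rewrite q subr0.
rewrite -expR_sum; congr expR.
rewrite big_split /= !sumrN -big_mkcond /= -[RHS]addrA; congr (_ + _).
  by congr (- _); apply: eq_bigr => k _; rewrite !expr0 !mul1r.
rewrite /weight_sum /pd_sum /x sumrB opprB addrC; congr (_ + _).
  by rewrite -mulr_suml mulrC rmorph_sum /=; congr (_ * _); apply: eq_bigr => k _; rewrite epsE.
by rewrite -mulr_suml mulrC natr_sum.
Qed.

Lemma integrand_sum m phi theta : integrand N alpha beta tau J m phi theta =
  \sum_(S : {set 'I_n0}) set_prob S *
    cos (((weight_sum S)%:R - energy tau) * phi + ((pd_sum S)%:~R - m) * theta).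
Proof.
rewrite /integrand /charprod /bern.
under eq_bigr do rewrite addrC.
rewrite bigA_distr mulr_suml Re_sum; apply: eq_bigr => S _.
have -> : \prod_(k < n0) (if k \in S then (prob tau k.+1)%:C * expi (psi phi theta k.+1) else (1 - prob tau k.+1)%:C)
   = (set_prob S)%:C * expi (\sum_(k in S) psi phi theta k.+1).
  rewrite /set_prob (big_mkcond (fun k => k \in S)) /=.
  elim/big_rec3: _ => [|k y1 y2 y3 _ ->]; first by rewrite mul1r expiE cos0 sin0.
  have cM (u v : R) : (u * v)%:C = u%:C * v%:C by apply/eqP; rewrite eq_complex /= !mulr0 !mul0r subr0 addr0 !eqxx.
  by case: ifP => _; rewrite ?add0r ?expiD cM; [rewrite mulrACA | rewrite mulrA].
rewrite -mulrA -expiD expiE /= mul0r subr0; congr (_ * cos _).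
rewrite /psi big_split /= -!mulr_suml /weight_sum /pd_sum natr_sum rmorph_sum /=.
have -> : \sum_(i in S) eps i.+1 = \sum_(i in S) (ieps i.+1)%:~R by apply: eq_bigr => k _; rewrite epsE.
by ring.
Qed.

Lemma Int_cos (j : int) (b : R) :
  Int (- pi) pi (fun x => cos (j%:~R * x + b)) = if j == 0 then 2 * pi * cos b else 0.
Proof.
have p0 := pi_gt0 R; have npp : - pi < pi :> R by lra.
have [->|j0] := eqVneq j 0.
  under eq_Int do rewrite mul0r add0r.
  by rewrite Int_cst ?ltW //; ring.
have jn : j%:~R != 0 :> R by rewrite intr_eq0.
have cc : continuous ((fun x => cos (j%:~R * x + b)) : R -> R).
  by move=> x; exact: derive_cont (dcomp (dcos _) (dD (dM (dC _ x) (dI x)) (dC b x))).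
rewrite (@Int_ftc _ _ _ _ (fun x => sin (j%:~R * x + b) / j%:~R) npp cc); last first.
  move=> x; apply: (der_eq (dM (dcomp (dsin _) (dD (dM (dC _ x) (dI x)) (dC b x))) (dC _ x))).
  by field.
rewrite -mulrBl mulrN; suff -> : sin (j%:~R * pi + b) = sin (- (j%:~R * pi) + b) by rewrite subrr mul0r.
have sp (k : nat) : sin (k%:R * pi) = 0 :> R.
  elim: k => [|k IH]; first by rewrite mul0r sin0.
  by rewrite -natr1 mulrDl mul1r sinDpi IH oppr0.
have s0 : sin (j%:~R * pi) = 0 :> R.
  by case: j {j0 jn cc} => k; rewrite ?NegzE ?mulrNz ?mulNr ?sinN -?pmulrn sp ?oppr0.
by rewrite !sinD sinN cosN s0 oppr0.
Qed.

Lemma Int_phi (n : nat) (s : int) m theta : energy tau = n%:R -> s != 0 ->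
  continuous ((fun phi => integrand N alpha beta tau J m (s%:~R * phi) theta) : R -> R) /\
  Int (- pi) pi (fun phi => integrand N alpha beta tau J m (s%:~R * phi) theta) =
  \sum_(S : {set 'I_n0} | weight_sum S == n) 2 * pi * set_prob S * cos (((pd_sum S)%:~R - m) * theta).
Proof.
move=> en s0.
pose F (S : {set 'I_n0}) (phi : R) := set_prob S *
  cos ((((weight_sum S)%:Z - n%:Z) * s)%:~R * phi + ((pd_sum S)%:~R - m) * theta).
have cc (S : {set 'I_n0}) : continuous ((fun phi => cos ((((weight_sum S)%:Z - n%:Z) * s)%:~R * phi + ((pd_sum S)%:~R - m) * theta)) : R -> R).
  by move=> x; exact: derive_cont (dcomp (dcos _) (dD (dM (dC _ x) (dI x)) (dC _ x))).
have cF S : continuous (F S) by move=> x; apply: cvgM; [exact: cvg_cst | exact: (@cc S)].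
have -> : (fun phi => integrand N alpha beta tau J m (s%:~R * phi) theta) = (fun phi => \sum_(S : {set 'I_n0}) F S phi).
  apply/funext => phi; rewrite integrand_sum en; apply: eq_bigr => S _.
  by rewrite /F intrM intrB mulrA.
have [c ->] := @Int_sum R (- pi) pi _ (index_enum {set 'I_n0}) F cF.
split => //; rewrite [RHS]big_mkcond /=; apply: eq_bigr => S _.
rewrite IntZ; last exact: (@cc S).
rewrite Int_cos mulf_eq0 (negPf s0) orbF subr_eq0 eqz_nat; case: ifP => _; last by rewrite mulr0.
by ring.
Qed.

Lemma Int_theta (n : nat) (m : int) :
  let F theta := \sum_(S : {set 'I_n0} | weight_sum S == n)
    2 * pi * set_prob S * cos (((pd_sum S)%:~R - m%:~R) * theta) in
  continuous (F : R -> R) /\ Int (- pi) pi F = 4 * pi ^+ 2 *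
    (expR (- msum tau J 0 0 (@lexp R) - tau ^+ 2 * n%:R + tau * m%:~R) *
     #|[pred S : {set 'I_n0} | (weight_sum S == n) && (pd_sum S == m)]|%:R).
Proof.
move=> F.
pose G (S : {set 'I_n0}) (theta : R) := (if weight_sum S == n then 2 * pi * set_prob S else 0) * cos ((pd_sum S - m)%:~R * theta + 0).
have cc (S : {set 'I_n0}) : continuous ((fun theta => cos ((pd_sum S - m)%:~R * theta + 0)) : R -> R).
  by move=> x; exact: derive_cont (dcomp (dcos _) (dD (dM (dC _ x) (dI x)) (dC _ x))).
have cG S : continuous (G S) by move=> x; apply: cvgM; [exact: cvg_cst | exact: (@cc S)].
have -> : F = (fun theta => \sum_(S : {set 'I_n0}) G S theta).
  apply/funext => theta; rewrite /F big_mkcond; apply: eq_bigr => S _.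
  by rewrite /G intrB addr0; case: ifP => // _; rewrite mul0r.
have [c ->] := @Int_sum R (- pi) pi _ (index_enum {set 'I_n0}) G cG.
split => //; rewrite -sum1_card natr_sum [in RHS]big_mkcond /= !mulr_sumr; apply: eq_bigr => S _.
rewrite IntZ; last exact: (@cc S).
rewrite Int_cos subr_eq0 inE; have [e1|_] := eqVneq (weight_sum S) n; have [e2|_] := eqVneq (pd_sum S) m;
  rewrite ?mulr0 ?mul0r //= cos0 set_probE e1 e2; ring.
Qed.
End Fourier.

(** * The local limit theorem *)

Section LocalLimit.
Variable R : realType.
Variables N alpha beta : nat.
Hypothesis (hN : N = 2%N \/ (5 <= N)%N).
Hypotheses (halpha : (1 <= alpha <= N)%N) (hbeta : (1 <= beta <= N)%N).
Hypothesis (hab : alpha <> beta).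
Local Notation quad := (@quad R N).
Local Notation mean := (@mean R N alpha beta).
Local Notation integrand := (@integrand R N alpha beta).
Local Notation msum := (@msum R N alpha beta).

(* The partitions of [n] into distinct parts at most [n0] with [pd = m]. *)
Definition set_count n0 n (m : int) : nat :=
  #|[pred S : {set 'I_n0} | (weight_sum S == n) && (pd_sum N alpha beta S == m)]|.

Lemma exp_inv_le (k : R) : 0 < k -> exists2 C : R, 0 < C &
  forall tau, 0 < tau -> expR (- (k / tau)) <= C * tau ^+ 6.
Proof.
move=> k0; have := fun x => @exprn_le_expR R 6 x.
have : 0 < 6`!%:R :> R by rewrite ltr0n fact_gt0.
move: (6`!%:R : R) => f f0 hexp; exists (f / k ^+ 6); first by rewrite divr_gt0 // exprn_gt0.
move=> tau t0; have u0 : 0 <= k / tau by rewrite divr_ge0 // ltW.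
have := hexp _ u0; rewrite expRN => h.
have e0 := expR_gt0 (k / tau).
rewrite -[leLHS]div1r ler_pdivrMr //.
have -> : f / k ^+ 6 * tau ^+ 6 * expR (k / tau) = (f * expR (k / tau)) / (k / tau) ^+ 6.
  by field; rewrite !gt_eqF.
by rewrite ler_pdivlMr ?mul1r // exprn_gt0 // divr_gt0.
Qed.

Lemma sqrt_pi_le2 : Num.sqrt pi <= 2 :> R.
Proof.
have e : Num.sqrt (2 ^+ 2) = 2 :> R by rewrite sqrtr_sqr ger0_norm.
by rewrite -e ler_wsqrtr //; have := pi_le4 R; lra.
Qed.

Lemma gauss_cos0_le (a : R) : 0 < a -> gauss_cos a 0 <= 2 / Num.sqrt a.
Proof.
move=> a0; rewrite gauss_cos0 //; apply: ler_wpM2r; first by rewrite invr_ge0 sqrtr_ge0.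
have s4 := sqrt_pi_le2.
have := gtail_ge0 (Num.sqrt a * pi); lra.
Qed.

Lemma gauss_cos0_ge0 (a : R) : 0 <= gauss_cos a 0.
Proof. by apply: Rintegral_ge0 => z _; rewrite mul0r cos0 mulr1 expR_ge0. Qed.

Lemma cgauss (a : R) : continuous ((fun z => expR (- (a * z ^+ 2))) : R -> R).
Proof. by move=> z; exact: derive_cont (dcomp (dexp _) (dN (dM (dC a z) (dX 2 (dI z))))). Qed.

Lemma ccosb (b : R) : continuous ((fun z => cos (b * z)) : R -> R).
Proof. by move=> z; exact: derive_cont (dcomp (dcos _) (dM (dC b z) (dI z))). Qed.

Lemma cmul (u v : R -> R) : continuous u -> continuous v -> continuous ((fun z => u z * v z) : R -> R).
Proof. by move=> cu cv z; apply: cvgM; [exact: cu | exact: cv]. Qed.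

Lemma cadd (u v : R -> R) : continuous u -> continuous v -> continuous ((fun z => u z + v z) : R -> R).
Proof. by move=> cu cv z; apply: cvgD; [exact: cu | exact: cv]. Qed.

Lemma csub (u v : R -> R) : continuous u -> continuous v -> continuous ((fun z => u z - v z) : R -> R).
Proof. by move=> cu cv z; apply: cvgB; [exact: cu | exact: cv]. Qed.

Lemma ccst (k : R) : continuous ((fun=> k) : R -> R).
Proof. by move=> z; exact: cvg_cst. Qed.

Lemma gauss_cos0E (a : R) : Int (- pi) pi (fun z => expR (- (a * z ^+ 2))) = gauss_cos a 0.
Proof. by apply: eq_Int => z _; rewrite mul0r cos0 mulr1. Qed.

(** [pointwise_bound] is integrated over the square, first in phi. Symmetrization doubles both
    sides. In the constant, 4 / c comes from the two Gaussian integrals and 64 bounds the area 4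
    pi^2 of the square. *)
Lemma fourier_error : exists K tau0 B : R, [/\ 0 < K, 0 < tau0 & forall tau J n (m : int),
  large_enough N tau J -> B <= N%:R * tau ^+ 2 * J%:R -> tau <= tau0 -> energy tau = n%:R ->
  `|4 * pi ^+ 2 * (expR (- msum tau J 0 0 (@lexp R) - tau ^+ 2 * n%:R + tau * m%:~R) *
      (set_count (N * J) n m)%:R)
    - gauss_cos (cdilog R / tau ^+ 6) 0 * gauss_cos ((2 * N%:R)^-1 / tau ^+ 2) (mean tau - m%:~R)|
  <= K * tau ^+ 6].
Proof.
have [c [K [tau0 [B [c0 K0 t00 hpt]]]]] := pointwise_bound R hN halpha hbeta hab.
have p16 : pi ^+ 2 <= 16 :> R by have := pi_le4 R; have := pi_ge0 R; nra.
have npp : - pi <= pi :> R by have := pi_gt0 R; lra.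
have pp : pi - - pi = 2 * pi :> R by ring.
exists (K * (4 / c + 64)), tau0, B; split => //.
  by rewrite mulr_gt0 // addr_gt0 // divr_gt0.
move=> tau J n m large sJ tt0 en.
have [[/andP[t0 t1] _ _] _ _] := large.
have T60 : 0 < tau ^+ 6 by rewrite exprn_gt0.
have nn : tau != 0 by rewrite gt_eqF.
set a1 := cdilog R / tau ^+ 6; set a2 := (2 * N%:R)^-1 / tau ^+ 2; set b := mean tau - m%:~R.
have [cF IF] := Int_theta N alpha beta tau J n m.
set F := (fun theta => _) in cF IF.
have e1 : (1 : int) != 0 by []. have e2 : (- 1 : int) != 0 by [].
have N0 : N%:R != 0 :> R by rewrite pnatr_eq0 -lt0n; case/andP: halpha; exact: leq_trans.
have step theta : - pi <= theta <= pi ->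
    `|2 * F theta - 2 * gauss_cos a1 0 * (expR (- (a2 * theta ^+ 2)) * cos (b * theta))| <=
    K * (tau ^+ 2 * gauss_cos (c / tau ^+ 6) 0 * expR (- (c / tau ^+ 2 * theta ^+ 2)) + 2 * pi * tau ^+ 6).
  move=> ht.
  have [c1 I1] := Int_phi N alpha beta J m%:~R theta en e1.
  have [c2 I2] := Int_phi N alpha beta J m%:~R theta en e2.
  rewrite -/(F theta) in I1 I2.
  set k := expR (- (a2 * theta ^+ 2)) * cos (b * theta).
  have -> : 2 * F theta - 2 * gauss_cos a1 0 * k = Int (- pi) pi (fun phi =>
     (integrand tau J m%:~R (1%:~R * phi) theta + integrand tau J m%:~R ((-1)%:~R * phi) theta) - 2 * k * expR (- (a1 * phi ^+ 2))).
    rewrite IntB; [|exact: (cadd c1 c2)|exact: (cmul (@ccst _) (@cgauss _))].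
    rewrite IntD // IntZ; last exact: cgauss.
    by rewrite I1 I2 gauss_cos0E -/(F theta); ring.
  set h := tau ^+ 2 * expR (- (c / tau ^+ 2 * theta ^+ 2)).
  have -> : K * (tau ^+ 2 * gauss_cos (c / tau ^+ 6) 0 * expR (- (c / tau ^+ 2 * theta ^+ 2)) + 2 * pi * tau ^+ 6)
     = Int (- pi) pi (fun phi => K * (h * expR (- (c / tau ^+ 6 * phi ^+ 2)) + tau ^+ 6)).
    rewrite IntZ; last exact: (cadd (cmul (@ccst _) (@cgauss _)) (@ccst _)).
    rewrite IntD; [|exact: (cmul (@ccst _) (@cgauss _))|exact: ccst].
    by rewrite IntZ ?Int_cst // ?gauss_cos0E ?pp /h; [ring | exact: cgauss].
  apply: Int_abs.
  - exact: (csub (cadd c1 c2) (cmul (@ccst _) (@cgauss _))).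
  - exact: (cmul (@ccst _) (cadd (cmul (@ccst _) (@cgauss _)) (@ccst _))).
  move=> phi hp; have := hpt tau J large sJ tt0 m%:~R phi theta.
  rewrite !ler_norml => /(_ hp ht).
  have -> : expR (- quad (phi / tau ^+ 3) (theta / tau)) * cos (theta * (mean tau - m%:~R)) = k * expR (- (a1 * phi ^+ 2)).
    rewrite /k mulrAC -expRD /b [_ * theta]mulrC; congr (expR _ * _).
    by rewrite /quad /a1 /a2; field; rewrite nn N0.
  have -> : tau ^+ 2 * expR (- (c * ((phi / tau ^+ 3) ^+ 2 + (theta / tau) ^+ 2))) = h * expR (- (c / tau ^+ 6 * phi ^+ 2)).
    by rewrite /h -mulrA -expRD; congr (_ * expR _); field.
  by rewrite mul1r mulN1r !mulrA.
have := @Int_abs R (- pi) pi _ _ (csub (cmul (@ccst 2) cF) (cmul (@ccst (2 * gauss_cos a1 0)) (cmul (@cgauss a2) (@ccosb b))))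
   (cmul (@ccst K) (cadd (cmul (@ccst (tau ^+ 2 * gauss_cos (c / tau ^+ 6) 0)) (@cgauss (c / tau ^+ 2))) (@ccst (2 * pi * tau ^+ 6)))) step.
rewrite IntB; [|exact: (cmul (@ccst 2) cF)|exact: (cmul (@ccst (2 * gauss_cos a1 0)) (cmul (@cgauss a2) (@ccosb b)))].
rewrite IntZ // IF IntZ; last exact: (cmul (@cgauss a2) (@ccosb b)).
rewrite -/(gauss_cos a2 b).
rewrite IntZ; last exact: (cadd (cmul (@ccst _) (@cgauss _)) (@ccst _)).
rewrite IntD; [|exact: (cmul (@ccst _) (@cgauss _))|exact: ccst].
rewrite IntZ ?Int_cst // ?gauss_cos0E ?pp; last exact: cgauss.
rewrite -/(set_count _ _ _); set w := expR _ * _; set G2 := gauss_cos a2 b; set G1 := gauss_cos a1 0.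
have -> : 2 * (4 * pi ^+ 2 * w) - 2 * G1 * G2 = 2 * (4 * pi ^+ 2 * w - G1 * G2) by ring.
rewrite normrM (@ger0_norm _ 2) // => h.
have i1 := gauss_cos0_ge0 (c / tau ^+ 2); have i2 := gauss_cos0_ge0 (c / tau ^+ 6).
have ca : 0 < Num.sqrt c by rewrite sqrtr_gt0.
have sc : Num.sqrt c ^+ 2 = c by rewrite sqr_sqrtr // ltW.
have u1 : gauss_cos (c / tau ^+ 2) 0 <= 2 * tau / Num.sqrt c.
  apply: (le_trans (gauss_cos0_le _)); first by rewrite divr_gt0 // exprn_gt0.
  rewrite sqrtrM ?(ltW c0) // sqrtrV ?sqr_ge0 // sqrtr_sqr gtr0_norm //.
  by rewrite le_eqVlt; apply/orP; left; apply/eqP; field; rewrite nn gt_eqF.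
have u2 : gauss_cos (c / tau ^+ 6) 0 <= 2 * tau ^+ 3 / Num.sqrt c.
  apply: (le_trans (gauss_cos0_le _)); first by rewrite divr_gt0.
  rewrite sqrtrM ?(ltW c0) // sqrtrV ?(ltW T60) // (_ : tau ^+ 6 = (tau ^+ 3) ^+ 2); last by rewrite -exprM.
  rewrite sqrtr_sqr gtr0_norm ?exprn_gt0 //.
  by rewrite le_eqVlt; apply/orP; left; apply/eqP; field; rewrite nn gt_eqF.
have u3 : gauss_cos (c / tau ^+ 2) 0 * gauss_cos (c / tau ^+ 6) 0 <= 4 * tau ^+ 4 / c.
  apply: le_trans (ler_pM i1 i2 u1 u2) _; rewrite -[in leRHS]sc.
  by rewrite le_eqVlt; apply/orP; left; apply/eqP; field; rewrite gt_eqF.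
have u4 : tau ^+ 2 * (gauss_cos (c / tau ^+ 2) 0 * gauss_cos (c / tau ^+ 6) 0) <= 4 / c * tau ^+ 6.
  apply: (le_trans (ler_wpM2l (sqr_ge0 _) u3)).
  by rewrite le_eqVlt; apply/orP; left; apply/eqP; field; rewrite gt_eqF.
have u5 := ler_wpM2r (ltW T60) p16.
have u6 : 0 < 4 / c * tau ^+ 6 by rewrite mulr_gt0 // divr_gt0.
have {}h := le_trans h (_ : _ <= K * ((4 / c + 64) * tau ^+ 6)).
have : 2 * `|4 * pi ^+ 2 * w - G1 * G2| <= K * ((4 / c + 64) * tau ^+ 6).
  apply: h; apply: ler_wpM2l; first exact: ltW.
  rewrite [leRHS]mulrDl; apply: lerD; first by rewrite mulrAC -mulrA.
  have -> : 2 * pi * tau ^+ 6 * (2 * pi) = 4 * (pi ^+ 2 * tau ^+ 6) by ring.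
  have -> : 64 * tau ^+ 6 = 4 * (16 * tau ^+ 6) by ring.
  exact: ler_wpM2l.
move=> h'; rewrite -[leRHS]mulrA; apply: le_trans h'; rewrite ler_peMl ?normr_ge0 //.
exact: ler1n.
Qed.

(** [gauss_fourier] replaces both truncated transforms by full ones. The errors are exponentially
    small in 1 / tau; bounding them by tau^6 is enough. *)
Lemma local_limit : exists K tau0 B : R, [/\ 0 < K, 0 < tau0 & forall tau J n (m : int),
  large_enough N tau J -> B <= N%:R * tau ^+ 2 * J%:R -> tau <= tau0 -> energy tau = n%:R ->
  `|4 * pi ^+ 2 * (expR (- msum tau J 0 0 (@lexp R) - tau ^+ 2 * n%:R + tau * m%:~R) *
      (set_count (N * J) n m)%:R)
    - pi / (Num.sqrt (cdilog R) * Num.sqrt ((2 * N%:R)^-1)) * tau ^+ 4 *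
        expR (- (N%:R * tau ^+ 2 / 2 * (mean tau - m%:~R) ^+ 2))|
  <= K * tau ^+ 6].
Proof.
have [K [tau0 [B [K0 t00 herr]]]] := fourier_error.
have N0 : 0 < N%:R :> R by rewrite ltr0n; case/andP: halpha; exact: leq_trans.
have cd0 : 0 < cdilog R by rewrite /cdilog divr_gt0 // exprn_gt0 // pi_gt0.
have n20 : 0 < (2 * N%:R)^-1 :> R by rewrite invr_gt0 mulr_gt0.
have c1 : 1 / 3 <= cdilog R.
  by rewrite /cdilog ler_pdivlMr //; have := pi_ge2 R; nra.
set k1 := Num.sqrt (cdilog R); set k2 := Num.sqrt ((2 * N%:R)^-1).
have k10 : 0 < k1 by rewrite sqrtr_gt0.
have k20 : 0 < k2 by rewrite sqrtr_gt0.
have [C1 C10 hC1] := exp_inv_le k10; have [C2 C20 hC2] := exp_inv_le k20.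
(* 28 is 2 * 14, as each Gaussian factor is at most 2. The condition tau <= 1/2 ensures a >= 1 in
   the first use of [gauss_fourier]. *)
exists (K + 28 * (C1 + C2)), (Num.min tau0 (1 / 2)), B; split.
- by rewrite addr_gt0 // mulr_gt0 // addr_gt0.
- by rewrite lt_min t00 divr_gt0.
move=> tau J n m large sJ; rewrite le_min => /andP[tt0 t12] en.
have [[/andP[t0 t1] _ _] N4 _] := large.
have T60 : 0 < tau ^+ 6 by rewrite exprn_gt0.
have T20 : 0 < tau ^+ 2 by rewrite exprn_gt0.
have nn : tau != 0 by rewrite gt_eqF.
have := herr tau J n m large sJ tt0 en.
set w := 4 * pi ^+ 2 * _; set a1 := cdilog R / tau ^+ 6; set a2 := (2 * N%:R)^-1 / tau ^+ 2; set b := mean tau - m%:~R => h.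
have a10 : 0 < a1 by rewrite divr_gt0.
have a20 : 0 < a2 by rewrite divr_gt0.
have a11 : 1 <= a1.
  rewrite ler_pdivlMr // mul1r; apply: le_trans c1; apply: (@le_trans _ _ ((1 / 2) ^+ 6)).
    by rewrite lerXn2r // nnegrE ?ltW // divr_gt0.
  by rewrite !exprS expr0; lra.
have a21 : 1 <= a2.
  by rewrite ler_pdivlMr // mul1r -[leRHS]mulr1 ler_pdivlMl ?mulr_gt0 // -mulrA; lra.
have s1 : Num.sqrt a1 = k1 / tau ^+ 3.
  rewrite sqrtrM ?(ltW cd0) // sqrtrV ?(ltW T60) // (_ : tau ^+ 6 = (tau ^+ 3) ^+ 2); last by rewrite -exprM.
  by rewrite sqrtr_sqr gtr0_norm // exprn_gt0.
have s2 : Num.sqrt a2 = k2 / tau.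
  by rewrite sqrtrM ?(ltW n20) // (sqrtrV (ltW T20)) sqrtr_sqr gtr0_norm.
have f1 := gauss_fourier a10 0 a11; have f2 := gauss_fourier a20 b a21.
rewrite expr0n mul0r oppr0 expR0 mulr1 in f1.
have E4 : b ^+ 2 / (4 * a2) = N%:R * tau ^+ 2 / 2 * b ^+ 2 by rewrite /a2; field; rewrite nn gt_eqF.
rewrite E4 in f2; set E := expR _ in f2 *.
have e1 : expR (- Num.sqrt a1) <= C1 * tau ^+ 6.
  apply: le_trans (hC1 _ t0); rewrite s1 ler_expR lerN2; apply: ler_wpM2l; first exact: ltW.
  by rewrite lef_pV2 ?posrE ?exprn_gt0 // -[leRHS]expr1; apply: ler_wiXn2l => //; exact: ltW.
have e2 : expR (- Num.sqrt a2) <= C2 * tau ^+ 6 by rewrite s2; exact: hC2.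
have q1 : 1 <= Num.sqrt a1 by rewrite -[leLHS]sqrtr1 ler_wsqrtr.
have q2 : 1 <= Num.sqrt a2 by rewrite -[leLHS]sqrtr1 ler_wsqrtr.
have G1 : gauss_cos a1 0 <= 2.
  by apply: (le_trans (gauss_cos0_le a10)); rewrite ler_pdivrMr ?sqrtr_gt0 // ler_peMr.
have G10 := gauss_cos0_ge0 a1.
have E0 : 0 <= E by exact: expR_ge0.
have E1 : E <= 1.
  by rewrite -expR0 ler_expR oppr_le0 mulr_ge0 ?sqr_ge0 // divr_ge0 // mulr_ge0 ?sqr_ge0 // ltW.
have g20 : 0 <= Num.sqrt pi / Num.sqrt a2 * E by rewrite mulr_ge0 // divr_ge0 ?sqrtr_ge0.
have g2 : Num.sqrt pi / Num.sqrt a2 * E <= 2.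
  have h0 : 0 <= Num.sqrt pi / Num.sqrt a2 by rewrite divr_ge0 ?sqrtr_ge0.
  apply: (le_trans (ler_piMr h0 E1)); rewrite ler_pdivrMr ?sqrtr_gt0 //.
  by apply: (le_trans sqrt_pi_le2); rewrite ler_peMr.
have -> : pi / (k1 * k2) * tau ^+ 4 * E = Num.sqrt pi / Num.sqrt a1 * (Num.sqrt pi / Num.sqrt a2 * E).
  rewrite -[in LHS](sqr_sqrtr (pi_ge0 R)) s1 s2; field.
  by rewrite nn !gt_eqF.
set x1 := gauss_cos a1 0 in h f1 G1 G10; set x2 := gauss_cos a2 b in h f2.
set y1 := Num.sqrt pi / Num.sqrt a1 in f1 *; set y2 := _ * E in f2 g20 g2 *.
have -> : w - y1 * y2 = (w - x1 * x2) + (x1 * (x2 - y2) + y2 * (x1 - y1)) by ring.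
have p1 : `|x1 * (x2 - y2)| <= 2 * (14 * (C2 * tau ^+ 6)).
  rewrite normrM (ger0_norm G10); apply: ler_pM => //; apply: (le_trans f2); exact: ler_wpM2l.
have p2 : `|y2 * (x1 - y1)| <= 2 * (14 * (C1 * tau ^+ 6)).
  rewrite normrM (ger0_norm g20); apply: ler_pM => //; apply: (le_trans f1); exact: ler_wpM2l.
apply: (le_trans (ler_normD _ _)).
have -> : (K + 28 * (C1 + C2)) * tau ^+ 6 = K * tau ^+ 6 + (2 * (14 * (C2 * tau ^+ 6)) + 2 * (14 * (C1 * tau ^+ 6))) by ring.
apply: lerD => //; apply: (le_trans (ler_normD _ _)); exact: lerD.
Qed.
End LocalLimit.

(** * Summation of the local limit theorem *)

Section GaussSum.
Variable R : realType.

Lemma exp_small (s x e : R) : 0 < s -> 0 < e -> exists L0 : nat, forall L : nat, (L0 <= L)%N ->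
  expR (- (x + s * L%:R)) <= e.
Proof.
move=> s0 e0; exists (Num.truncn ((e^-1 + `|x|) / s)).+1 => L hL.
have q0 : 0 <= (e^-1 + `|x|) / s by rewrite divr_ge0 ?addr_ge0 ?invr_ge0 // ltW.
have /andP[_ h1] := truncn_itv q0.
have hL' : (Num.truncn ((e^-1 + `|x|) / s)).+1%:R <= L%:R :> R by rewrite ler_nat.
have := lt_le_trans h1 hL'; rewrite ltr_pdivrMr // => h2.
have h3 : e^-1 <= x + s * L%:R by have := ler_norm (- x); rewrite normrN; lra.
have h4 := expR_ge1Dx (x + s * L%:R).
rewrite expRN -[e]invrK lef_pV2 ?posrE ?invr_gt0 ?expR_gt0 //; lra.
Qed.

(* Euler-Maclaurin for the Gaussian, followed by a Taylor expansion at [y]. *)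
Lemma gauss_sum (X : R) : 0 <= X -> exists2 K : R, 0 < K & forall s y delta,
  0 < s <= 1 -> `|y| <= X -> `|delta| <= 2 * s -> exists L0 : nat, forall L : nat, (L0 <= L)%N ->
  `|s * \sum_(i < L) gauss_fun (y + delta + s * i%:R) - (gtail y + (s / 2 - delta) * gauss_fun y)|
    <= K * s ^+ 2.
Proof.
(* 24 is 8 * 3: |4 z^2 - 2| <= 8 e^{z^2/2}, and completing the square costs e <= 3. The starting
   point is above - (X + 2). *)
move=> X0; pose C : R := 24 * expR (X + 2).
have C0 : 0 < C by rewrite mulr_gt0 ?expR_gt0.
exists (4 * C + 24); first by apply: addr_gt0; [exact: mulr_gt0 | exact: ltr0Sn].
move=> s y delta s01 hy hd; have /andP[s0 s1] := s01.
have s20 : 0 < s ^+ 2 by rewrite exprn_gt0.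
(* From this length on, the values of [gtail] and of the Gaussian at the upper end are within the
   error. *)
have [L0 hL0] := exp_small (y + delta) s0 s20.
exists L0 => L /hL0 hL.
set x0 := y + delta in hL *.
have hx0 : - (X + 2) <= x0.
  by move: hy hd; rewrite !ler_norml /x0 => /andP[? _] /andP[? _]; lra.
pose g := @gauss_fun R.
have dd (z : R) : der_at (fun z => - 2 * z * gauss_fun z) z ((4 * z ^+ 2 - 2) * gauss_fun z).
  by apply: (der_eq (dM (dM (dC (-2) z) (dI z)) (dgauss z))); ring.
have := @euler_maclaurin2 R (fun x => - gtail (x0 + x)) (fun x => g (x0 + x))
  (fun x => - 2 * (x0 + x) * g (x0 + x)) (fun x => (4 * (x0 + x) ^+ 2 - 2) * g (x0 + x)) C s 0 L s01.
rewrite lexx ler01 => /(_ isT) EM.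
have {}EM : `|s * \sum_(j < L) g (x0 + s * (j%:R + 0)) - (- gtail (x0 + s * L%:R) - - gtail (x0 + 0)) - s * (1 / 2 - 0) * (g (x0 + 0) - g (x0 + s * L%:R))| <= 4 * C * s ^+ 2.
  apply: EM => x x_ge0.
  - by apply: (@der_shift R (fun u => - gtail u)); apply: (der_eq (dN (dgtail _))); exact: opprK.
  - by apply: (@der_shift R g); exact: dgauss.
  - by apply: (@der_shift R (fun z => - 2 * z * g z) x0 x); exact: dd.
  - set z := x0 + x; rewrite normrM (ger0_norm (gauss_fun_ge0 _)).
    have h1 : `|4 * z ^+ 2 - 2| <= 8 * expR (z ^+ 2 / 2).
      have := expR_ge1Dx (z ^+ 2 / 2); have := sqr_ge0 z; rewrite ler_norml; lra.
    apply: (@le_trans _ _ (8 * expR (z ^+ 2 / 2) * gauss_fun z)).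
      by apply: ler_wpM2r => //; exact: gauss_fun_ge0.
    rewrite /gauss_fun -mulrA -expRD.
    have h2 : expR (z ^+ 2 / 2 + - z ^+ 2) <= expR 1 * (expR (X + 2) * expR (- x / 2)).
      by rewrite -!expRD ler_expR; have := sqr_ge0 (z - 1 / 2); rewrite /z; nra.
    have h3 : expR 1 * (expR (X + 2) * expR (- x / 2)) <= 3 * (expR (X + 2) * expR (- x / 2)).
      by apply: ler_wpM2r; [rewrite mulr_ge0 ?expR_ge0 | exact: exp1_le3].
    rewrite /C; lra.
rewrite addr0 subr0 in EM.
have eS : \sum_(j < L) g (x0 + s * (j%:R + 0)) = \sum_(j < L) g (x0 + s * j%:R).
  by apply: eq_bigr => j _; rewrite addr0.
rewrite eS in EM.
have h1 : 0 <= gtail (x0 + s * L%:R) <= 3 * s ^+ 2.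
  by rewrite gtail_ge0 (le_trans (gtail_le _)) // ler_wpM2l.
have h2 : 0 <= g (x0 + s * L%:R) <= 3 * s ^+ 2.
  by rewrite gauss_fun_ge0 (le_trans (gauss_le_exp _)) // ler_wpM2l.
have h3 := gtail_taylor y delta; have h4 := gauss_lip y (y + delta).
rewrite addrAC subrr add0r in h4.
have d2 : delta ^+ 2 <= 4 * s ^+ 2.
  have e : 4 * s ^+ 2 = (2 * s) ^+ 2 by ring.
  rewrite -(real_normK (num_real delta)) e lerXn2r // nnegrE mulr_ge0 //; exact: ltW.
have sd : s * `|g x0 - g y| <= 2 * s ^+ 2.
  by rewrite expr2 mulrCA; apply: ler_wpM2l; [exact: ltW | exact: le_trans h4 hd].
have sg : s * g (x0 + s * L%:R) <= 3 * s ^+ 2.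
  case/andP: h2 => h20 h21; apply: le_trans h21; rewrite ler_piMl //.
have sg0 : 0 <= s * g (x0 + s * L%:R) by apply: mulr_ge0; [exact: ltW | case/andP: h2].
rewrite -/x0 in h3; rewrite -/g in h3 sd *.
set Sg := \sum_(_ < _) _ in EM *.
have -> : s * Sg - (gtail y + (s / 2 - delta) * g y) =
  (s * Sg - (- gtail (x0 + s * L%:R) - - gtail x0) - s * (1 / 2) * (g x0 - g (x0 + s * L%:R)))
  + (gtail x0 - gtail y - - g y * delta) + (s * (g x0 - g y)) / 2 - gtail (x0 + s * L%:R) - s * g (x0 + s * L%:R) / 2 by field.
have sd' : `|s * (g x0 - g y)| <= 2 * s ^+ 2 by rewrite normrM gtr0_norm.
move: EM h3 sd' h1; clear - d2 sg sg0 s20; rewrite !ler_norml => /andP[? ?] /andP[? ?] /andP[? ?] /andP[? ?].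
apply/andP; split; lra.
Qed.

Lemma exp_sum_bound (tau : R) L : 0 < tau <= 1 / 2 -> \sum_(i < L) expR (- (tau * i%:R)) <= 2 / tau.
Proof.
move=> /andP[t0 t1]; have := @geometric_decay R (2 * tau) L.
have h : 0 < 2 * tau <= 1 by apply/andP; split; lra.
move=> /(_ h).
rewrite (eq_bigr (fun i : 'I_L => expR (- (tau * i%:R)))); last by move=> i _; congr expR; field.
by rewrite ler_pdivlMr //; lra.
Qed.
End GaussSum.

(** * Removing the tilt, and summation over m *)

Section CountTail.
Variable R : realType.
Variables N alpha beta : nat.
Hypothesis (hN : N = 2%N \/ (5 <= N)%N).
Hypotheses (halpha : (1 <= alpha <= N)%N) (hbeta : (1 <= beta <= N)%N).
Hypothesis (hab : alpha <> beta).
Local Notation mean := (@mean R N alpha beta).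
Local Notation mu0 := (@mu0 R N alpha beta).
Local Notation msum := (@msum R N alpha beta).

(** The partition function times e^{n tau^2}, without the terms depending on N, alpha and beta. As
    tau^4 = [cdilog] / n, it equals e^{pi sqrt (n/3)} / sqrt 2. *)
Definition gsize (tau : R) : R := expR (2 * cdilog R / tau ^+ 2 - ln 2 / 2).
Definition gcoef : R := (4 * pi * Num.sqrt (cdilog R) * Num.sqrt ((2 * N%:R)^-1))^-1.

Let N0 : 0 < N%:R :> R.
Proof. by rewrite ltr0n; case/andP: halpha; exact: leq_trans. Qed.

Lemma mu0_abs : `|mu0| <= 1 / 2.
Proof.
rewrite /mu0 normrM normfV ler_pdivrMr ?normr_gt0 ?mulf_neq0 ?gt_eqF //.
rewrite (_ : `|2 * N%:R| = 2 * N%:R); last by rewrite ger0_norm // mulr_ge0.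
have a1 : alpha%:R <= N%:R :> R by rewrite ler_nat; case/andP: halpha.
have b1 : beta%:R <= N%:R :> R by rewrite ler_nat; case/andP: hbeta.
by have := ler0n R alpha; have := ler0n R beta; rewrite ler_norml; lra.
Qed.

(** Undoing the tilt multiplies the Gaussian centred at [mean tau] by e^{-tau m}. The terms (2
    N)^{-1} and tau * [mu0] of the partition function are what completes the square, and the new
    centre is [mu0]; this is [PE]. The error has no Gaussian factor and keeps e^{-tau m}. *)
Lemma count_estimate : exists K tau0 B : R, [/\ 0 < K, 0 < tau0 & forall tau J n (m : int),
  large_enough N tau J -> B <= N%:R * tau ^+ 2 * J%:R -> tau <= tau0 -> energy tau = n%:R ->
  `|(set_count N alpha beta (N * J) n m)%:R
    - gsize tau * (gcoef * tau ^+ 4 * expR (- (N%:R * tau ^+ 2 / 2 * (m%:~R - mu0) ^+ 2)))|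
  <= gsize tau * (K * tau ^+ 6 * expR (- (tau * m%:~R)))].
Proof.
have [K [tau1 [B [K0 t10 hloc]]]] := local_limit R hN halpha hbeta hab.
have hN2 : (2 <= N)%N by case: hN => [->|] //; exact: leq_trans.
have [K2 K21 hmom] := moment_bounds R hN2 halpha hbeta hab.
have cd0 : 0 < cdilog R by rewrite /cdilog divr_gt0 // exprn_gt0 // pi_gt0.
have n20 : 0 < (2 * N%:R)^-1 :> R by rewrite invr_gt0 mulr_gt0.
have n21 : (2 * N%:R)^-1 <= 1 / 2 :> R.
  by rewrite div1r lef_pV2 ?posrE ?mulr_gt0 // ler_peMr // ler1n; case/andP: halpha; exact: leq_trans.
move: hloc; set k1 := Num.sqrt (cdilog R); set k2 := Num.sqrt ((2 * N%:R)^-1) => hloc.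
have k10 : 0 < k1 by rewrite sqrtr_gt0.
have k20 : 0 < k2 by rewrite sqrtr_gt0.
set kap := pi / (k1 * k2) in hloc.
have p0 := pi_gt0 R.
have kap0 : 0 < kap by rewrite divr_gt0 // mulr_gt0.
have pp : 4 <= pi ^+ 2 :> R by have := pi_ge2 R; nra.
have p3 : 3 <= 4 * pi ^+ 2 :> R by lra.
have mu1 := mu0_abs.
have K20 : 0 < K2 by exact: lt_le_trans ltr01 K21.
(* For tau <= 1 / K2 the error [r] in the logarithm of the partition function is at most 1, so e^r
   <= 3. *)
exists (3 * K + 3 * K2 * kap), (Num.min tau1 (K2^-1)), B; split.
- have h3 : 0 < 3 :> R by exact: ltr0Sn.
  exact: addr_gt0 (mulr_gt0 h3 K0) (mulr_gt0 (mulr_gt0 h3 K20) kap0).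
- by rewrite lt_min t10 invr_gt0.
move=> tau J n m large sJ; rewrite le_min => /andP[tt0 tK] en.
have [adm _ _] := large; have [/andP[t0 t1] _ _] := adm.
have [_ _ _ hz] := hmom tau J adm.
have h := hloc tau J n m large sJ tt0 en.
set lZ := msum _ _ _ _ _ in hz h.
set T := tau ^+ 2 in hz h *.
have T0 : 0 < T by rewrite exprn_gt0.
set A : R := (set_count _ _ _ _ _ _)%:R in h *.
set r := lZ - _ in hz.
have r1 : `|r| <= 1.
  apply: (le_trans hz); rewrite /T expr2 mulrA.
  have h1 : K2 * tau <= 1 by rewrite -(@ler_pM2l _ K2^-1) ?invr_gt0 ?mulKf ?gt_eqF ?mulr1.
  by rewrite -[leRHS]mulr1; apply: ler_pM => //; [apply: mulr_ge0; exact: ltW | exact: ltW].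
set E := expR (- (N%:R * T / 2 * (mean tau - m%:~R) ^+ 2)) in h.
have E1 : E <= 1.
  by rewrite -expR0 ler_expR oppr_le0 mulr_ge0 ?sqr_ge0 // divr_ge0 // mulr_ge0 // ltW.
have E0 : 0 <= E by exact: expR_ge0.
pose P := expR ((2 * N%:R)^-1 - tau * (m%:~R - mu0)).
have P0 : 0 < P by exact: expR_gt0.
have PE : P * E = expR (- (N%:R * T / 2 * (m%:~R - mu0) ^+ 2)).
  by rewrite /P /E -expRD; congr expR; rewrite /mean /T; field; rewrite !gt_eqF.
have P3 : P <= 3 * expR (- (tau * m%:~R)).
  apply: (@le_trans _ _ (expR 1 * expR (- (tau * m%:~R)))).
    have : tau * mu0 <= 1 / 2 by move: mu1; clear - t0 t1 hN halpha hbeta hab N0; rewrite ler_norml => /andP[_ q]; nra.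
    by rewrite -expRD ler_expR; clear - n21 hN halpha hbeta hab N0; lra.
  by apply: ler_wpM2r; [exact: expR_ge0 | exact: exp1_le3].
set w := expR _ * A in h.
have Aw : A = gsize tau * (P / (4 * pi ^+ 2) * (expR r * (4 * pi ^+ 2 * w))).
  rewrite /w.
  have gen (a b q u v z : R) : q != 0 -> a * (b / q * (u * (q * (v * z)))) = a * b * u * v * z.
    by move=> q0; field.
  rewrite gen; last by rewrite mulf_neq0 ?expf_neq0 // gt_eqF.
  rewrite /gsize /P -!expRD -en /energy [X in expR X](_ : _ = 0) ?expR0 ?mul1r //.
  by rewrite /r -/T; field; rewrite !gt_eqF.
have ker : gcoef = kap / (4 * pi ^+ 2).
  have gen (x y z : R) : x != 0 -> y != 0 -> z != 0 -> (4 * x * y * z)^-1 = x / (y * z) / (4 * x ^+ 2).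
    by move=> x0 y0 z0; field; rewrite x0 y0 z0.
  by rewrite /gcoef /kap gen ?gt_eqF //.
rewrite -PE ker [X in `|X - _|]Aw.
have -> : gsize tau * (P / (4 * pi ^+ 2) * (expR r * (4 * pi ^+ 2 * w))) - gsize tau * (kap / (4 * pi ^+ 2) * tau ^+ 4 * (P * E))
  = gsize tau * (P / (4 * pi ^+ 2) * (expR r * (4 * pi ^+ 2 * w - kap * tau ^+ 4 * E) + (expR r - 1) * (kap * tau ^+ 4 * E))) by ring.
rewrite normrM (gtr0_norm (expR_gt0 _)); apply: ler_wpM2l; first exact: expR_ge0.
have P40 : 0 < P / (4 * pi ^+ 2) by rewrite divr_gt0 // mulr_gt0 // exprn_gt0.
rewrite normrM (gtr0_norm P40) [leRHS]mulrC; apply: ler_pM => //; first exact: ltW.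
  rewrite ler_pdivrMr; last by rewrite mulr_gt0 // exprn_gt0.
  by apply: (le_trans P3); rewrite mulrC; apply: ler_wpM2l; [exact: expR_ge0 | exact: p3].
have er3 : expR r <= 3 by apply: le_trans (exp1_le3 R); rewrite ler_expR; move: r1; rewrite ler_norml => /andP[].
have er1 : `|expR r - 1| <= 3 * (K2 * T).
  apply: (le_trans (expR_taylor1 _)); rewrite [leRHS]mulrC; apply: ler_pM; [exact: normr_ge0 | exact: expR_ge0 | exact: hz |].
  apply: le_trans (exp1_le3 R); rewrite ler_expR ge_max ler01 /=.
  by move: r1; rewrite ler_norml => /andP[].
have t40 : 0 <= kap * tau ^+ 4 by rewrite mulr_ge0 ?exprn_ge0 // ltW.
have t4 : `|kap * tau ^+ 4 * E| <= kap * tau ^+ 4.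
  by rewrite (ger0_norm (mulr_ge0 t40 E0)); exact: ler_piMr.
have -> : (3 * K + 3 * K2 * kap) * tau ^+ 6 = 3 * (K * tau ^+ 6) + 3 * (K2 * T) * (kap * tau ^+ 4) by rewrite /T; ring.
apply: (le_trans (ler_normD _ _)); apply: lerD; rewrite normrM.
  by rewrite (gtr0_norm (expR_gt0 _)); apply: ler_pM => //; exact: expR_ge0.
exact: ler_pM.
Qed.

(** The step s = tau sqrt (N/2) turns the Gaussian into e^{-t^2}. The errors tau^6 e^{-tau m} over m
    >= c form a geometric series of size e^X / tau, so tau^5 remains against a main term of order
    tau^3. *)
Lemma tail_estimate (X : R) : 0 <= X -> exists K tau0 B : R, [/\ 0 < K, 0 < tau0 & forall tau J n (c : R),
  large_enough N tau J -> B <= N%:R * tau ^+ 2 * J%:R -> tau <= tau0 -> energy tau = n%:R ->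
  `|tau * c| <= X -> exists L0 : nat, forall L : nat, (L0 <= L)%N ->
  let k := Num.sqrt (N%:R / 2) in
  `|\sum_(i < L) (set_count N alpha beta (N * J) n (Num.ceil c + i%:Z))%:R
    - gsize tau * (gcoef / k * tau ^+ 3 * (gtail (tau * k * c)
        + tau * k * (1 / 2 + mu0 - ((Num.ceil c)%:~R - c)) * gauss_fun (tau * k * c)))|
  <= gsize tau * (K * tau ^+ 5)].
Proof.
move=> X0; have [K1 [tau1 [B [K10 t10 hcount]]]] := count_estimate.
set k := Num.sqrt (N%:R / 2).
have k0 : 0 < k by rewrite sqrtr_gt0 divr_gt0.
have kk : k ^+ 2 = N%:R / 2 by rewrite sqr_sqrtr // divr_ge0 // ltW.
have kX : 0 <= k * X by rewrite mulr_ge0 // ltW.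
have [K2 K20 hgauss] := @gauss_sum R (k * X) kX.
have g0 : 0 < gcoef.
  have cd0 : 0 < cdilog R by rewrite /cdilog divr_gt0 // exprn_gt0 // pi_gt0.
  rewrite invr_gt0; apply: mulr_gt0; last by rewrite sqrtr_gt0 invr_gt0 mulr_gt0.
  by apply: mulr_gt0; [apply: mulr_gt0; [exact: ltr0Sn | exact: pi_gt0] | rewrite sqrtr_gt0].
exists (2 * K1 * expR X + gcoef * k * K2), (Num.min tau1 (1 / 2)), B; split.
- by rewrite addr_gt0 // !mulr_gt0 // expR_gt0.
- by rewrite lt_min t10 divr_gt0.
move=> tau J n c large sJ; rewrite le_min => /andP[tt0 t12] en hc.
have [[/andP[t0 t1] _ _] N4 _] := large.
have mu1 := mu0_abs.
set M := Num.ceil c.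
have Mc : c <= M%:~R by exact: ceil_ge.
have Mc1 : M%:~R - c <= 1.
  by have /andP[q _] := ceil_itv c; move: q; rewrite -/M intrB; lra.
pose s := tau * k.
have s0 : 0 < s by rewrite mulr_gt0.
have s1 : s <= 1.
  have : s ^+ 2 <= 1 by rewrite exprMn kk; lra.
  by move=> q; rewrite leNgt; apply/negP => s1; nra.
have s01 : 0 < s <= 1 by rewrite s0.
(* The offset of the first sampling point from s c, due to the ceiling and to the centre [mu0]; the
   first lies in [0, 1] and the second is at most 1/2 in absolute value. *)
pose delta := s * ((M%:~R - c) - mu0).
have hd : `|delta| <= 2 * s.
  rewrite normrM (gtr0_norm s0) mulrC; apply: ler_wpM2r; first exact: ltW.
  by move: mu1; clear - Mc Mc1 hN halpha hbeta hab N0; rewrite !ler_norml => /andP[? ?]; apply/andP; split; lra.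
have hy : `|s * c| <= k * X.
  by rewrite /s mulrAC normrM (gtr0_norm k0) mulrC; apply: ler_wpM2l => //; exact: ltW.
have [L0 hL0] := hgauss s (s * c) delta s01 hy hd.
exists L0 => L /hL0 {hL0}hL; cbv zeta; rewrite -/s.
set G := \sum_(_ < _) _ in hL.
set main := gtail (s * c) + _.
have mainE : gtail (s * c) + (s / 2 - delta) * gauss_fun (s * c) = main.
  by rewrite /main /delta -/M; ring.
rewrite mainE in hL.
have e1 : gsize tau * (gcoef * tau ^+ 4 * G) = \sum_(i < L) gsize tau *
    (gcoef * tau ^+ 4 * expR (- (N%:R * tau ^+ 2 / 2 * ((M + i%:Z)%:~R - mu0) ^+ 2))).
  rewrite /G !mulr_sumr; apply: eq_bigr => i _; congr (_ * (_ * _)); rewrite /gauss_fun; congr expR.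
  rewrite (_ : N%:R * tau ^+ 2 / 2 = s ^+ 2); last by rewrite exprMn kk; ring.
  by rewrite intrD /delta /=; ring.
have h1 : `|\sum_(i < L) (set_count N alpha beta (N * J) n (M + i%:Z))%:R - gsize tau * (gcoef * tau ^+ 4 * G)|
    <= gsize tau * (2 * K1 * expR X * tau ^+ 5).
  rewrite e1 -sumrB; apply: (le_trans (ler_norm_sum _ _ _)).
  apply: (@le_trans _ _ (\sum_(i < L) gsize tau * (K1 * tau ^+ 6 * expR X) * expR (- (tau * i%:R)))).
    apply: ler_sum => i _; apply: (le_trans (hcount tau J n _ large sJ tt0 en)).
    rewrite -[leRHS]mulrA; apply: ler_wpM2l; first exact: expR_ge0.
    rewrite -[leRHS]mulrA; apply: ler_wpM2l; first by rewrite mulr_ge0 ?exprn_ge0 // ltW.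
    rewrite -expRD ler_expR intrD mulrDr opprD; apply: lerD => //.
    by move: hc; rewrite ler_norml => /andP[q _]; have := ler_wpM2l (ltW t0) Mc; clear - q hN halpha hbeta hab N0; lra.
  rewrite -mulr_sumr -[leLHS]mulrA; apply: ler_wpM2l; first exact: expR_ge0.
  have t01 : 0 < tau <= 1 / 2 by rewrite t0.
  have := exp_sum_bound L t01; rewrite ler_pdivlMr // => q.
  have q0 : 0 <= K1 * tau ^+ 5 * expR X by rewrite !mulr_ge0 ?exprn_ge0 ?expR_ge0 // ltW.
  by have := ler_wpM2l q0 q; rewrite /=; lra.
have h2 : `|gsize tau * (gcoef * tau ^+ 4 * G) - gsize tau * (gcoef / k * tau ^+ 3 * main)|
    <= gsize tau * (gcoef * k * K2 * tau ^+ 5).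
  have -> : gsize tau * (gcoef * tau ^+ 4 * G) - gsize tau * (gcoef / k * tau ^+ 3 * main)
    = gsize tau * (gcoef / k * tau ^+ 3 * (s * G - main)) by rewrite /s; field; rewrite gt_eqF.
  rewrite normrM (gtr0_norm (expR_gt0 _)); apply: ler_wpM2l; first exact: expR_ge0.
  have q0 : 0 <= gcoef / k * tau ^+ 3 by rewrite mulr_ge0 ?exprn_ge0 ?divr_ge0 // ltW.
  rewrite normrM (ger0_norm q0).
  have -> : gcoef * k * K2 * tau ^+ 5 = gcoef / k * tau ^+ 3 * (K2 * s ^+ 2).
    by rewrite /s; field; rewrite gt_eqF.
  exact: ler_wpM2l.
apply: le_trans (ler_distD (gsize tau * (gcoef * tau ^+ 4 * G)) _ _) _.
apply: (le_trans (lerD h1 h2)); rewrite -mulrDr; apply: ler_wpM2l; first exact: expR_ge0.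
by rewrite [leRHS]mulrDl lexx.
Qed.
End CountTail.

(** * Partitions as sets of indices *)

Section Partitions.
Variables N alpha beta : nat.
Local Open Scope nat_scope.

Definition parts n0 (S : {set 'I_n0}) : seq nat := [seq (val k).+1 | k <- rev (enum S)].

Lemma mem_parts n0 (S : {set 'I_n0}) (k : 'I_n0) : (k.+1 \in parts S) = (k \in S).
Proof.
rewrite /parts (mem_map (f := fun k : 'I_n0 => (val k).+1)) ?mem_rev ?mem_enum //.
by move=> i j [] /val_inj.
Qed.

Lemma parts_sorted n0 (S : {set 'I_n0}) : sorted gtn (parts S).
Proof.
rewrite /parts map_rev rev_sorted sorted_map; apply: sorted_filter.
  by move=> y x z; exact: ltn_trans.
have := iota_ltn_sorted 0 n0; rewrite -val_enum_ord sorted_map enumT.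
by apply: sub_sorted => x y.
Qed.

Lemma parts_gt0 n0 (S : {set 'I_n0}) : all (leq 1) (parts S).
Proof. by apply/allP => x /mapP[k _ ->]. Qed.

Lemma big_parts (V : nmodType) n0 (S : {set 'I_n0}) (F : nat -> V) :
  (\sum_(x <- parts S) F x = \sum_(k in S) F k.+1)%R.
Proof. by rewrite big_map (perm_big (enum S)) ?perm_rev // big_enum. Qed.

Lemma sumn_parts n0 (S : {set 'I_n0}) : sumn (parts S) = weight_sum S.
Proof. by rewrite sumnE big_parts. Qed.

Lemma pd_sum_seq (s : seq nat) : pd alpha beta N s = (\sum_(x <- s) ieps N alpha beta x)%R.
Proof.
rewrite /pd /ieps sumrB.
by congr (_ - _)%R; elim: s => [|x s IH] /=; rewrite ?big_nil // big_cons PoszD IH.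
Qed.

Lemma pd_parts n0 (S : {set 'I_n0}) : pd alpha beta N (parts S) = pd_sum N alpha beta S.
Proof. by rewrite pd_sum_seq big_parts. Qed.

Lemma parts_inj n0 : injective (@parts n0).
Proof. by move=> S1 S2 e; apply/setP => k; rewrite -!mem_parts e. Qed.

Lemma parts_surj n0 n (lam : seq nat) : n <= n0 -> distinct_partitions n lam ->
  exists S : {set 'I_n0}, lam = parts S.
Proof.
move=> hn [slam lam1 sumlam].
have memlam x : x \in lam -> x <= n0.
  by move=> xlam; apply: leq_trans hn; rewrite -sumlam (perm_sumn (perm_to_rem xlam)) /= leq_addr.
exists [set k : 'I_n0 | k.+1 \in lam]%SET.
have gtn_tr : transitive gtn by move=> y x z /= yx zy; exact: ltn_trans yx.
have gtn_irr : irreflexive gtn by move=> x /=; rewrite ltnn.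
apply: (irr_sorted_eq gtn_tr gtn_irr) => //; first exact: parts_sorted.
move=> x; case: x => [|x].
  transitivity false; first by apply/negP => /(allP lam1).
  by apply/esym/negP => /(allP (parts_gt0 _)).
have [xn|nx] := ltnP x n0; last first.
  transitivity false; first by apply/negP => /memlam; rewrite leqNgt ltnS nx.
  by apply/esym/negP => /mapP[k _ [e]]; have := ltn_ord k; rewrite -e ltnNge nx.
by rewrite -[x]/(val (Ordinal xn)) mem_parts inE.
Qed.

Lemma ieps_abs k : `|ieps N alpha beta k| <= 1.
Proof. by rewrite /ieps; case: eqP; case: eqP. Qed.

Lemma pd_sum_abs n0 (S : {set 'I_n0}) : `|pd_sum N alpha beta S| <= n0.
Proof.
apply: (@leq_trans (\sum_(k in S) 1)); last first.
  by rewrite sum1_card -[leqRHS]card_ord max_card.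
rewrite /pd_sum; elim/big_ind2: _ => // [a b x y ha hb|k _]; last exact: ieps_abs.
by apply: leq_trans (leq_add ha hb); rewrite -lez_nat PoszD !abszE ler_normD.
Qed.

Lemma d_pd_card (R : realType) (c : R) n n0 : n <= n0 ->
  d_pd alpha beta N c n = #|[pred S : {set 'I_n0} | (weight_sum S == n) && (Num.ceil c <= pd_sum N alpha beta S)%R]|.
Proof.
move=> hn; set P := [pred S | _]; rewrite /d_pd.
set A := [set lam | _]%classic.
have finA : finite_set A by apply: sub_finite_set (finite_distinct_partitions n) => lam [].
have perm : perm_eq (enum_fset (fset_set A)) [seq parts T | T <- enum P].
  apply: uniq_perm; first exact: fset_uniq.
    by rewrite map_inj_uniq ?enum_uniq //; exact: parts_inj.
  move=> lam; rewrite in_fset_set //; apply/idP/mapP.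
    rewrite inE => -[hlam hc]; have [S e] := parts_surj hn hlam.
    exists S => //; rewrite mem_enum inE /= -pd_parts -e ceil_le_int hc andbT -sumn_parts -e.
    by case: hlam => _ _ ->.
  move=> [S]; rewrite mem_enum inE /= => /andP[/eqP h1 h2] ->.
  split; last by rewrite pd_parts -ceil_le_int.
  by split; [exact: parts_sorted | exact: parts_gt0 | rewrite sumn_parts].
by rewrite (perm_size perm) size_map -cardE.
Qed.

(** The values of [pd] are bounded by n0, so every sufficiently long sum over m is the full one.
    Leaving the length open lets it also meet the demand of [tail_estimate]. *)
Lemma d_pd_count (R : realType) (c : R) n n0 : n <= n0 -> exists L0, forall L, L0 <= L ->
  d_pd alpha beta N c n = \sum_(i < L) set_count N alpha beta n0 n (Num.ceil c + i%:Z)%R.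
Proof.
move=> hn; set M := Num.ceil c; exists (n0 + `|M|).+1 => -[//|L] hL.
rewrite (d_pd_card _ hn) -sum1_card.
(* The default value 0 of [inord] never intervenes: [hS] keeps the index below L + 1. *)
rewrite (partition_big (fun S : {set 'I_n0} => inord `|pd_sum N alpha beta S - M| : 'I_L.+1) xpredT) //=.
apply: eq_bigr => i _; rewrite /set_count -sum1_card; apply: eq_bigl => S; rewrite !inE -/M.
have hS : `|pd_sum N alpha beta S - M| < L.+1.
  apply: leq_ltn_trans (_ : _ <= n0 + `|M|) hL.
  by apply: (leq_trans (leqD_dist _ 0 _)); rewrite subr0 sub0r abszN leq_add2r pd_sum_abs.
rewrite -andbA; congr (_ && _); apply/andP/eqP => [[h1 /eqP h2]|h].
  by rewrite -h2 inordK // gez0_abs ?subr_ge0 // [RHS]addrC subrK.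
by rewrite h lerDl; split => //; apply/eqP/val_inj; rewrite /= addrAC subrr add0r absz_nat inordK.
Qed.
End Partitions.

(** * The theorem *)

Section Normalization.
Variable R : realType.
Variables N alpha beta : nat.
Hypothesis N_gt0 : (0 < N)%N.
Local Notation mu0 := (@mu0 R N alpha beta).
Variables theta r tau : R.
Hypotheses (theta0 : 0 < theta) (theta4 : theta ^+ 4 = 3) (r0 : 0 < r).
Hypothesis tauE : tau = Num.sqrt pi / (Num.sqrt 2 * theta * r).

Let p := Num.sqrt (pi : R).
Let h := Num.sqrt (2 : R).
Let q := Num.sqrt (N%:R : R).
Let N0 : 0 < N%:R :> R. Proof. by rewrite ltr0n. Qed.
Let p0 : 0 < p. Proof. by rewrite sqrtr_gt0 pi_gt0. Qed.
Let h0 : 0 < h. Proof. by rewrite sqrtr_gt0. Qed.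
Let q0 : 0 < q. Proof. by rewrite sqrtr_gt0. Qed.
Let p2 : p ^+ 2 = pi. Proof. by rewrite sqr_sqrtr // pi_ge0. Qed.
Let h2 : h ^+ 2 = 2. Proof. by rewrite sqr_sqrtr. Qed.
Let q2 : q ^+ 2 = N%:R. Proof. by rewrite sqr_sqrtr // ltW. Qed.

Lemma tau_sqr : tau ^+ 2 = pi / (2 * theta ^+ 2 * r ^+ 2).
Proof. by rewrite tauE -/p -/h -p2 -h2; field; rewrite !gt_eqF. Qed.

Lemma energy_tau : energy tau = r ^+ 4.
Proof.
rewrite /energy tau_sqr /cdilog.
have -> : (12 : R) = 4 * theta ^+ 4 by rewrite theta4; ring.
by move: (pi_gt0 R); move: (pi : R) => P P0; field; rewrite !gt_eqF.
Qed.

Lemma sqrt_cdilog : Num.sqrt (cdilog R) = pi / (2 * theta ^+ 2).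
Proof.
have e : cdilog R = (pi / (2 * theta ^+ 2)) ^+ 2.
  rewrite /cdilog; have -> : (12 : R) = 4 * theta ^+ 4 by rewrite theta4; ring.
  by field; rewrite !gt_eqF.
by rewrite e sqrtr_sqr ger0_norm // divr_ge0 ?pi_ge0 // mulr_ge0 // sqr_ge0.
Qed.

Lemma gsize_tau : gsize tau = expR (pi * (r ^+ 2 / theta ^+ 2)) / h.
Proof.
rewrite /gsize expRD; congr (_ * _).
  congr expR; rewrite tau_sqr /cdilog.
  have -> : (12 : R) = 4 * theta ^+ 4 by rewrite theta4; ring.
  by move: (pi_gt0 R); move: (pi : R) => P P0; field; rewrite !gt_eqF.
rewrite expRN; congr (_^-1).
have e0 := expR_gt0 (ln 2 / 2 : R).
have : expR (ln 2 / 2) ^+ 2 = h ^+ 2.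
  by rewrite h2 -expRM_natl mulrC divfK // lnK // posrE.
by move=> /eqP; rewrite eqrXn2 // ?ltW // => /eqP.
Qed.

Lemma sqrt_half : Num.sqrt (N%:R / 2) = q / h.
Proof. by rewrite sqrtrM ?ltW // sqrtrV. Qed.

Lemma gcoef_tau : gcoef R N / Num.sqrt (N%:R / 2) = theta ^+ 2 / pi ^+ 2.
Proof.
rewrite /gcoef sqrt_cdilog sqrt_half.
have -> : Num.sqrt ((2 * N%:R)^-1) = (h * q)^-1 by rewrite sqrtrV ?mulr_ge0 // ?ltW // sqrtrM.
have -> : theta ^+ 2 / pi ^+ 2 = h ^+ 2 * theta ^+ 2 / (2 * pi ^+ 2) by rewrite h2; move: (pi_gt0 R); move: (pi : R) => P P0; field; rewrite ?gt_eqF.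
by move: h0 q0 (pi_gt0 R); move: (pi : R) h q => P x y x0 y0 P0; field; rewrite !gt_eqF.
Qed.

Lemma erfc_gtail (x : R) : erfc x = 2 / p * gtail x.
Proof. by []. Qed.

(* The value of the main term of [tail_estimate] in terms of [r = n^(1/4)] and
   [theta = 3^(1/4)]. *)
Lemma main_term (c0 delta : R) :
  let k := Num.sqrt (N%:R / 2) in
  gsize tau * (gcoef R N / k * tau ^+ 3 * (gtail (tau * k * (c0 * r))
    + tau * k * (1 / 2 + mu0 - delta) * gauss_fun (tau * k * (c0 * r)))) =
  expR (pi * (r ^+ 2 / theta ^+ 2)) * r ^- 3 *
  (1 / (8 * theta) * erfc (c0 * Num.sqrt (pi * N%:R) / (2 * theta))
   + expR (- (c0 ^+ 2 * pi * N%:R / (4 * theta ^+ 2))) / (16 * (theta ^+ 2 * q))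
     * (beta%:R - alpha%:R + N%:R - 2 * N%:R * delta) * r^-1).
Proof.
cbv zeta; rewrite gcoef_tau gsize_tau sqrt_half erfc_gtail sqrtrM ?pi_ge0 // -/p -/q.
have y1 : tau * (q / h) * (c0 * r) = c0 * (p * q) / (2 * theta).
  rewrite tauE -/p -/h; have -> : c0 * (p * q) / (2 * theta) = c0 * (p * q) / (h ^+ 2 * theta) by rewrite h2.
  by field; rewrite !gt_eqF.
rewrite y1; set y := c0 * (p * q) / (2 * theta).
have -> : expR (- (c0 ^+ 2 * pi * N%:R / (4 * theta ^+ 2))) = gauss_fun y.
  by rewrite /gauss_fun /y -p2 -q2; congr expR; field; rewrite gt_eqF.
rewrite /mu0; set g := gauss_fun y; set G := gtail y; set e := expR _.
rewrite tauE -/p -/h -p2 -q2.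
(* The numerals are written through h^2 = 2 so that the identity becomes one of rational functions
   in h. *)
have -> : 1 / (8 * theta) = 1 / (2 * h ^+ 2 * h ^+ 2 * theta) by rewrite h2; congr (_ / _); ring.
have -> : 16 * (theta ^+ 2 * q) = 2 * h ^+ 2 * h ^+ 2 * h ^+ 2 * (theta ^+ 2 * q) by rewrite h2; ring.
clearbody e g G; move: h0 p0 q0; move: h p q => x u v x0 u0 v0.
by field; rewrite !gt_eqF.
Qed.
End Normalization.

Section Final.
Variable R : realType.

(** All estimates are uniform in J, which may therefore be taken as large as needed; n <= N J
    ensures that no partition of n is lost. *)
Lemma enough_parts (N : nat) (tau B : R) (n : nat) : (0 < N)%N -> 0 < tau <= 1 -> N%:R * tau ^+ 2 <= 1 / 4 ->
  exists J, [/\ large_enough N tau J, B <= N%:R * tau ^+ 2 * J%:R & (n <= N * J)%N].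
Proof.
move=> N0 t01 s4; have /andP[t0 t1] := t01.
set s := N%:R * tau ^+ 2 in s4 *.
have s0 : 0 < s by rewrite mulr_gt0 ?ltr0n // exprn_gt0.
have s20 : 0 < s / 2 by rewrite divr_gt0.
have e0 : 0 < s ^+ 2 by rewrite exprn_gt0.
have [J0 hJ0] := exp_small 0 s20 e0.
have reach (b : R) : exists J1 : nat, b <= s * J1%:R.
  exists (Num.truncn (`|b| / s)).+1.
  have q0 : 0 <= `|b| / s by rewrite divr_ge0 // ltW.
  have /andP[_] := truncn_itv q0; rewrite ltr_pdivrMr // mulrC => /ltW; apply: le_trans; exact: ler_norm.
have [J1 hJ1] := reach B; have [J2 hJ2] := reach 1.
exists (J0 + J1 + J2 + n)%N; split.
- split => //; last first.
    by apply: (le_trans hJ2); apply: ler_wpM2l; [exact: ltW | rewrite ler_nat; lia].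
  split => //; first by rewrite -/s; lra.
  rewrite -/s mulNr mulrAC -[leLHS]/(expR _); have := hJ0 (J0 + J1 + J2 + n)%N.
  by rewrite add0r; apply; lia.
- by apply: (le_trans hJ1); apply: ler_wpM2l; [exact: ltW | rewrite ler_nat; lia].
- by apply: (@leq_trans (1 * (J0 + J1 + J2 + n))); [rewrite mul1n leq_addl | rewrite leq_mul2r N0 orbT].
Qed.

Lemma quartic_root (n : nat) : (n%:R `^ (1 / 4)) ^+ 4 = n%:R :> R.
Proof. by rewrite -powR_mulrn ?powR_ge0 // -powRrM div1r mulVf // powRr1. Qed.

Lemma tau_small (x e : R) : 0 < e -> 0 <= x -> \forall n \near \oo, x / n%:R `^ (1 / 4) <= e.
Proof.
move=> e0 x0; near=> n.
have n0 : (0 < n)%N by near: n; exact: nbhs_infty_gt.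
have r0 : 0 < n%:R `^ (1 / 4) :> R by rewrite powR_gt0 // ltr0n.
have r4 := quartic_root n.
set r := _ `^ _ in r0 r4 *; rewrite ler_pdivrMr // mulrC -ler_pdivrMr //.
have : (x / e) ^+ 4 <= n%:R by near: n; exact: nbhs_infty_ger.
by rewrite -r4 ler_pXn2r // nnegrE ?divr_ge0 // ltW.
Unshelve. all: by end_near. Qed.
End Final.

Theorem theorem1p2 (R : realType) (N alpha beta : nat) (c0 : R)
    (hN : N = 2%N \/ (5 <= N)%N)
    (halpha : (1 <= alpha <= N)%N) (hbeta : (1 <= beta <= N)%N)
    (hab : alpha <> beta) :
  let c (n : nat) : R := c0 * n%:R `^ (1 / 4) in
  let partial (n : nat) : R := (Num.ceil (c n))%:~R - c n in
  exists2 E : nat -> R,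
    E =O_\oo (fun n => n%:R `^ (- (1 / 2)) : R) &
    \forall n \near \oo,
      (d_pd alpha beta N (c n) n)%:R =
      expR (pi * Num.sqrt (n%:R / 3)) * n%:R `^ (- (3 / 4))
      * (1 / (8 * 3 `^ (1 / 4))
           * erfc (c0 * Num.sqrt (pi * N%:R) / (2 * 3 `^ (1 / 4)))
         + expR (- (c0 ^+ 2 * pi * N%:R / (4 * Num.sqrt 3)))
             / (16 * Num.sqrt (3 * N%:R))
           * (beta%:R - alpha%:R + N%:R - 2 * N%:R * partial n)
           * n%:R `^ (- (1 / 4))
         + E n).
Proof.
move=> c partial.
have N0 : (0 < N)%N by case/andP: halpha; exact: leq_trans.
pose theta : R := 3 `^ (1 / 4).
have theta0 : 0 < theta by exact: powR_gt0.
have theta4 : theta ^+ 4 = 3 by exact: (quartic_root R 3).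
have h0 : 0 < Num.sqrt 2 :> R by rewrite sqrtr_gt0.
have p0 : 0 < Num.sqrt pi :> R by rewrite sqrtr_gt0 pi_gt0.
(* The constant x = tau n^{1/4}. Then tau times the threshold is c0 x, which supplies the X of
   [tail_estimate]. *)
pose x : R := Num.sqrt pi / (Num.sqrt 2 * theta).
have x0 : 0 < x by rewrite divr_gt0 // mulr_gt0.
have X0 : 0 <= `|c0| * x by rewrite mulr_ge0 // ltW.
have [K [tau0 [B [K0 t00 htail]]]] := tail_estimate hN halpha hbeta hab X0.
pose pref (n : nat) : R := expR (pi * Num.sqrt (n%:R / 3)) * n%:R `^ (- (3 / 4)).
pose main (n : nat) : R := 1 / (8 * theta) * erfc (c0 * Num.sqrt (pi * N%:R) / (2 * theta))
   + expR (- (c0 ^+ 2 * pi * N%:R / (4 * Num.sqrt 3))) / (16 * Num.sqrt (3 * N%:R))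
     * (beta%:R - alpha%:R + N%:R - 2 * N%:R * partial n) * n%:R `^ (- (1 / 4)).
have pref_gt0 (n : nat) : (0 < n)%N -> 0 < pref n.
  by move=> n0; rewrite mulr_gt0 ?expR_gt0 // powR_gt0 // ltr0n.
exists (fun n => (d_pd alpha beta N (c n) n)%:R / pref n - main n); last first.
  near=> n; have n0 : (0 < n)%N by near: n; exact: nbhs_infty_gt.
  rewrite -/(pref n) -/theta -/(main n); set d := (d_pd _ _ _ _ _)%:R.
  by rewrite [main n + _]addrC subrK mulrC divfK // gt_eqF // pref_gt0.
(* The error [gsize tau] * K tau^5 divided by the prefactor: the exponentials cancel up to 1 / sqrt
   2, and x^5 n^{-5/4} n^{3/4} leaves n^{-1/2}. *)
apply/eqO_exP; exists (K * x ^+ 5 / Num.sqrt 2); first by rewrite divr_gt0 // mulr_gt0 // exprn_gt0.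
(* The bound 1 / (4 N) on tau gives N tau^2 <= 1/4, as [large_enough] requires. *)
have e0 : 0 < Num.min tau0 (1 / (4 * N%:R)) by rewrite lt_min t00 divr_gt0 // mulr_gt0 // ltr0n.
have small := tau_small e0 (ltW x0).
near=> n; have n0 : (0 < n)%N by near: n; exact: nbhs_infty_gt.
have : x / n%:R `^ (1 / 4) <= Num.min tau0 (1 / (4 * N%:R)) by near: n; exact: small.
rewrite le_min => /andP[tt0 tN].
pose r : R := n%:R `^ (1 / 4).
have r0 : 0 < r by rewrite powR_gt0 // ltr0n.
have r4 : r ^+ 4 = n%:R by exact: quartic_root.
pose tau := x / r; rewrite -/r -/tau in tt0 tN.
have NR : 1 <= N%:R :> R by rewrite ler1n.
have t0 : 0 < tau by rewrite divr_gt0.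
have tN' : N%:R * tau <= 1 / 4.
  by move: tN; rewrite ler_pdivlMr ?mulr_gt0 //; lra.
have t1 : tau <= 1 by nra.
have t4 : N%:R * tau ^+ 2 <= 1 / 4.
  by apply: le_trans tN'; rewrite expr2 mulrA ler_piMr // mulr_ge0 // ltW.
have t01 : 0 < tau <= 1 by rewrite t0.
have [J [large sJ nJ]] := enough_parts B n N0 t01 t4.
have tauE : tau = Num.sqrt pi / (Num.sqrt 2 * theta * r).
  by rewrite /tau /x; field; rewrite !gt_eqF.
have en : energy tau = n%:R by rewrite -r4; exact: (energy_tau theta0 theta4 r0 tauE).
have hc : `|tau * c n| <= `|c0| * x.
  rewrite (_ : tau * c n = c0 * x); last by rewrite /tau /c -/r; field; rewrite gt_eqF.
  by rewrite normrM (gtr0_norm x0).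
have [L1 hL1] := htail tau J n (c n) large sJ tt0 en hc.
have [L2 hL2] := d_pd_count N alpha beta (c n) nJ.
have := hL1 (maxn L1 L2) (leq_maxl _ _).
cbv zeta; rewrite -natr_sum -(hL2 _ (leq_maxr _ _)).
rewrite [c n]/(c0 * r) -/(c n) (main_term alpha beta N0 theta0 theta4 r0 tauE) -/(partial n).
have th2 : Num.sqrt 3 = theta ^+ 2.
  have e : theta ^+ 4 = (theta ^+ 2) ^+ 2 by rewrite -exprM.
  by rewrite -theta4 e sqrtr_sqr ger0_norm // sqr_ge0.
have sn : Num.sqrt (n%:R / 3) = r ^+ 2 / theta ^+ 2.
  rewrite -r4 -theta4 (_ : r ^+ 4 / theta ^+ 4 = (r ^+ 2 / theta ^+ 2) ^+ 2).
    by rewrite sqrtr_sqr ger0_norm // divr_ge0 // sqr_ge0.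
  by field; rewrite gt_eqF.
have pw (k : nat) (a : R) : a = 1 / 4 * k%:R -> n%:R `^ (- a) = r ^- k.
  by move=> ->; rewrite powRN powRrM powR_mulrn // ltW.
have p34 : n%:R `^ (- (3 / 4)) = r ^- 3 :> R by apply: (pw 3%N); field.
have p14 : n%:R `^ (- (1 / 4)) = r ^-1 :> R by have := pw 1%N (1 / 4); rewrite expr1 => -> //; rewrite mulr1.
have p12 : n%:R `^ (- (1 / 2)) = r ^- 2 :> R by apply: (pw 2%N); field.
have prefE : pref n = expR (pi * (r ^+ 2 / theta ^+ 2)) * r ^- 3 by rewrite /pref sn p34.
rewrite -prefE.
have -> : 1 / (8 * theta) * erfc (c0 * Num.sqrt (pi * N%:R) / (2 * theta))
   + expR (- (c0 ^+ 2 * pi * N%:R / (4 * theta ^+ 2))) / (16 * (theta ^+ 2 * Num.sqrt N%:R))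
     * (beta%:R - alpha%:R + N%:R - 2 * N%:R * partial n) * r^-1 = main n.
  by rewrite /main th2 p14 sqrtrM // th2.
rewrite (gsize_tau theta0 theta4 r0 tauE).
set d := (d_pd _ _ _ _ _)%:R => hd.
have P0 := pref_gt0 n n0.
have -> : d / pref n - main n = (d - pref n * main n) / pref n.
  by rewrite mulrBl [pref n * _]mulrC mulfK // gt_eqF.
rewrite normrM normfV (gtr0_norm P0) ler_pdivrMr // p12.
rewrite (ger0_norm (_ : 0 <= r ^- 2)) ?invr_ge0 ?sqr_ge0 //.
apply: (le_trans hd); rewrite prefE le_eqVlt; apply/orP; left; apply/eqP.
by rewrite /tau; field; rewrite !gt_eqF.
Unshelve. all: by end_near.
Qed.
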